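(* Let $M$ be a closed connected 7-dimensional spin manifold. Let $g_t$ be a smooth one-parameter family of Riemannian metrics on $M$ (defined for $t$ in an interval containing $0$), and let $\omega$ be the fundamental three-form of a $G_2$-structure on $M$ with underlying metric $g_0$. Then the solution of the ODE $$\begin{cases}\dot\omega_t=\frac32\, i_{\omega_t}(\dot g_t),\\ \omega_0=\omega,\end{cases}$$ exists as long as $g_t$ does and belongs to $\Omega^3_+$. Moreover, if $(g_t)_x$ lies in a maximal flat subspace of $S^2_+T^*_xM$ for any $x\in M$ and $t\in[0,t_1]$, then $\omega_{t_1}$ depends only on $g_0$, $g_{t_1}$ and the flat subspace (for the given initial form $\omega$).
   Context: A $G_2$-structure on $M$ is a reduction to $G_2$ of the bundle of oriented frames; equivalently a Riemannian metric $g$ and a unit real spinor field $\psi$ up to sign. Its fundamental three-form is $\omega_{abc}=\langle e_a\cdot e_b\cdot e_c\cdot\psi,\psi\rangle_g$ in $g$-orthonormal frames; $g=g_\omega$ is determined by $\omega$ and is called the underlying metric. $\Lambda^3_+\subset\Lambda^3T^*M$ is the open set of forms pointwise $\mathrm{GL}$-equivalent to such a form, and $\Omega^3_+$ is the space of smooth three-forms with values in $\Lambda^3_+$ (positive three-forms). For $\omega\in\Lambda^3_+$ and a symmetric 2-tensor $h$, $i_\omega(h)_{abc}=h_{[a|i|}\,\omega^{i}{}_{bc]}$, where indices are raised with $g_\omega$ and $[\,\cdot\,]$ is skew-symmetrisation over $a,b,c$ including the factor $1/3!$. $S^2_+T^*_xM$ is the space of positive-definite symmetric bilinear forms on $T_xM$,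 regarded as the non-positively curved symmetric space $\mathrm{GL}^+(T_xM)/\mathrm{SO}(7)$; ''maximal flat subspace'' refers to this structure, and for each $x$ the flat is the same for all $t\in[0,t_1]$. *)

(* Defs.v *)
From mathcomp Require Import all_boot all_order all_fingroup all_algebra.
From mathcomp Require Import all_classical all_reals all_analysis.

Set Implicit Arguments.
Unset Strict Implicit.
Unset Printing Implicit Defensive.
Import Order.TTheory GRing.Theory Num.Theory.
Import numFieldNormedType.Exports.
Local Open Scope classical_set_scope.
Local Open Scope ring_scope.

(** * Smooth functions on subsets of R^n *)

Section Smooth.
Context {R : realType}.

(* Difference quotients are only formed inside A, so this is the one-sided
   derivative at an end point of an interval A that belongs to A. *)
Definition has_deriv_within (A : set R) (f : R -> R) (t l : R) : Prop :=
  (fun s => (f s - f t) / (s - t)) @ within A t^' --> l.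

Definition deriv_within (A : set R) (f : R -> R) (t : R) : R :=
  lim ((fun s => (f s - f t) / (s - t)) @ within A t^').

Definition has_partial_within n (D : set 'rV[R]_n) (f : 'rV[R]_n -> R)
    (i : 'I_n) (y : 'rV[R]_n) (l : R) : Prop :=
  has_deriv_within [set s | D (y + s *: delta_mx 0 i)]
                   (fun s => f (y + s *: delta_mx 0 i)) 0 l.

(* This is used for open D, and for products of an interval (which may contain
   its end points) with an open set. *)
Fixpoint Ck_on n (k : nat) (D : set 'rV[R]_n) (f : 'rV[R]_n -> R) : Prop :=
  {within D, continuous f} /\
  if k is k'.+1 then
    forall i : 'I_n, exists f' : 'rV[R]_n -> R,
      (forall y, D y -> has_partial_within D f i y (f' y)) /\ Ck_on k' D f'
  else True.

Definition smooth_on n (D : set 'rV[R]_n) (f : 'rV[R]_n -> R) : Prop :=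
  forall k, Ck_on k D f.

End Smooth.

(** * Linear algebra on R^7: vectors are rows, so that a bilinear form with
    matrix G is (u, v) |-> u *m G *m v^T, an endomorphism acts by v |-> v *m A,
    and a frame is the matrix whose rows are the frame vectors *)

Section Pointwise.
Context {R : realType}.

Definition symmetric_mx (G : 'M[R]_7) : Prop := G^T = G.

Definition posdef (G : 'M[R]_7) : Prop :=
  symmetric_mx G /\ forall v : 'rV[R]_7, v != 0 -> 0 < (v *m G *m v^T) 0 0.

Definition orthonormal_frame (G E : 'M[R]_7) : Prop := E *m G *m E^T = 1%:M.

Definition form3 := 'I_7 -> 'I_7 -> 'I_7 -> R.

Definition alternating3 (w : form3) : Prop :=
  (forall a b c, w b a c = - w a b c) /\ (forall a b c, w a c b = - w a b c).

(* The components of w on the rows of A. *)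
Definition pull3 (A : 'M[R]_7) (w : form3) : form3 := fun a b c =>
  \sum_p \sum_q \sum_r A a p * A b q * A c r * w p q r.

Definition skew3 (T : form3) : form3 := fun a b c =>
  let v := tnth [tuple a; b; c] in
  (3`!)%:R^-1 *
  \sum_(s : 'S_3) (-1) ^+ s * T (v (s 0)) (v (s 1)) (v (s 2)).

(** ** Clifford multiplication on real spinors.  R^8 = R + R^7 is the algebra of
    octonions with e_i e_(i+1) = e_(i+3), indices modulo 7, and e_a acts as left
    multiplication by the imaginary unit e_a; the action is skew-symmetric and
    the square of a unit vector is -1. *)

Definition fano_line (a b c : 'I_7) : bool := (b == a + 1) && (c == a + 3).

Definition fano (a b c : 'I_7) : R :=
  if [|| fano_line a b c, fano_line b c a | fano_line c a b] then 1
  else if [|| fano_line b a c, fano_line a c b | fano_line c b a] then -1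
  else 0.

Definition gamma (a : 'I_7) : 'M[R]_(1 + 7) :=
  block_mx (0 : 'M[R]_1) (- delta_mx 0 a)
           (delta_mx a 0) (\matrix_(c, b) fano a b c).

Definition clifford (v : 'rV[R]_7) : 'M[R]_(1 + 7) := \sum_a v 0 a *: gamma a.

Definition psi0 : 'cV[R]_(1 + 7) := col_mx 1%:M 0.

(* <e_a . e_b . e_c . psi0, psi0> in the standard basis.  Since Spin(7) acts
   transitively on unit spinors, fixing psi0 only fixes the frame in which a
   G_2-structure is written. *)
Definition phi0 : form3 := fun a b c =>
  (psi0^T *m (gamma a *m gamma b *m gamma c *m psi0)) 0 0.

Definition G2 : set 'M[R]_7 := [set A | A \in unitmx /\ pull3 A phi0 = phi0].

(* Spin(7), realised faithfully on spinors. *)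
Definition Spin7 : set 'M[R]_(1 + 7) := [set S |
  exists s : seq 'rV[R]_7,
    [/\ ~~ odd (size s), forall v, v \in s -> v *m v^T = 1%:M
      & S = \big[mulmx/1%:M]_(v <- s) clifford v]].

(* The vector representation of S maps e_b to row b of A. *)
Definition spin_covers (S : 'M[R]_(1 + 7)) (A : 'M[R]_7) : Prop :=
  forall b, S *m gamma b = clifford (row b A) *m S.

(** ** Positive three-forms *)

Definition positive3 (w : form3) : Prop :=
  exists2 A : 'M[R]_7, A \in unitmx & w = pull3 A phi0.

Definition is_metric_of (w : form3) (G : 'M[R]_7) : Prop :=
  exists A : 'M[R]_7, [/\ A \in unitmx, w = pull3 A phi0 & G = A *m A^T].

(* g_w; there is exactly one G with is_metric_of w G when w is positive,
   because G_2 is contained in SO(7). *)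
Definition metric_of (w : form3) : 'M[R]_7 := xget 1%:M (is_metric_of w).

Definition i_form (w : form3) (h : 'M[R]_7) : form3 :=
  skew3 (fun a b c =>
    \sum_i \sum_j h a i * (invmx (metric_of w)) i j * w j b c).

(** ** Flats of the symmetric space of positive-definite forms, GL^+(7)/SO(7).
    A in GL^+(7) moves G to A *m G *m A^T.  In the Cartan decomposition of gl(7)
    at G, the isotropy algebra consists of the G-skew endomorphisms and its
    complement p of the G-self-adjoint ones.  The flats through G are the orbits
    exp(a) . G with a an abelian subspace of p. *)

Definition expmx (A : 'M[R]_7) : 'M[R]_7 :=
  lim (series (fun k => (k`!)%:R^-1 *: A ^+ k) @ \oo).

Definition self_adjoint (G A : 'M[R]_7) : Prop := A *m G = G *m A^T.

Definition flat_subspace (F : set 'M[R]_7) : Prop :=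
  exists (G : 'M[R]_7) (a : {vspace 'M[R]_7}),
    [/\ posdef G,
        forall A, A \in a -> self_adjoint G A,
        forall A B, A \in a -> B \in a -> A *m B = B *m A
      & F = [set expmx A *m G *m (expmx A)^T | A in [set A | A \in a]]].

Definition maximal_flat (F : set 'M[R]_7) : Prop :=
  flat_subspace F /\ forall F', flat_subspace F' -> F `<=` F' -> F' = F.

End Pointwise.

(** * Oriented smooth 7-manifolds, with tensor fields given by their components
    in the charts of an oriented atlas *)

(* par i is the inverse of the chart coord i; the values of coord i outside
   dom i and of par i outside the image are irrelevant. *)
Record oriented_atlas (R : realType) (M : topologicalType) := OrientedAtlas {
  chart : Type;
  dom : chart -> set M;
  coord : chart -> M -> 'rV[R]_7;
  par : chart -> 'rV[R]_7 -> M;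
  dom_open : forall i, open (dom i);
  dom_cover : forall x, exists i, dom i x;
  coord_open : forall i, open (coord i @` dom i);
  coord_continuous : forall i, {within dom i, continuous (coord i)};
  par_continuous : forall i, {within coord i @` dom i, continuous (par i)};
  coordK : forall i x, dom i x -> par i (coord i x) = x;
  transition_smooth : forall i j (b : 'I_7),
    smooth_on (coord i @` (dom i `&` dom j))
              (fun y => coord j (par i y) 0 b);
  transition_oriented : forall i j x, dom i x -> dom j x ->
    0 < \det (jacobian (coord j \o par i) (coord i x))
}.

Section Manifold.
Context {R : realType} {M : topologicalType} (X : oriented_atlas R M).

(* A tangent vector with components v in chart i has components
   v *m jac i j x in chart j. *)
Definition jac (i j : chart X) (x : M) : 'M[R]_7 :=
  jacobian (coord j \o par i) (coord i x).

Definition chart_smooth (i : chart X) (U : set M) (f : M -> R) : Prop :=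
  smooth_on (coord i @` (dom i `&` U)) (f \o par i).

(* Joint smoothness in (t, x), t in J. *)
Definition chart_smooth_family (i : chart X) (J : set R) (f : R -> M -> R) :=
  smooth_on [set z : 'rV[R]_(1 + 7) |
               J (lsubmx z 0 0) /\ (coord i @` dom i) (rsubmx z)]
            (fun z => f (lsubmx z 0 0) (par i (rsubmx z))).

(** ** Metrics and three-forms; the values outside dom i of the components in
    chart i are irrelevant *)

Definition tensor2 := chart X -> M -> 'M[R]_7.
Definition tensor3 := chart X -> M -> @form3 R.

Definition same2 (g g' : tensor2) : Prop :=
  forall i x, dom i x -> g i x = g' i x.
Definition same3 (w w' : tensor3) : Prop :=
  forall i x, dom i x -> w i x = w' i x.

Definition riemannian_metric (g : tensor2) : Prop :=
  [/\ forall i j x, dom i x -> dom j x ->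
        g i x = jac i j x *m g j x *m (jac i j x)^T,
      forall i a b, chart_smooth i setT (fun x => g i x a b)
    & forall i x, dom i x -> posdef (g i x)].

Definition smooth_metric_family (J : set R) (g : R -> tensor2) : Prop :=
  (forall t, J t -> riemannian_metric (g t)) /\
  (forall i a b, chart_smooth_family i J (fun t x => g t i x a b)).

Definition three_form (w : tensor3) : Prop :=
  [/\ forall i j x, dom i x -> dom j x -> w i x = pull3 (jac i j x) (w j x),
      forall i a b c, chart_smooth i setT (fun x => w i x a b c)
    & forall i x, dom i x -> alternating3 (w i x)].

(* Omega^3_+ *)
Definition positive_three_form (w : tensor3) : Prop :=
  three_form w /\ forall i x, dom i x -> positive3 (w i x).

Definition smooth_form_family (J : set R) (W : R -> tensor3) : Prop :=
  (forall t, J t -> three_form (W t)) /\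
  (forall i a b c, chart_smooth_family i J (fun t x => W t i x a b c)).

(** ** Frames, spin structures and G_2-structures *)

Definition local_frame (U : set M) (e : tensor2) : Prop :=
  [/\ forall i j x, U x -> dom i x -> dom j x -> e j x = e i x *m jac i j x,
      forall i a b, chart_smooth i U (fun x => e i x a b)
    & forall i x, U x -> dom i x -> 0 < \det (e i x)].

(* S k l lifts to Spin(7) the SO(7)-valued transition functions between local
   oriented orthonormal frames. *)
Definition spin_structure (g : tensor2) (K : Type) (U : K -> set M)
    (e : K -> tensor2) (S : K -> K -> M -> 'M[R]_(1 + 7)) : Prop :=
  [/\ forall k, open (U k) /\ local_frame (U k) (e k),
      forall x, exists k, U k x,
      forall k i x, U k x -> dom i x -> orthonormal_frame (g i x) (e k i x),
      forall k l, {within U k `&` U l, continuous (S k l)} /\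
        (forall x, U k x -> U l x -> Spin7 (S k l x) /\
           forall i, dom i x ->
             spin_covers (S k l x) (e l i x *m invmx (e k i x)))
    & forall k l m x, U k x -> U l x -> U m x ->
        S k l x *m S l m x = S k m x].

Definition spin_manifold : Prop :=
  exists g K U e S, riemannian_metric g /\ @spin_structure g K U e S.

(* P i x is the set of frames at x that belong to the reduction, written in
   chart i. *)
Definition G2_structure (P : chart X -> M -> set 'M[R]_7) : Prop :=
  [/\ forall i j x, dom i x -> dom j x ->
        P j x = [set E *m jac i j x | E in P i x],
      forall i x, dom i x -> forall E, P i x E -> 0 < \det E
    & forall x, exists (U : set M) (e : tensor2),
        [/\ open U, U x, local_frame U e
          & forall i y, U y -> dom i y ->
              P i y = [set A *m e i y | A in G2]]].

Definition underlying_metric (P : chart X -> M -> set 'M[R]_7) (g : tensor2) :=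
  forall i x, dom i x -> forall E, P i x E -> orthonormal_frame (g i x) E.

(* The spinor of the G_2-structure is represented by psi0 in the frames of P. *)
Definition fundamental_form (P : chart X -> M -> set 'M[R]_7) (w : tensor3) :=
  forall i x, dom i x -> forall E, P i x E -> pull3 E (w i x) = phi0.

(** ** The evolution equation *)

Definition metric_dot (J : set R) (g : R -> tensor2) (t : R) : tensor2 :=
  fun i x => \matrix_(a, b) deriv_within J (fun s => g s i x a b) t.

Definition solution (J : set R) (g : R -> tensor2) (w : tensor3)
    (W : R -> tensor3) : Prop :=
  [/\ forall t, J t -> positive_three_form (W t),
      forall t, J t -> forall i x, dom i x -> forall a b c,
        has_deriv_within J (fun s => W s i x a b c) t
          (3 / 2 * i_form (W t i x) (metric_dot J g t i x) a b c)
    & same3 (W 0) w].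

(* A maximal flat of S^2_+ T*_x M for every x, with no regularity in x. *)
Definition maximal_flats (F : chart X -> M -> set 'M[R]_7) : Prop :=
  (forall i j x, dom i x -> dom j x ->
     F i x = [set jac i j x *m G *m (jac i j x)^T | G in F j x]) /\
  (forall i x, dom i x -> maximal_flat (F i x)).

Definition in_flats (F : chart X -> M -> set 'M[R]_7) (g : tensor2) : Prop :=
  forall i x, dom i x -> F i x (g i x).

End Manifold.

(* Main.v *)
(* Solve the linear equation [F' = 1/2 g' g^-1 F], [F 0 = 1], for endomorphisms of the tangent
   spaces.  Then [g_t = F g_0 F^T], and [w_t = pull3 F w] solves the equation: [3/2 i_w h] is the
   infinitesimal action of [1/2 h g^-1] on three-forms.  Smoothness in (t, x) is the smooth
   dependence of linear flows on parameters.

   For an arbitrary solution the right-hand side involves [metric_of w_t], which is not known to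
   be [g_t] beforehand.  The metric of a positive form is an explicit continuous function of the
   form, through the cubic form i_u w /\ i_v w /\ w.  Hence [w_t] is moved by the flow of the continuous
   endomorphism [1/2 g' (metric_of w_t)^-1], so [metric_of w_t] has derivative [g'] and equals
   [g_t]; this gives uniqueness.

   Along a flat the endomorphisms [S_t = g_t g_0^-1] commute, so [F_t ^ 2 = S_t], and [F_t] is
   the square of the [g_0]-self-adjoint flow of [1/4 g' g^-1].  Thus [F_t] is the positive square
   root of [S_t], which is determined by [g_0] and [g_t]. *)

Require Import Defs.
From mathcomp Require Import all_boot all_order all_fingroup all_algebra.
From mathcomp Require Import all_classical all_reals all_analysis.
From mathcomp Require Import ring lra.
Import Order.TTheory GRing.Theory Num.Theory.
Import numFieldNormedType.Exports.
Set Implicit Arguments.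
Unset Strict Implicit.
Unset Printing Implicit Defensive.
Local Open Scope classical_set_scope.
Local Open Scope ring_scope.

(** * Calculus on an interval *)

Section OneVariable.
Context {R : realType}.
Implicit Types (A B J : set R) (f g : R -> R) (a b c t l C : R).

(** Time derivatives are taken relative to [J], hence one-sided at end points that belong to [J],
    and the solution has to be smooth up to these points; linear flows are therefore constructed
    directly for such intervals. A flow [F] always comes with the solution [G] of the adjoint
    equation, and [G *m F], [G *m Y], [G *m H *m G^T] or [pull3 G w] have zero derivative. This one
    device gives invertibility, uniqueness of linear evolutions without a Gronwall estimate, and the
    transport of metrics and forms.

    Regularity in the parameter is an induction in which a flow and its parameter derivative form
    one block column of a flow of twice the size, so it has to be stated for all matrix sizes at
    once.

    A frame change [A] multiplies the cubic form by [\det A], besides acting on it as on a metric,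
    so the determinant of the cubic form carries [\det A ^+ 9]. It is nonzero for either sign of
    [\det A], and a ninth root of its square is what turns the cubic form into the metric. The value
    of the cubic form at [phi0] is a finite integer computation. *)

Lemma cvg_sumr (T I : Type) (F : set_system T) {FF : Filter F} (r : seq I)
    (f : I -> T -> R) (l : I -> R) : (forall i, f i @ F --> l i) ->
  (fun x => \sum_(i <- r) f i x) @ F --> \sum_(i <- r) l i.
Proof.
move=> hf; elim: r => [|i r IH].
  rewrite big_nil (_ : (fun _ => _) = fun=> 0); first exact: cvg_cst.
  by apply/funext => s; rewrite big_nil.
rewrite big_cons (_ : (fun _ => _) = fun s => f i s + \sum_(j <- r) f j s).
  exact: cvgD.
by apply/funext => s; rewrite big_cons.
Qed.

Lemma hd_cst A t c : has_deriv_within A (fun=> c) t 0.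
Proof.
rewrite /has_deriv_within (_ : (fun _ => _) = fun=> 0); first exact: cvg_cst.
by apply/funext => s; rewrite subrr mul0r.
Qed.

Lemma hd_id A t : has_deriv_within A id t 1.
Proof.
apply/cvgrPdist_le => e e0; rewrite near_withinE; near=> s => _.
rewrite /= divff ?subrr ?normr0 ?ltW// subr_eq0.
by near: s; exact: nbhs_dnbhs_neq.
Unshelve. all: by end_near. Qed.

Lemma hdD A f g t l m : has_deriv_within A f t l -> has_deriv_within A g t m ->
  has_deriv_within A (fun s => f s + g s) t (l + m).
Proof.
move=> hf hg; rewrite /has_deriv_within.
rewrite (_ : (fun _ => _) = fun s => (f s - f t) / (s - t) + (g s - g t) / (s - t)).
  exact: cvgD.
by apply/funext => s; ring.
Qed.

(** The filter [within A (nbhs t)] includes [t] itself, so this is continuity relative to [A]; away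
    from [t], [f s] is the difference quotient times [s - t] plus [f t]. *)
Lemma hd_cvg A f t l : has_deriv_within A f t l -> f @ within A (nbhs t) --> f t.
Proof.
move=> hf; have h0 : (fun s => s - t) @ within A t^' --> (0 : R).
  apply/cvgrPdist_lt => e e0; rewrite near_withinE; apply: nbhs_dnbhs.
  by exists e => //= s; rewrite /= sub0r opprB.
have h1 : f @ within A t^' --> f t.
  have H : (fun s => (f s - f t) / (s - t) * (s - t) + f t) @ within A t^' --> l * 0 + f t.
    by apply: cvgD; [exact: cvgM|exact: cvg_cst].
  move: H; rewrite mulr0 add0r; apply: cvg_trans; apply: near_eq_cvg.
  rewrite near_withinE; near=> s => _ /=; rewrite divfK ?subrK// subr_eq0.
  by near: s; exact: nbhs_dnbhs_neq.
apply/cvgrPdist_le => e e0; have /cvgrPdist_le /(_ e e0) := h1.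
rewrite !near_withinE; apply: filterS => s h As.
by have [->|st] := eqVneq s t; [rewrite subrr normr0 ltW|exact: h].
Unshelve. all: by end_near. Qed.

Lemma hdM A f g t l m : has_deriv_within A f t l -> has_deriv_within A g t m ->
  has_deriv_within A (fun s => f s * g s) t (l * g t + f t * m).
Proof.
move=> hf hg; rewrite /has_deriv_within.
have hgt : g @ within A t^' --> g t.
  apply: cvg_trans (hd_cvg hg); apply: cvg_app => U [e e0 eU].
  by exists e => // s se /eqP st; apply: eU.
rewrite (_ : (fun _ => _) = fun s => (f s - f t) / (s - t) * g s
    + f t * ((g s - g t) / (s - t))).
  by apply: cvgD; apply: cvgM => //; exact: cvg_cst.
by apply/funext => s; ring.
Qed.

Lemma hdZ A f t l c : has_deriv_within A f t l ->
  has_deriv_within A (fun s => c * f s) t (c * l).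
Proof. by move=> hf; have := hdM (hd_cst A t c) hf; rewrite mul0r add0r. Qed.

Lemma hdN A f t l : has_deriv_within A f t l ->
  has_deriv_within A (fun s => - f s) t (- l).
Proof.
move=> /(@hdZ A f t l (-1)); rewrite mulN1r; congr (has_deriv_within _ _ _ _).
by apply/funext => s; rewrite mulN1r.
Qed.

Lemma hdB A f g t l m : has_deriv_within A f t l -> has_deriv_within A g t m ->
  has_deriv_within A (fun s => f s - g s) t (l - m).
Proof. by move=> hf hg; apply: hdD => //; exact: hdN. Qed.

Lemma hd_sum A (I : Type) (r : seq I) (P : pred I) (f : I -> R -> R) t (l : I -> R) :
  (forall i, has_deriv_within A (f i) t (l i)) ->
  has_deriv_within A (fun s => \sum_(i <- r | P i) f i s) t (\sum_(i <- r | P i) l i).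
Proof.
move=> hf; elim: r => [|i r IH].
  rewrite big_nil (_ : (fun _ => _) = fun=> 0); first exact: hd_cst.
  by apply/funext => s; rewrite big_nil.
rewrite big_cons (_ : (fun _ => _) = fun s => if P i then f i s + \sum_(j <- r | P j) f j s
   else \sum_(j <- r | P j) f j s).
  by case: ifP => // _; exact: hdD.
by apply/funext => s; rewrite big_cons.
Qed.

Lemma hd_eq A f g t l : A t -> (forall s, A s -> f s = g s) ->
  has_deriv_within A f t l -> has_deriv_within A g t l.
Proof.
move=> At fg; apply: cvg_trans; apply: near_eq_cvg.
rewrite near_withinE; near=> s => As; by rewrite !fg.
Unshelve. all: by end_near. Qed.

Lemma hd_sub A B f t l : B `<=` A -> has_deriv_within A f t l ->
  has_deriv_within B f t l.
Proof.
move=> BA; rewrite /has_deriv_within !cvgrPdist_le => H e e0.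
have := H e e0; rewrite !near_withinE; apply: filterS => s h st Bs.
exact: h st (BA _ Bs).
Qed.

(** Carries a derivative from a compact segment back to [J], when the segment contains all points of
    [J] near [t]. *)
Lemma hd_near A B f t l : (\forall s \near t, A s -> B s) ->
  has_deriv_within B f t l -> has_deriv_within A f t l.
Proof.
move=> AB; rewrite /has_deriv_within !cvgrPdist_le => H e e0.
have AB' : \forall s \near t^', A s -> B s by exact: nbhs_dnbhs.
by have := H e e0; rewrite !near_withinE; apply: filterS2 AB' => s h1 h2 /h1.
Qed.

Lemma hd_shift A f t c l :
  has_deriv_within [set s | A (s + c)] (fun s => f (s + c)) t l <->
  has_deriv_within A f (t + c) l.
Proof.
rewrite /has_deriv_within !cvgrPdist_le /=; split=> H e e0.
- have := H e e0; rewrite !near_withinE => -[d /= d0 h]; exists d => //= s /= sd /eqP st As.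
  have := h (s - c); rewrite /= /ball_ !subrK.
  rewrite (_ : s - c - t = s - (t + c)); last by ring.
  apply=> //; first by rewrite (_ : t - _ = t + c - s)//; ring.
  by apply: contra_not_neq st => /(congr1 (fun x => x + c)); rewrite subrK.
- have := H e e0; rewrite !near_withinE => -[d /= d0 h]; exists d => //= s /= sd /eqP st As.
  have := h (s + c); rewrite /= /ball_ opprD addrACA subrr addr0.
  rewrite (_ : s + c - (t + c) = s - t); last by ring.
  apply=> //; by apply: contra_not_neq st => /addIr.
Qed.

Lemma hd_opp A f t l :
  has_deriv_within A f t l -> has_deriv_within [set s | A (- s)] (fun s => f (- s)) (- t) (- l).
Proof.
rewrite /has_deriv_within !cvgrPdist_le /= => H e e0.
have := H e e0; rewrite !near_withinE => -[d /= d0 h]; exists d => //= s /= sd /eqP st As.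
have := h (- s); rewrite /= /ball_ opprK.
have -> : - l - (f (- s) - f (- - t)) / (s - - t) = - (l - (f (- s) - f t) / (- s - t)).
  by rewrite (opprK t) (_ : s + t = - (- s - t)) ?invrN; ring.
rewrite normrN.
apply=> //; first by rewrite -normrN (_ : - (t + s) = - t - s)//; ring.
by apply: contra_not_neq st => <-; rewrite opprK.
Qed.

Lemma limit_point_within A t : (forall e, 0 < e -> exists s, [/\ A s, s != t & `|t - s| < e]) ->
  ProperFilter (within A t^').
Proof.
move=> H; apply: Build_ProperFilter_ex => U [e /= e0 eU].
have [s [As st ts]] := H e e0.
by exists s; apply: eU.
Qed.

Lemma itv_limit_point J t : is_interval J -> (exists2 u, J u & u != t) -> J t ->
  forall e, 0 < e -> exists s, [/\ J s, s != t & `|t - s| < e].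
Proof.
move=> iJ [u Ju ut] Jt e e0.
have d0 : 0 < `|u - t| by rewrite normr_gt0 subr_eq0.
(* A fraction of the way from [t] to [u]: at most 1 keeps the point in the interval, the second
   bound keeps it in the ball of radius [e]. *)
pose k := Num.min 1 (e / 2 / `|u - t|).
have k0 : 0 < k by rewrite lt_min ltr01 !divr_gt0.
have k1 : k <= 1 by rewrite ge_min lexx.
have ke : k * `|u - t| < e.
  apply: (@le_lt_trans _ _ (e / 2)); last by rewrite ltr_pdivrMr// mulr_natr mulr2n ltrDl.
  by rewrite -ler_pdivlMr// ge_min lexx orbT.
exists (t + k * (u - t)); split.
- have [tu|ut'] := leP t u.
    apply: (iJ t u) => //; apply/andP; split; nra.
  apply: (iJ u t) => //; apply/andP; split; nra.
- rewrite -subr_eq0 addrAC subrr add0r mulf_neq0 ?(gt_eqF k0)//.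
  by rewrite subr_eq0.
- by rewrite opprD addrA subrr add0r normrN normrM (gtr0_norm k0).
Qed.

(** A nondegenerate interval has no isolated point. Properness of this filter is what makes
    derivatives relative to [J] unique. *)
Lemma itv_within_proper J t : is_interval J -> (exists2 u, J u & u != t) -> J t ->
  ProperFilter (within J t^').
Proof. by move=> iJ Ju Jt; apply: limit_point_within; exact: itv_limit_point. Qed.

Lemma itv_within_proper0 J t : is_interval J -> J 0 -> (exists2 u, J u & u != 0) -> J t ->
  ProperFilter (within J t^').
Proof.
move=> iJ J0 nJ Jt; apply: itv_within_proper => //; have [->|t0] := eqVneq t 0.
  exact: nJ.
by exists 0 => //; rewrite eq_sym.
Qed.

Lemma hd_unique A f t l m : ProperFilter (within A t^') ->
  has_deriv_within A f t l -> has_deriv_within A f t m -> l = m.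
Proof. by move=> PF; exact: (cvg_unique (@Rhausdorff R)). Qed.

Lemma deriv_withinE A f t l : ProperFilter (within A t^') ->
  has_deriv_within A f t l -> deriv_within A f t = l.
Proof. by move=> PF; exact: (cvg_lim (@Rhausdorff R)). Qed.

Lemma hd_is_derive A f t l : nbhs t A -> has_deriv_within A f t l -> is_derive t 1 f l.
Proof.
move=> nA hf.
have H : h^-1 *: (f (h *: 1 + t) - f t) @[h --> 0^'] --> l.
  move: hf; rewrite /has_deriv_within !cvgrPdist_le => H e e0.
  have := H e e0; rewrite near_withinE => -[d /= d0 h].
  have [d' /= d'0 h'] := nA.
  exists (Num.min d d'); first by rewrite /= lt_min d0.
  move=> s /=; rewrite sub0r normrN lt_min => /andP[sd sd'] s0.
  rewrite /= /GRing.scale /= mulr1.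
  have := h (s + t); rewrite /= addrK [s^-1 * _]mulrC; apply => //.
  - by rewrite opprD addrCA subrr addr0 normrN.
  - by apply: contra_neq s0 => /eqP; rewrite -subr_eq0 addrK => /eqP.
  - by apply: h'; rewrite /= opprD addrCA subrr addr0 normrN.
apply: DeriveDef; last exact: (cvg_lim (@Rhausdorff R)).
by apply/cvg_ex; exists l.
Qed.

Lemma is_derive_hd A f t l : is_derive t 1 f l -> has_deriv_within A f t l.
Proof.
move=> [df <-]; rewrite /has_deriv_within.
apply: (@cvg_trans _ ((fun s => (f s - f t) / (s - t)) @ t^')).
  by apply: cvg_app; exact: cvg_within.
move: df; rewrite /derivable /derive; set m := lim _ => /cvg_ex[l' hl'].
have -> : m = l' by exact: (cvg_lim (@Rhausdorff R)).
move: hl'; rewrite !cvgrPdist_le => H e e0.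
have [d /= d0 hd] := H e e0; exists d => //= s /= sd st.
have := hd (s - t); rewrite /= /GRing.scale /= mulr1 subrK mulrC; apply.
- by rewrite sub0r opprB.
- by rewrite subr_eq0.
Qed.

Lemma segment_sub J a b : is_interval J -> J a -> J b -> `[a, b] `<=` J.
Proof. by move=> iJ Ja Jb s; rewrite /= in_itv /= => h; apply: (iJ a b). Qed.

(** [g - f] and [g + f] are nondecreasing by the mean value theorem, which uses derivatives inside
    the segment and only continuity at its ends. *)
Lemma hd_le a b f f' g g' : a <= b ->
  (forall t, a <= t <= b -> [/\ has_deriv_within `[a, b] f t (f' t),
     has_deriv_within `[a, b] g t (g' t) & `|f' t| <= g' t]) ->
  `|f b - f a| <= g b - g a.
Proof.
move=> ab H.
have key h h' : (forall t, a <= t <= b -> has_deriv_within `[a, b] h t (h' t) /\ 0 <= h' t) ->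
    h a <= h b.
  move=> Hh; have [||c] := @MVT_segment R h h' a b ab.
  - move=> x xab; apply: (@hd_is_derive `[a, b]); last first.
      by apply: (Hh x _).1; move: xab; rewrite in_itv /= => /andP[/ltW -> /ltW ->].
    by have := near_in_itvoo xab; apply: filterS; exact: subset_itv_oo_cc.
  - apply/subspace_continuousP => x /=; rewrite in_itv /= => /Hh [hx _].
    exact: hd_cvg hx.
  rewrite in_itv /= => /Hh [_ h0] /eqP.
  by rewrite subr_eq => /eqP ->; rewrite lerDr mulr_ge0// subr_ge0.
have h1 : g a - f a <= g b - f b.
  apply: (key (fun s => g s - f s) (fun s => g' s - f' s)) => t tab.
  have [hf hg fg] := H t tab; split; first exact: hdB.
  by rewrite subr_ge0; apply: le_trans fg; exact: ler_norm.
have h2 : g a + f a <= g b + f b.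
  apply: (key (fun s => g s + f s) (fun s => g' s + f' s)) => t tab.
  have [hf hg fg] := H t tab; split; first exact: hdD.
  rewrite -lerBlDr sub0r; apply: le_trans fg; rewrite -normrN; exact: ler_norm.
by rewrite ler_norml; apply/andP; split; lra.
Qed.

Lemma hd_lip A f f' C a b : is_interval A -> A a -> A b ->
  (forall t, A t -> `|t - a| <= `|b - a| -> has_deriv_within A f t (f' t) /\ `|f' t| <= C) ->
  `|f b - f a| <= C * `|b - a|.
Proof.
move=> iA Aa Ab H; have [ab|ba] := leP a b.
  have := @hd_le a b f f' (fun s => C * s) (fun=> C) ab.
  rewrite -mulrBr (@ger0_norm _ (b - a)) ?subr_ge0//; apply => t tab.
  have At : A t by apply: (iA a b).
  have [//|hf fC] := H t At.
    by move: tab => /andP[? ?]; rewrite !ger0_norm ?subr_ge0// lerD2r.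
  split => //; first by apply: hd_sub hf; exact: segment_sub.
  by have := @hdZ _ _ _ _ C (@hd_id `[a, b] t); rewrite mulr1.
have := @hd_le b a f f' (fun s => C * s) (fun=> C) (ltW ba).
rewrite -mulrBr -normrN opprB -(normrN (b - a)) opprB (@gtr0_norm _ (a - b)) ?subr_gt0//; apply => t tab.
have At : A t by apply: (iA b a).
have [//|hf fC] := H t At.
  move: tab => /andP[? ?]; rewrite !ler0_norm ?subr_le0//; last exact: ltW.
  by rewrite lerN2 lerD2r.
split => //; first by apply: hd_sub hf; exact: segment_sub.
by have := @hdZ _ _ _ _ C (@hd_id `[b, a] t); rewrite mulr1.
Qed.

Lemma hd0_cst A f a b : is_interval A -> A a -> A b ->
  (forall t, A t -> has_deriv_within A f t 0) -> f b = f a.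
Proof.
move=> iA Aa Ab H; apply/eqP; rewrite -subr_eq0 -normr_le0.
rewrite -(mul0r `|b - a|); apply: (@hd_lip A f (fun=> 0)) => // t At _.
by split; [exact: H|rewrite normr0].
Qed.

Lemma is_interval_segment a b : is_interval (`[a, b] : set R).
Proof. by apply/interval_is_interval. Qed.

(** Reduction to compact segments. The segment extends beyond [t] on each side where [J] does and
    stops at [t] otherwise, so it contains all of [J] near [t], whichever end points [J] has. *)
Lemma segment_nbhs J t : is_interval J -> J 0 -> J t ->
  exists a b, [/\ a <= 0 <= b, a <= t <= b, `[a, b] `<=` J &
    \forall s \near t, J s -> s \in `[a, b]].
Proof.
move=> iJ J0 Jt.
have [b [b0 bt Jb Hb]] : exists b, [/\ 0 <= b, t <= b, J b & \forall s \near t, J s -> s <= b].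
  have [[u Ju [u0 tu]]|N] := pselect (exists2 u, J u & 0 <= u /\ t < u).
    exists u; split => //; first exact: ltW.
    by near=> s => _; apply: ltW; near: s; exact: lt_nbhsl.
  exists (Num.max 0 t); split; rewrite ?le_max ?lexx ?orbT//.
    by case: ltP.
  near=> s => Js; rewrite leNgt; apply/negP; rewrite gt_max => /andP[s0 ts].
  by apply: N; exists s => //; rewrite ltW.
have [a [a0 at' Ja Ha]] : exists a, [/\ a <= 0, a <= t, J a & \forall s \near t, J s -> a <= s].
  have [[u Ju [u0 tu]]|N] := pselect (exists2 u, J u & u <= 0 /\ u < t).
    exists u; split => //; first exact: ltW.
    by near=> s => _; apply: ltW; near: s; exact: lt_nbhsr.
  exists (Num.min 0 t); split; rewrite ?ge_min ?lexx ?orbT//.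
    by case: ltP.
  near=> s => Js; rewrite leNgt; apply/negP; rewrite lt_min => /andP[s0 ts].
  by apply: N; exists s => //; rewrite ltW.
exists a, b; split; rewrite ?a0 ?b0 ?at' ?bt//; first exact: segment_sub.
by near=> s => Js; rewrite in_itv /=; apply/andP; split; move: Js; near: s.
Unshelve. all: by end_near. Qed.

Lemma antiderivative_segment f a b : a < b -> {within `[a, b], continuous f} ->
  exists F, forall t, a <= t <= b -> has_deriv_within `[a, b] F t (f t).
Proof.
(* Clamping to [[a, b]] extends [f] continuously to the line, so the fundamental theorem of calculus
   applies at [a] and [b] as well. *)
move=> ab cf; pose c (s : R) := Num.max a (Num.min b s).
have cP s : c s \in `[a, b] by rewrite in_itv /= /c le_max ge_max lexx ge_min lexx (ltW ab).
have cc : continuous c.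
  move=> s; apply: continuous_max; first exact: cvg_cst.
  by apply: continuous_min; [exact: cvg_cst|exact: cvg_id].
pose h := f \o c.
have ch : continuous h.
  move=> s; apply: (@cvg_comp _ _ _ c f _ (within `[a, b] (nbhs (c s)))); last first.
    by move/subspace_continuousP : cf; apply; exact: cP.
  move=> U hU; have : \forall u \near s, c u \in `[a, b] -> U (c u) by exact: (cc s _ hU).
  by apply: filterS => u; apply; exact: cP.
(* Starting at [a - 1] makes every point of [[a, b]] interior to the domain of integration. *)
pose F x := \int[@lebesgue_measure R]_(t in `[a - 1, x]) h t.
exists F => t tab.
have tb : t < b + 1 by move: tab => /andP[_ ?]; lra.
have ta : a - 1 < t by move: tab => /andP[? _]; lra.
have ih : lebesgue_measure.-integrable `[a - 1, b + 1] (EFin \o h).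
  apply: continuous_compact_integrable; first exact: segment_compact.
  exact: continuous_subspaceT.
have [dF F't] := continuous_FTC1_closed tb ih ta (ch t).
apply: is_derive_hd; apply: DeriveDef => //; rewrite -derive1E F't /h /= /c.
by move: tab => /andP[? ?]; rewrite (min_idPr _)// (max_idPr _).
Qed.

Lemma antiderivative J f : is_interval J -> J 0 -> (exists2 u, J u & u != 0) ->
  {within J, continuous f} ->
  exists2 F, F 0 = 0 & forall t, J t -> has_deriv_within J F t (f t).
Proof.
move=> iJ J0 nJ cf.
(* [v] is the increment from [0] to [t] of an antiderivative on the segment between them. Such
   increments are unique, which glues the antiderivatives found on different segments. *)
pose P t v := exists2 G, v = G t - G 0 & forall s, s \in `[Num.min 0 t, Num.max 0 t] ->
  has_deriv_within `[Num.min 0 t, Num.max 0 t] G s (f s).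
have P_sub a b G t : a <= 0 <= b -> a <= t <= b ->
    (forall s, a <= s <= b -> has_deriv_within `[a, b] G s (f s)) -> P t (G t - G 0).
  move=> /andP[a0 b0] /andP[at' bt] hG; exists G => // s.
  rewrite in_itv /= => sI; apply: (@hd_sub `[a, b]); last first.
    apply: hG; move: sI; rewrite ge_min le_max => /andP[/orP[s0|s1] /orP[s2|s3]]; apply/andP; split; lra.
  apply: subset_itv; rewrite bnd_simp.
    by rewrite le_min a0.
  by rewrite ge_max b0.
have P_uniq t v v' : P t v -> P t v' -> v = v'.
  move=> [G -> hG] [G' -> hG'].
  have : G t - G' t = G 0 - G' 0.
    apply: (@hd0_cst `[Num.min 0 t, Num.max 0 t] (fun s => G s - G' s)).
    - exact: is_interval_segment.
    - by rewrite /= in_itv /= ge_min le_max lexx.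
    - by rewrite /= in_itv /= ge_min le_max lexx !orbT.
    - by move=> s hs; have := hdB (hG s hs) (hG' s hs); rewrite subrr.
  lra.
have seg t : J t -> exists a b G, [/\ a <= 0 <= b, a <= t <= b,
    \forall s \near t, J s -> s \in `[a, b] &
    forall s, a <= s <= b -> has_deriv_within `[a, b] G s (f s)].
  move=> Jt; have [a [b [ab tab abJ Nt]]] := segment_nbhs iJ J0 Jt.
  have [ab'|ba] := ltP a b.
    have [G hG] := antiderivative_segment ab' (continuous_subspaceW abJ cf).
    by exists a, b, G; split.
  (* A degenerate segment would make [0] an isolated point of [J]. *)
  have [ea eb] : a = 0 /\ b = 0 by move: ab => /andP[? ?]; split; lra.
  have t0 : t = 0 by move: tab => /andP[? ?]; lra.
  have := Nt; rewrite t0 => -[e /= e0 he].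
  have [s [Js s0 se]] := itv_limit_point iJ nJ J0 e0.
  have := he s se Js; rewrite in_itv /= ea eb -eq_le => /eqP s0'.
  by rewrite s0' eqxx in s0.
exists (fun t => xget 0 (P t)).
  apply: xget_unique; last first.
    move=> v [G -> _]; by rewrite subrr.
  have [a [b [G [h1 h2 _ hG]]]] := seg 0 J0.
  by have := P_sub a b G 0 h1 h2 hG; rewrite subrr.
move=> t Jt; have [a [b [G [h1 h2 Nt hG]]]] := seg t Jt.
apply: (hd_near Nt).
have abt : t \in `[a, b] by rewrite in_itv.
apply: (@hd_eq _ (fun s => G s - G 0)) => //.
  move=> s; rewrite /= in_itv /= => sI; apply/esym; apply: xget_unique.
    exact: (P_sub a b).
  move=> v Pv; apply: (P_uniq s) => //; exact: (P_sub a b).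
by rewrite -[f t]subr0; apply: hdB; [exact: hG|exact: hd_cst].
Qed.

End OneVariable.

(** * Paths of matrices and linear flows *)

Section MatrixPaths.
Context {R : realType}.
Implicit Types (A J : set R) (a b c t C e : R).

Definition mderiv A m n (F : R -> 'M[R]_(m, n)) t (L : 'M[R]_(m, n)) : Prop :=
  forall i j, has_deriv_within A (fun s => F s i j) t (L i j).

Definition mcont A m n (F : R -> 'M[R]_(m, n)) : Prop :=
  forall i j, {within A, continuous (fun s => F s i j)}.

Lemma submxE m n (F G : 'M[R]_(m, n)) i j : (F - G) i j = F i j - G i j.
Proof. by rewrite !mxE. Qed.

Lemma mderiv_cst A m n (F : 'M[R]_(m, n)) t : mderiv A (fun=> F) t 0.
Proof. by move=> i j; rewrite mxE; exact: hd_cst. Qed.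

Lemma mderivD A m n (F G : R -> 'M[R]_(m, n)) t L M :
  mderiv A F t L -> mderiv A G t M -> mderiv A (fun s => F s + G s) t (L + M).
Proof.
move=> hF hG i j; rewrite mxE; have := hdD (hF i j) (hG i j).
by congr (has_deriv_within _ _ _ _); apply/funext => s; rewrite mxE.
Qed.

Lemma mderivN A m n (F : R -> 'M[R]_(m, n)) t L :
  mderiv A F t L -> mderiv A (fun s => - F s) t (- L).
Proof.
move=> hF i j; rewrite mxE; have := hdN (hF i j).
by congr (has_deriv_within _ _ _ _); apply/funext => s; rewrite mxE.
Qed.

Lemma mderivB A m n (F G : R -> 'M[R]_(m, n)) t L M :
  mderiv A F t L -> mderiv A G t M -> mderiv A (fun s => F s - G s) t (L - M).
Proof. by move=> hF hG; apply: mderivD => //; exact: mderivN. Qed.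

Lemma mderivZ A m n (F : R -> 'M[R]_(m, n)) t L c :
  mderiv A F t L -> mderiv A (fun s => c *: F s) t (c *: L).
Proof.
move=> hF i j; rewrite mxE; have := @hdZ _ _ _ _ _ c (hF i j).
by congr (has_deriv_within _ _ _ _); apply/funext => s; rewrite mxE.
Qed.

Lemma mderivT A m n (F : R -> 'M[R]_(m, n)) t L :
  mderiv A F t L -> mderiv A (fun s => (F s)^T) t L^T.
Proof.
move=> hF i j; rewrite mxE; have := hF j i.
by congr (has_deriv_within _ _ _ _); apply/funext => s; rewrite mxE.
Qed.

Lemma mderivM A m n p (F : R -> 'M[R]_(m, n)) (G : R -> 'M[R]_(n, p)) t L M :
  mderiv A F t L -> mderiv A G t M ->
  mderiv A (fun s => F s *m G s) t (L *m G t + F t *m M).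
Proof.
move=> hF hG i j.
have := @hd_sum R A 'I_n (index_enum _) xpredT
  (fun k s => F s i k * G s k j) t _ (fun k => hdM (hF i k) (hG k j)).
rewrite big_split /= !mxE.
by congr (has_deriv_within _ _ _ _); apply/funext => s; rewrite mxE.
Qed.

Lemma mderiv_eq A m n (F G : R -> 'M[R]_(m, n)) t L :
  A t -> (forall s, A s -> F s = G s) -> mderiv A F t L -> mderiv A G t L.
Proof.
by move=> At FG hF i j; apply: (hd_eq At _ (hF i j)) => s As; rewrite FG.
Qed.

Lemma mderiv_sub A B m n (F : R -> 'M[R]_(m, n)) t L :
  B `<=` A -> mderiv A F t L -> mderiv B F t L.
Proof. by move=> BA hF i j; exact: hd_sub (hF i j). Qed.

Lemma mderiv_unique A m n (F : R -> 'M[R]_(m, n)) t L M :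
  ProperFilter (within A t^') -> mderiv A F t L -> mderiv A F t M -> L = M.
Proof. by move=> PF h1 h2; apply/matrixP => i j; exact: hd_unique (h1 i j) (h2 i j). Qed.

Lemma mderiv0_cst J m n (F : R -> 'M[R]_(m, n)) a b : is_interval J -> J a -> J b ->
  (forall t, J t -> mderiv J F t 0) -> F b = F a.
Proof.
move=> iJ Ja Jb hF; apply/matrixP => i j.
by apply: (hd0_cst iJ (f := fun s => F s i j)) => // t Jt; have := hF t Jt i j; rewrite mxE.
Qed.

Lemma hd_within_cont J (f f' : R -> R) :
  (forall t, J t -> has_deriv_within J f t (f' t)) -> {within J, continuous f}.
Proof. by move=> hf; apply/subspace_continuousP => t Jt; exact: hd_cvg (hf t Jt). Qed.

Lemma mderiv_mcont J m n (F F' : R -> 'M[R]_(m, n)) :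
  (forall t, J t -> mderiv J F t (F' t)) -> mcont J F.
Proof.
move=> hF i j; apply: (@hd_within_cont J _ (fun t => F' t i j)) => t Jt; exact: hF.
Qed.

Lemma mcont_cst J m n (F : 'M[R]_(m, n)) : mcont J (fun=> F).
Proof. by move=> i j; apply/subspace_continuousP => t Jt; exact: cvg_cst. Qed.

Lemma mcontM J m n p (F : R -> 'M[R]_(m, n)) (G : R -> 'M[R]_(n, p)) :
  mcont J F -> mcont J G -> mcont J (fun s => F s *m G s).
Proof.
move=> hF hG i j.
rewrite (_ : (fun s => (F s *m G s) i j) = (fun s => \sum_k F s i k * G s k j)); last first.
  by apply/funext => s; rewrite mxE.
apply/subspace_continuousP => t Jt; apply: cvg_sumr => k; apply: cvgM.
  by have /subspace_continuousP := hF i k; exact.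
by have /subspace_continuousP := hG k j; exact.
Qed.

Lemma mcontN J m n (F : R -> 'M[R]_(m, n)) : mcont J F -> mcont J (fun s => - F s).
Proof.
move=> hF i j; rewrite (_ : (fun s => (- F s) i j) = (fun s => - F s i j)); last first.
  by apply/funext => s; rewrite mxE.
by apply/subspace_continuousP => t Jt; apply: cvgN; have /subspace_continuousP := hF i j; exact.
Qed.

Lemma mcontZ J m n c (F : R -> 'M[R]_(m, n)) : mcont J F -> mcont J (fun s => c *: F s).
Proof.
move=> hF i j; rewrite (_ : (fun s => (c *: F s) i j) = (fun s => c * F s i j)); last first.
  by apply/funext => s; rewrite mxE.
apply/subspace_continuousP => t Jt; apply: cvgM; first exact: cvg_cst.
by have /subspace_continuousP := hF i j; exact.
Qed.

Lemma mcontT J m n (F : R -> 'M[R]_(m, n)) : mcont J F -> mcont J (fun s => (F s)^T).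
Proof.
move=> hF i j; rewrite (_ : (fun s => (F s)^T i j) = (fun s => F s j i)); last first.
  by apply/funext => s; rewrite mxE.
by apply/subspace_continuousP => t Jt; have /subspace_continuousP := hF j i; exact.
Qed.

Lemma mcont_sub A J m n (F : R -> 'M[R]_(m, n)) : A `<=` J -> mcont J F -> mcont A F.
Proof. by move=> AJ hF i j; exact: continuous_subspaceW (hF i j). Qed.

Lemma segment_bounded a b (f : R -> R) : a <= b -> {within `[a, b], continuous f} ->
  exists C, forall t, a <= t <= b -> `|f t| <= C.
Proof.
move=> ab cf; have cf' : {within `[a, b], continuous (fun t => `|f t|)}.
  apply/subspace_continuousP => t Jt; apply: cvg_norm.
  by move/subspace_continuousP : cf; exact.
have [c _ hc] := EVT_max ab cf'.
by exists `|f c| => t tab; apply: hc; rewrite in_itv.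
Qed.

Lemma mcont_bounded a b m n (F : R -> 'M[R]_(m, n)) : a <= b -> mcont `[a, b] F ->
  exists2 C : R, 0 < C & forall t, a <= t <= b -> forall i j, `|F t i j| <= C.
Proof.
move=> ab hF.
have /choice[C hC] (i : 'I_m) : exists Ci, forall j t, a <= t <= b -> `|F t i j| <= Ci.
  have /choice[c hc] (j : 'I_n) := segment_bounded ab (hF i j).
  exists (\sum_j `|c j|) => j t tab; apply: (le_trans (hc j t tab)).
  by rewrite (bigD1 j)//= -[X in X <= _]addr0 lerD ?ler_norm// sumr_ge0.
exists (1 + \sum_i `|C i|); first by rewrite ltr_wpDr// sumr_ge0.
move=> t tab i j; apply: (le_trans (hC i j t tab)).
rewrite (bigD1 i)//= addrA -[X in X <= _]addr0 lerD ?sumr_ge0//.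
by rewrite (le_trans (ler_norm _))// lerDr.
Qed.

Lemma mulmx_entry_le m n p (F : 'M[R]_(m, n)) (G : 'M[R]_(n, p)) C e :
  (forall i j, `|F i j| <= C) -> (forall i j, `|G i j| <= e) ->
  forall i j, `|(F *m G) i j| <= n%:R * (C * e).
Proof.
move=> hF hG i j; rewrite mxE (le_trans (ler_norm_sum _ _ _))//.
have := @ler_sum R 'I_n (index_enum _) xpredT (fun k => `|F i k * G k j|) (fun=> C * e).
rewrite sumr_const card_ord mulr_natl => H; apply: H => k _.
by rewrite normrM ler_pM.
Qed.

Lemma small_half C e : 0 < e -> exists N, C * 2^-1 ^+ N <= e.
Proof.
move=> e0; have : (fun N => C * 2^-1 ^+ N) @ \oo --> 0.
  by apply: cvg_geometric; rewrite ger0_norm ?invf_lt1// ltr1n.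
move=> /cvgrPdist_le /(_ e e0) [N _ hN]; exists N.
by have := hN N (leqnn N); rewrite /= sub0r normrN; apply: le_trans; exact: ler_norm.
Qed.

(** [B / 2 * expR (2 * C * t)] has derivative [B * (C * expR (2 * C * t))], so integration gains the
    factor 1/2. *)
Lemma exp_bound_ge0 (f f' : R -> R) B C b : 0 <= b -> 0 < C -> f 0 = 0 ->
  (forall t, 0 <= t <= b -> has_deriv_within `[0, b] f t (f' t) /\
     `|f' t| <= B * (C * expR (2 * C * t))) ->
  `|f b| <= B / 2 * (expR (2 * C * b) - 1).
Proof.
move=> b0 C0 f0 H.
have := @hd_le R 0 b f f' (fun s => B / 2 * expR (2 * C * s))
  (fun s => B * (C * expR (2 * C * s))) b0.
rewrite f0 subr0 mulr0 expR0 -mulrBr; apply => t tb; have [h1 h2] := H t tb; split => //.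
apply: is_derive_hd; apply: is_derive_eq.
by rewrite /GRing.scale /= mulr1; field.
Qed.

Lemma exp_bound (f f' : R -> R) B C a b t : a <= 0 <= b -> 0 < C -> 0 <= B -> f 0 = 0 ->
  (forall t, a <= t <= b -> has_deriv_within `[a, b] f t (f' t) /\
     `|f' t| <= B * (C * expR (2 * C * `|t|))) -> a <= t <= b ->
  `|f t| <= B / 2 * expR (2 * C * `|t|).
Proof.
move=> /andP[a0 b0] C0 B0 f0 H /andP[at' tb].
have weak x : B / 2 * (x - 1) <= B / 2 * x by rewrite ler_wpM2l ?divr_ge0// gerBl.
have [t0|t0] := leP 0 t.
  rewrite (ger0_norm t0); apply: le_trans (weak _).
  apply: (@exp_bound_ge0 f f') => // s /andP[s0 st].
  have [|h1 h2] := H s; first by rewrite (le_trans a0 s0) (le_trans st tb).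
  rewrite (ger0_norm s0) in h2; split=> //; apply: hd_sub h1.
  by apply: subset_itv; rewrite bnd_simp.
apply: le_trans (weak _); rewrite -[in f t](opprK t) (ltr0_norm t0).
apply: (@exp_bound_ge0 (fun s => f (- s)) (fun s => - f' (- s))); rewrite ?oppr0//.
  by rewrite oppr_ge0 ltW.
move=> s /andP[s0 st]; have [|h1 h2] := H (- s).
  by apply/andP; split; lra.
rewrite normrN (ger0_norm s0) in h2; split; last by rewrite normrN.
have := hd_opp h1; rewrite opprK; apply: hd_sub => u /=; rewrite !in_itv /= => /andP[? ?].
by apply/andP; split; lra.
Qed.

(* Picard iteration; the weight [expR (2 * C * `|t|)] turns it into a contraction
   with factor 1/2 on every compact interval. *)
Lemma linear_flow J n (K : R -> 'M[R]_n) : is_interval J -> J 0 ->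
  (exists2 u, J u & u != 0) -> mcont J K ->
  exists2 F, F 0 = 1%:M & forall t, J t -> mderiv J F t (K t *m F t).
Proof.
move=> iJ J0 nJ cK.
(* The integral of [F] from [0]; without continuity nothing is asked of it, so that it can be chosen
   as a total operator [T]. *)
have int F : exists P : R -> 'M[R]_n, mcont J F ->
    P 0 = 0 /\ forall t, J t -> mderiv J P t (F t).
  have [cF|] := pselect (mcont J F); last by exists (fun=> 0).
  have /choice[P hP] (ij : 'I_n * 'I_n) : exists p : R -> R,
      p 0 = 0 /\ forall t, J t -> has_deriv_within J p t (F t ij.1 ij.2).
    by have [p p0 hp] := antiderivative iJ J0 nJ (cF ij.1 ij.2); exists p.
  exists (fun t => \matrix_(i, j) P (i, j) t) => _; split.
    by apply/matrixP => i j; rewrite !mxE (hP (i, j)).1.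
  move=> t Jt i j; have := (hP (i, j)).2 t Jt.
  by congr (has_deriv_within _ _ _ _); apply/funext => s; rewrite mxE.
have /choice[T hT] := int.
pose fix S N := if N is N'.+1 then fun t => 1%:M + T (fun s => K s *m S N' s) t
  else fun=> 1%:M.
have S0 N : mcont J (S N) -> S N.+1 0 = 1%:M.
  by move=> cS /=; rewrite (hT _ (mcontM cK cS)).1 addr0.
have S' N : mcont J (S N) -> forall t, J t -> mderiv J (S N.+1) t (K t *m S N t).
  move=> cS t Jt /=; rewrite -[X in mderiv _ _ _ X]add0r.
  by apply: mderivD; [exact: mderiv_cst|exact: (hT _ (mcontM cK cS)).2].
have cS N : mcont J (S N).
  elim: N => [|N IH]; first exact: mcont_cst.
  exact: mderiv_mcont (S' N IH).
have bound a b : a <= 0 <= b -> `[a, b] `<=` J -> exists E, forall N t, a <= t <= b ->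
    forall i j, `|S N.+1 t i j - S N t i j| <= 2^-1 ^+ N * E.
  move=> ab abJ.
  have [|c c0 hc] := mcont_bounded _ (mcont_sub abJ cK).
    by case/andP: ab => ? ?; exact: (@le_trans _ _ 0).
  (* [n.+1] instead of [n] keeps [C] positive, and at least [c], even in size 0. *)
  pose C := n.+1%:R * c.
  have C0 : 0 < C by rewrite mulr_gt0.
  have cC : n%:R * c <= C by rewrite ler_pM2r// ler_nat.
  have key N t : a <= t <= b ->
      forall i j, `|S N.+1 t i j - S N t i j| <= 2^-1 ^+ N * expR (2 * C * `|t|).
    elim: N t => [|N IH] t tab i j.
      (* The constant 2 is halved by [exp_bound], which gives the base case with factor 1. *)
      have := @exp_bound (fun t => S 1%N t i j - S 0%N t i j) (fun t => (K t) i j) 2 C a b t.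
      rewrite divff// expr0 S0// subrr; apply => //.
      move=> s sab; have Js : J s by apply: abJ; rewrite /= in_itv.
      split.
        apply: (hd_sub abJ); have := hdB (S' 0%N (cS _) s Js i j) (@mderiv_cst J n n 1%:M s i j).
        by rewrite mulmx1 (_ : (0 : 'M[R]_n) i j = 0) ?subr0// mxE.
      apply: (le_trans (hc s sab i j)).
      have cC' : c <= C by rewrite ler_peMl// ?ler1n// ltW.
      apply: (le_trans cC'); rewrite mulrCA; apply: ler_peMr; first exact: ltW.
      have e1 : 1 <= expR (2 * C * `|s|) by rewrite -expR0 ler_expR !mulr_ge0// ltW.
      by rewrite -[X in X <= _]mulr1 ler_pM// ler1n.
    rewrite exprSr.
    apply: (@exp_bound (fun t => S N.+2 t i j - S N.+1 t i j)
        (fun t => (K t *m (S N.+1 t - S N t)) i j) _ C a b) => //.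
      by rewrite !S0// subrr.
    move=> s sab; have Js : J s by apply: abJ; rewrite /= in_itv.
    split.
      apply: (hd_sub abJ); have := hdB (S' N.+1 (cS _) s Js i j) (S' N (cS _) s Js i j).
      by rewrite mulmxBr submxE.
    set x := 2^-1 ^+ N; set y := expR _.
    apply: (le_trans (@mulmx_entry_le _ _ _ _ (S N.+1 s - S N s) c (x * y) (hc s sab) _ i j)).
      by move=> k l; rewrite submxE; exact: IH.
    rewrite (_ : n%:R * (c * (x * y)) = x * (n%:R * c * y)); last by ring.
    by apply: ler_wpM2l; [exact: exprn_ge0|apply: ler_wpM2r => //; exact: expR_ge0].
  exists (expR (2 * C * (b - a))) => N t tab i j; apply: (le_trans (key N t tab i j)).
  rewrite ler_wpM2l ?exprn_ge0// ler_expR ler_wpM2l//; first by rewrite mulr_ge0// ltW.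
  rewrite ler_norml; move: ab tab => /andP[? ?] /andP[? ?]; apply/andP; split; lra.
have cvg t i j : J t -> cvgn (fun N => S N t i j).
  move=> Jt; have [a [b [ab tab abJ _]]] := segment_nbhs iJ J0 Jt.
  have [E hE] := bound a b ab abJ.
  have E0 : 0 <= E by have := hE 0%N t tab i j; rewrite expr0 mul1r; exact: le_trans.
  pose u N := S N.+1 t i j - S N t i j.
  have cu : cvgn (series u).
    apply: normed_cvg; apply: (@series_le_cvg _ _ (geometric E 2^-1)) => //.
    - by move=> N /=.
    - by move=> N; rewrite /geometric /= mulr_ge0// exprn_ge0.
    - by move=> N; rewrite /geometric /= mulrC; exact: hE.
    - by apply: is_cvg_geometric_series; rewrite ger0_norm ?invf_lt1// ltr1n.
  rewrite (_ : (fun N => S N t i j) = fun N => S 0%N t i j + series u N); last first.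
    by apply/funext => N; rewrite /series /= telescope_sumr// addrC subrK.
  by apply: is_cvgD => //; exact: is_cvg_cst.
pose F t : 'M[R]_n := \matrix_(i, j) limn (fun N => S N t i j).
have tail a b : a <= 0 <= b -> `[a, b] `<=` J -> exists E, forall N t, a <= t <= b ->
    forall i j, `|F t i j - S N t i j| <= E * 2^-1 ^+ N.
  move=> ab abJ; have [E hE] := bound a b ab abJ.
  exists (2 * E) => N t tab i j; have Jt : J t by apply: abJ; rewrite /= in_itv.
  (* Partial sums of the geometric series, with the exact factor [1 - 2^-1 ^+ p] so that the
     induction closes. *)
  have fin p : `|S (N + p)%N t i j - S N t i j| <= (2 * E * 2^-1 ^+ N) * (1 - 2^-1 ^+ p).
    elim: p => [|p IH]; first by rewrite addn0 !subrr normr0 mulr0.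
    rewrite addnS; have := hE (N + p)%N t tab i j; rewrite exprD exprS => h.
    have := ler_normD (S (N + p).+1 t i j - S (N + p)%N t i j) (S (N + p)%N t i j - S N t i j).
    rewrite addrA subrK => /le_trans; apply; apply: (le_trans (lerD h IH)).
    by rewrite le_eqVlt; apply/orP; left; apply/eqP; field.
  have E0 : 0 <= E by have := hE 0%N t tab i j; rewrite expr0 mul1r; exact: le_trans.
  have fin' M : (N <= M)%N -> `|S M t i j - S N t i j| <= 2 * E * 2^-1 ^+ N.
    move=> NM; rewrite -(subnKC NM); apply: (le_trans (fin _)).
    by rewrite ler_piMr ?mulr_ge0 ?exprn_ge0// gerBl exprn_ge0.
  rewrite mxE.
  have h : (fun M => `|S M t i j - S N t i j|) @ \oo --> `|limn (fun N => S N t i j) - S N t i j|.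
    by apply: cvg_norm; apply: cvgB; [exact: (cvg _ _ _ Jt)|exact: cvg_cst].
  rewrite -(cvg_lim _ h)//; apply: limr_le; first by apply/cvg_ex; eexists; exact: h.
  by exists N => // M /= NM; exact: fin'.
have cF : mcont J F.
  move=> i j; apply/subspace_continuousP => t Jt.
  have [a [b [ab tab abJ Nt]]] := segment_nbhs iJ J0 Jt.
  have [E hE] := tail a b ab abJ.
  apply/cvgrPdist_le => e e0; have [|N hN] := @small_half E (e / 3); first by rewrite divr_gt0.
  have /subspace_continuousP /(_ t Jt) /cvgrPdist_le /(_ (e / 3)) := cS N i j.
  rewrite divr_gt0// => /(_ isT); rewrite !near_withinE => h.
  near=> s => Js.
  have sab : s \in `[a, b] by move: Js; near: s.
  rewrite in_itv /= in sab.
  have h1 : `|S N t i j - S N s i j| <= e / 3 by move: Js; near: s.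
  have h2 := le_trans (hE N t tab i j) hN.
  have h3 := le_trans (hE N s sab i j) hN.
  rewrite (_ : F t i j - F s i j = (F t i j - S N t i j) + (S N t i j - S N s i j)
    - (F s i j - S N s i j)); last by ring.
  apply: (le_trans (ler_normB _ _)); apply: (le_trans (lerD (ler_normD _ _) (lexx _))).
  by apply: (le_trans (lerD (lerD h2 h1) h3)); lra.
have [P0 P'] := hT _ (mcontM cK cF).
have FE t : J t -> F t = 1%:M + T (fun s => K s *m F s) t.
  move=> Jt; apply/matrixP => i j.
  have [a [b [ab tab abJ Nt]]] := segment_nbhs iJ J0 Jt.
  have [E hE] := tail a b ab abJ.
  have [|c c0 hc] := mcont_bounded _ (mcont_sub abJ cK).
    by case/andP: ab => ? ?; exact: (@le_trans _ _ 0).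
  set y := (1%:M + _).
  (* [y] and [S N.+1] are the Picard images of [F] and [S N], so their distance is of order
     [2^-1 ^+ N]. As [S N.+1] also tends to [F], the limit is a fixed point. *)
  have hy N : `|y i j - S N.+1 t i j| <= (n%:R * c * E * `|t|) * 2^-1 ^+ N.
    have := @hd_lip R `[a, b] (fun s => (1%:M + T (fun s => K s *m F s) s) i j - S N.+1 s i j)
      (fun s => (K s *m (F s - S N s)) i j) (n%:R * (c * (E * 2^-1 ^+ N))) 0 t.
    rewrite P0 S0// addr0 subrr !subr0 (_ : _ * `|t| = n%:R * c * E * `|t| * 2^-1 ^+ N); last by ring.
    apply.
    - exact: is_interval_segment.
    - by rewrite /= in_itv.
    - by rewrite /= in_itv.
    - move=> s sab _; have Js := abJ _ sab; rewrite /= in_itv /= in sab.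
      split; last first.
        apply: mulmx_entry_le; first exact: hc.
        by move=> k l; have := hE N s sab k l; rewrite submxE.
      apply: (hd_sub abJ).
      have h0 : mderiv J (fun s => 1%:M + T (fun s => K s *m F s) s) s (0 + K s *m F s).
        by apply: mderivD; [exact: mderiv_cst|exact: P'].
      have := hdB (h0 i j) (S' N (cS _) s Js i j).
      by rewrite add0r mulmxBr submxE.
  apply/eqP; rewrite -subr_eq0 -normr_le0; apply/ler_addgt0Pr => e e0; rewrite add0r.
  have [N hN] := @small_half (E / 2 + n%:R * c * E * `|t|) e e0.
  apply: le_trans hN.
  rewrite (_ : F t i j - y i j = (F t i j - S N.+1 t i j) - (y i j - S N.+1 t i j)); last by ring.
  apply: (le_trans (ler_normB _ _)); apply: (le_trans (lerD (hE _ _ tab i j) (hy N))).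
  by rewrite exprS mulrDl mulrA.
exists F; first by rewrite FE// P0 addr0.
move=> t Jt; apply: (@mderiv_eq J _ _ (fun t => 1%:M + T (fun s => K s *m F s) t)) => //.
  by move=> s Js; rewrite -FE.
rewrite -[X in mderiv _ _ _ X]add0r.
by apply: mderivD; [exact: mderiv_cst|exact: P'].
Unshelve. all: by end_near. Qed.

(** Transposing the flow of minus the transpose of [K] moves the coefficient to the right. *)
Lemma linear_coflow J n (K : R -> 'M[R]_n) : is_interval J -> J 0 ->
  (exists2 u, J u & u != 0) -> mcont J K ->
  exists2 F, F 0 = 1%:M & forall t, J t -> mderiv J F t (- (F t *m K t)).
Proof.
move=> iJ J0 nJ cK.
have [|F F0 hF] := @linear_flow J n (fun t => - (K t)^T) iJ J0 nJ.
  by apply: mcontN; exact: mcontT.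
exists (fun t => (F t)^T); first by rewrite F0 trmx1.
move=> t Jt; have := mderivT (hF t Jt).
by rewrite mulNmx linearN /= trmx_mul trmxK.
Qed.

(* [G] is the inverse of [F]. *)
Definition is_flow J n (K F G : R -> 'M[R]_n) : Prop :=
  [/\ F 0 = 1%:M, G 0 = 1%:M,
      forall t, J t -> mderiv J F t (K t *m F t)
    & forall t, J t -> mderiv J G t (- (G t *m K t))].

Lemma flow_exists J n (K : R -> 'M[R]_n) : is_interval J -> J 0 ->
  (exists2 u, J u & u != 0) -> mcont J K -> exists F G, is_flow J K F G.
Proof.
move=> iJ J0 nJ cK; have [F F0 hF] := linear_flow iJ J0 nJ cK.
by have [G G0 hG] := linear_coflow iJ J0 nJ cK; exists F, G.
Qed.

(** [G *m F] has zero derivative, and a left inverse of a square matrix is a right inverse. *)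
Lemma flow_inv J n (K F G : R -> 'M[R]_n) : is_interval J -> J 0 -> is_flow J K F G ->
  forall t, J t -> G t *m F t = 1%:M /\ F t *m G t = 1%:M.
Proof.
move=> iJ J0 [F0 G0 hF hG] t Jt.
have GF : G t *m F t = 1%:M.
  have := @mderiv0_cst J n n (fun s => G s *m F s) 0 t iJ J0 Jt.
  rewrite F0 G0 mulmx1; apply => s Js.
  have := mderivM (hG s Js) (hF s Js).
  by rewrite mulNmx mulmxA addNr.
by split=> //; exact: mulmx1C.
Qed.

(** [G *m Y] has zero derivative. The solution may have any number of columns. *)
Lemma flow_unique J n m (K F G : R -> 'M[R]_n) (Y : R -> 'M[R]_(n, m)) :
  is_interval J -> J 0 -> is_flow J K F G ->
  (forall t, J t -> mderiv J Y t (K t *m Y t)) ->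
  forall t, J t -> Y t = F t *m Y 0.
Proof.
move=> iJ J0 FG hY t Jt; have [F0 G0 hF hG] := FG.
have [_ fg] := flow_inv iJ J0 FG Jt.
have GY : G t *m Y t = Y 0.
  have := @mderiv0_cst J n m (fun s => G s *m Y s) 0 t iJ J0 Jt.
  rewrite G0 mul1mx; apply => s Js.
  have := mderivM (hG s Js) (hY s Js).
  by rewrite mulNmx mulmxA addNr.
by rewrite -GY mulmxA fg mul1mx.
Qed.

Lemma is_flow_sub A J n (K F G : R -> 'M[R]_n) : A `<=` J ->
  is_flow J K F G -> is_flow A K F G.
Proof.
move=> AJ [F0 G0 hF hG]; split=> // t At; apply: (mderiv_sub AJ); [exact: hF (AJ _ At)|exact: hG (AJ _ At)].
Qed.

End MatrixPaths.

(** * Dependence of linear flows on parameters *)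

Section UniformConvergence.
Context {R : realType} {Y : Type} (G : set_system Y) {FG : Filter G}.
Implicit Types (a b t e C : R).

(** Uniform convergence on [[a, b]] along an arbitrary filter: neighbourhoods of a parameter for
    continuity, punctured neighbourhoods of [0] for difference quotients. *)
Definition muconv a b m n (F : Y -> R -> 'M[R]_(m, n)) (L : R -> 'M[R]_(m, n)) : Prop :=
  forall e, 0 < e -> \forall y \near G,
    forall t, a <= t <= b -> forall i j, `|F y t i j - L t i j| <= e.

Lemma muconv_cst a b m n (L : R -> 'M[R]_(m, n)) : muconv a b (fun=> L) L.
Proof. by move=> e e0; near=> y => t tab i j; rewrite subrr normr0 ltW.
Unshelve. all: by end_near. Qed.

Lemma muconv_eq a b m n (F F' : Y -> R -> 'M[R]_(m, n)) L L' :
  (\forall y \near G, forall t, a <= t <= b -> F y t = F' y t) ->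
  (forall t, a <= t <= b -> L t = L' t) -> muconv a b F L -> muconv a b F' L'.
Proof.
move=> FF' LL' h e e0; apply: filterS2 FF' (h e e0) => y h1 h2 t tab i j.
by rewrite -h1// -LL'//; exact: h2.
Qed.

Lemma muconvB a b m n (F H : Y -> R -> 'M[R]_(m, n)) L M :
  muconv a b F L -> muconv a b H M ->
  muconv a b (fun y t => F y t - H y t) (fun t => L t - M t).
Proof.
move=> hF hH e e0; have e2 : 0 < e / 2 by rewrite divr_gt0.
apply: filterS2 (hF _ e2) (hH _ e2) => y h1 h2 t tab i j; rewrite !submxE.
rewrite (_ : _ - _ = (F y t i j - L t i j) - (H y t i j - M t i j)); last by ring.
apply: (le_trans (ler_normB _ _)); rewrite [leRHS](splitr e).
by apply: lerD; [exact: h1|exact: h2].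
Qed.

Lemma muconvM a b m n p (F : Y -> R -> 'M[R]_(m, n)) (H : Y -> R -> 'M[R]_(n, p)) L M :
  a <= b -> mcont `[a, b] L -> mcont `[a, b] M ->
  muconv a b F L -> muconv a b H M ->
  muconv a b (fun y t => F y t *m H y t) (fun t => L t *m M t).
Proof.
move=> ab cL cM hF hH e e0.
have [C1 C10 hC1] := mcont_bounded ab cL; have [C2 C20 hC2] := mcont_bounded ab cM.
pose N := n%:R * (1 + C1 + C2) + 1 : R.
have N0 : 0 < N by rewrite ltr_wpDl// mulr_ge0// !addr_ge0// ltW.
(* [d <= 1] lets the product of the two errors be bounded linearly in [d]; [N] collects the
   coefficients. *)
pose d := Num.min 1 (e / N).
have d0 : 0 < d by rewrite lt_min ltr01 divr_gt0.
have d1 : d <= 1 by rewrite ge_min lexx.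
have dN : d * N <= e by rewrite -ler_pdivlMr// ge_min lexx orbT.
apply: filterS2 (hF _ d0) (hH _ d0) => y h1 h2 t tab i j.
rewrite -submxE.
have -> : F y t *m H y t - L t *m M t =
   (F y t - L t) *m (H y t - M t) + L t *m (H y t - M t) + (F y t - L t) *m M t.
  rewrite !mulmxBl !mulmxBr; set u := F y t *m H y t; set v := F y t *m M t.
  set w := L t *m H y t; set x := L t *m M t.
  by apply/matrixP => k l; rewrite !mxE; ring.
have h1' k l : `|(F y t - L t) k l| <= d by rewrite submxE; exact: h1.
have h2' k l : `|(H y t - M t) k l| <= d by rewrite submxE; exact: h2.
have b1 := mulmx_entry_le h1' h2' i j.
have b2 := mulmx_entry_le (hC1 t tab) h2' i j.
have b3 := mulmx_entry_le h1' (hC2 t tab) i j.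
rewrite [X in `|X|]mxE [X in `|X + _|]mxE.
apply: (le_trans (ler_normD _ _)); apply: (le_trans (lerD (ler_normD _ _) (lexx _))).
apply: (le_trans (lerD (lerD b1 b2) b3)); apply: le_trans dN.
have -> : n%:R * (d * d) + n%:R * (C1 * d) + n%:R * (d * C2) = d * (n%:R * (d + C1 + C2)) by ring.
apply: ler_wpM2l; first exact: ltW.
by rewrite /N -[leLHS]addr0 lerD// ler_wpM2l// !lerD2r.
Qed.

(** Mean value inequality from the common value at [0]. In the proof, [b - a + 1] replaces the
    length so as to be positive also when [a = b]. *)
Lemma muconv_deriv a b m n (F F' : Y -> R -> 'M[R]_(m, n)) L L' : a <= 0 <= b ->
  (\forall y \near G, F y 0 = L 0 /\
     forall t, a <= t <= b -> mderiv `[a, b] (F y) t (F' y t)) ->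
  (forall t, a <= t <= b -> mderiv `[a, b] L t (L' t)) ->
  muconv a b F' L' -> muconv a b F L.
Proof.
move=> /andP[a0 b0] hF hL hc e e0.
have T0 : 0 < b - a + 1 by rewrite ltr_wpDl// subr_ge0 (le_trans a0).
have d0 : 0 < e / (b - a + 1) by rewrite divr_gt0.
apply: filterS2 hF (hc _ d0) => y [F0 hy] h t tab i j.
have := @hd_lip R `[a, b] (fun s => F y s i j - L s i j) (fun s => F' y s i j - L' s i j)
  (e / (b - a + 1)) 0 t.
rewrite F0 subrr !subr0 => H; apply: (le_trans (H _ _ _ _)).
- exact: is_interval_segment.
- by rewrite /= in_itv /= a0.
- by rewrite /= in_itv.
- move=> s; rewrite /= in_itv /= => sab _; split; last exact: h.
  by apply: hdB; [exact: hy|exact: hL].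
- rewrite -mulrA ler_piMr ?(ltW e0)// mulrC ler_pdivrMr// mul1r.
  by rewrite ler_norml; move: tab => /andP[? ?]; apply/andP; split; lra.
Qed.

(* Gronwall, by bootstrapping: a bound [s] on the entries of [E y] improves to
   [1 + s / 2], hence the best bound is at most 2. *)
Lemma muconv_flow1 a b n (E L : Y -> R -> 'M[R]_n) : a <= 0 <= b ->
  (\forall y \near G, E y 0 = 1%:M /\
     forall t, a <= t <= b -> mderiv `[a, b] (E y) t (L y t *m E y t)) ->
  muconv a b L (fun=> 0) -> muconv a b E (fun=> 1%:M).
Proof.
move=> /andP[a0 b0] hE hL e e0.
have ab : a <= b by exact: le_trans b0.
pose N := n%:R * (b - a) + 1 : R.
have N0 : 0 < N by rewrite ltr_wpDl// mulr_ge0// subr_ge0.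
(* Makes [n%:R * (d * (b - a))] at most half of [Num.min 1 e]: the bound 1/2 drives the bootstrap,
   and [e / 2] times the resulting bound 2 is the required error. *)
pose d := Num.min 1 e / (2 * N).
have d0 : 0 < d by rewrite divr_gt0 ?mulr_gt0// lt_min ltr01.
have dN : n%:R * (d * (b - a)) <= Num.min 1 e / 2.
  have -> : Num.min 1 e / 2 = d * N by rewrite /d; field; rewrite gt_eqF.
  by rewrite mulrCA ler_wpM2l// ?ltW// /N ltrDl.
apply: filterS2 hE (hL _ d0) => y [E0 hy] h t tab i j.
have hL' s : a <= s <= b -> forall k l, `|L y s k l| <= d.
  by move=> sab k l; have := h s sab k l; rewrite mxE subr0.
have key B : (forall s, a <= s <= b -> forall k l, `|E y s k l| <= B) ->
    forall s, a <= s <= b -> forall k l, `|E y s k l - 1%:M k l| <= n%:R * (d * (b - a)) * B.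
  move=> hB s sab k l.
  have B0 : 0 <= B by apply: le_trans (hB s sab k l).
  have := @hd_lip R `[a, b] (fun s => E y s k l) (fun s => (L y s *m E y s) k l)
     (n%:R * (d * B)) 0 s.
  rewrite E0 subr0 => H; apply: (le_trans (H _ _ _ _)).
  - exact: is_interval_segment.
  - by rewrite /= in_itv /= a0.
  - by rewrite /= in_itv.
  - move=> u; rewrite /= in_itv /= => uab _; split; first exact: hy.
    by apply: mulmx_entry_le; [exact: hL'|exact: hB].
  - rewrite (_ : n%:R * (d * (b - a)) * B = n%:R * (d * B) * (b - a)); last by ring.
    apply: ler_wpM2l; first by rewrite mulr_ge0// mulr_ge0// ltW.
    by rewrite ler_norml; move: sab => /andP[? ?]; apply/andP; split; lra.
pose S := [set x : R | exists s k l, a <= s <= b /\ x = `|E y s k l|].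
have [B0 _ hB0] : exists2 C : R, 0 < C & forall t, a <= t <= b -> forall i j, `|E y t i j| <= C.
  apply: mcont_bounded => //; apply: mderiv_mcont => s.
  by rewrite /= in_itv /=; exact: hy.
have S0 : S !=set0 by exists `|E y t i j|, t, i, j.
have Sb : has_ubound S by exists B0 => _ [s [k [l [sab ->]]]]; exact: hB0.
have hS s : a <= s <= b -> forall k l, `|E y s k l| <= sup S.
  by move=> sab k l; apply: sup_upper_bound => //; exists s, k, l.
have sup0 : 0 <= sup S by apply: le_trans (hS t tab i j).
have S2 : sup S <= 1 + sup S / 2.
  apply: ge_sup => // _ [s [k [l [sab ->]]]].
  rewrite -[X in `|X|](subrK ((1%:M : 'M[R]_n) k l)); apply: (le_trans (ler_normD _ _)).
  rewrite addrC; apply: lerD; first by rewrite mxE; case: (k == l); rewrite ?normr1 ?normr0.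
  apply: (le_trans (key _ hS s sab k l)); rewrite mulrC; apply: ler_wpM2l => //.
  by apply: (le_trans dN); rewrite ler_pdivrMr// mulVf// ge_min lexx.
have S2' : sup S <= 2 by lra.
apply: (le_trans (key _ hS t tab i j)).
have : n%:R * (d * (b - a)) * sup S <= Num.min 1 e / 2 * 2.
  apply: ler_pM => //; rewrite mulr_ge0// mulr_ge0 ?subr_ge0//; exact: ltW.
by rewrite divfK// => /le_trans; apply; rewrite ge_min lexx orbT.
Qed.

Section FlowFamily.
Variables (a b : R) (n : nat) (K F : Y -> R -> 'M[R]_n) (K0 F0 G0 : R -> 'M[R]_n).
Hypothesis ab : a <= 0 <= b.
Hypothesis flow0 : is_flow `[a, b] K0 F0 G0.
Hypothesis contK0 : mcont `[a, b] K0.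
Hypothesis flowF : \forall y \near G, F y 0 = 1%:M /\
     forall t, a <= t <= b -> mderiv `[a, b] (F y) t (K y t *m F y t).
Hypothesis convK : muconv a b K K0.

Let leab : a <= b. Proof. by case/andP: ab; exact: le_trans. Qed.
Let seg t : `[a, b]%classic t <-> a <= t <= b. Proof. by rewrite /= in_itv. Qed.
Let contF0 : mcont `[a, b] F0.
Proof. by case: flow0 => _ _ h _; exact: mderiv_mcont h. Qed.
Let contG0 : mcont `[a, b] G0.
Proof. by case: flow0 => _ _ _ h; exact: mderiv_mcont h. Qed.
Let FG0 t : a <= t <= b -> F0 t *m G0 t = 1%:M.
Proof.
move=> tab; have [] // := flow_inv (@is_interval_segment R a b) _ flow0 (t := t); exact/seg.
Qed.

(** Variation of constants: the ratio [G0 *m F y] solves a linear equation whose generator is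
    [K y - K0] conjugated by [F0]. It tends to zero, so comparing two flows reduces to comparing a
    flow with the identity. *)
Let ratio_deriv : \forall y \near G, G0 0 *m F y 0 = 1%:M /\
  forall t, a <= t <= b -> mderiv `[a, b] (fun s => G0 s *m F y s) t
    ((G0 t *m (K y t - K0 t) *m F0 t) *m (G0 t *m F y t)).
Proof.
apply: filterS flowF => y [Fy0 hF]; split.
  by have [_ -> _ _] := flow0; rewrite Fy0 mulmx1.
move=> t tab; have [_ _ _ hG] := flow0.
have := mderivM (hG t ((seg t).2 tab)) (hF t tab).
congr (mderiv _ _ _ _).
by rewrite -!mulmxA (mulmxA (F0 t)) FG0// mul1mx mulmxBl mulmxBr mulNmx addrC !mulmxA.
Qed.

Let ratio_conv : muconv a b (fun y t => G0 t *m F y t) (fun=> 1%:M).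
Proof.
apply: (muconv_flow1 ab ratio_deriv).
have h : muconv a b (fun y t => K y t - K0 t) (fun=> 0).
  apply: muconv_eq (muconvB convK (muconv_cst a b K0)).
    by near=> y => t _.
  by move=> t _; rewrite subrr.
have c0 : mcont `[a, b] (fun=> 0 : 'M[R]_n) by exact: mcont_cst.
have h1 := muconvM leab contG0 c0 (muconv_cst a b G0) h.
have c1 : mcont `[a, b] (fun t => G0 t *m (0 : 'M[R]_n)) by exact: (mcontM contG0 c0).
apply: muconv_eq (muconvM leab c1 contF0 h1 (muconv_cst a b F0)).
  by near=> y => t _.
by move=> t _; rewrite mulmx0 mul0mx.
Unshelve. all: by end_near. Qed.

Lemma flow_uconv : muconv a b F F0.
Proof.
apply: muconv_eq (muconvM leab contF0 (@mcont_cst R _ n n 1%:M) (muconv_cst a b F0) ratio_conv).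
  by near=> y => t tab; rewrite mulmxA FG0// mul1mx.
by move=> t tab; rewrite mulmx1.
Unshelve. all: by end_near. Qed.

(* The quotients [(F y - F0) / h y] converge to the solution of the linearised
   equation: multiply by [G0] and compare derivatives. *)
Lemma flow_diff (h : Y -> R) (DK Z : R -> 'M[R]_n) :
  muconv a b (fun y t => (h y)^-1 *: (K y t - K0 t)) DK -> mcont `[a, b] DK ->
  Z 0 = 0 -> (forall t, a <= t <= b -> mderiv `[a, b] Z t (K0 t *m Z t + DK t *m F0 t)) ->
  muconv a b (fun y t => (h y)^-1 *: (F y t - F0 t)) Z.
Proof.
move=> hDK cDK Z0 hZ.
have cZ : mcont `[a, b] Z by apply: mderiv_mcont => t /seg; exact: hZ.
have N : muconv a b (fun y t => (h y)^-1 *: (G0 t *m F y t - 1%:M)) (fun t => G0 t *m Z t).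
  apply: (@muconv_deriv a b n n _ (fun y t => (h y)^-1 *: ((G0 t *m (K y t - K0 t) *m F0 t) *m (G0 t *m F y t))) _ (fun t => G0 t *m DK t *m F0 t)) => //.
  - apply: filterS ratio_deriv => y [E0 hE]; split.
      by rewrite E0 subrr scaler0 Z0 mulmx0.
    move=> t tab; apply: mderivZ; rewrite -[X in mderiv _ _ _ X]subr0.
    by apply: mderivB; [exact: hE|exact: mderiv_cst].
  - move=> t tab; have [_ _ _ hG] := flow0.
    have := mderivM (hG t ((seg t).2 tab)) (hZ t tab).
    by congr (mderiv _ _ _ _); rewrite mulNmx mulmxDr !mulmxA addrA addNr add0r.
  - have c1 : mcont `[a, b] (fun t => G0 t *m DK t) by exact: mcontM.
    have c2 : mcont `[a, b] (fun t => G0 t *m DK t *m F0 t) by exact: mcontM.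
    have h1 := muconvM leab contG0 cDK (muconv_cst a b G0) hDK.
    have h2 := muconvM leab c1 contF0 h1 (muconv_cst a b F0).
    apply: muconv_eq (muconvM leab c2 (@mcont_cst R _ n n 1%:M) h2 ratio_conv).
      by near=> y => t _; rewrite -scalemxAr -!scalemxAl.
    by move=> t _; rewrite mulmx1.
apply: muconv_eq (muconvM leab contF0 (mcontM contG0 cZ) (muconv_cst a b F0) N).
  by near=> y => t tab; rewrite -scalemxAr mulmxBr mulmxA FG0// mul1mx mulmx1.
by move=> t tab; rewrite mulmxA FG0// mul1mx.
Unshelve. all: by end_near. Qed.

End FlowFamily.
End UniformConvergence.

(** * Smooth functions of several variables *)

Section SmoothCalculus.
Context {R : realType}.

Lemma nbhs_mx m n (z : 'M[R]_(m, n)) (A : set 'M[R]_(m, n)) :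
  nbhs z A <-> exists2 e : R, 0 < e &
    forall y : 'M[R]_(m, n), (forall i j, `|z i j - y i j| < e) -> A y.
Proof.
split; first by move=> /nbhs_ballP[e /= e0 h]; exists e => // y hy; apply: h; split.
by move=> [e e0 h]; apply/nbhs_ballP; exists e => // y [_ hy]; apply: h => i j; exact: hy.
Qed.

(** * Algebra and localisation of C^k functions *)

Section Algebra.
Variable n : nat.
Implicit Types (D V : set 'rV[R]_n) (f g : 'rV[R]_n -> R) (k : nat).

Lemma Ck_cont k D f : Ck_on k D f -> {within D, continuous f}.
Proof. by case: k => [[]|k []]. Qed.

Lemma hp_eq D f g i y l : D y -> (forall y, D y -> f y = g y) ->
  has_partial_within D f i y l -> has_partial_within D g i y l.
Proof.
move=> Dy fg; apply: hd_eq; first by rewrite /= scale0r addr0.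
by move=> s /= /fg.
Qed.

Lemma Ck_eq k D f g : (forall y, D y -> f y = g y) -> Ck_on k D f -> Ck_on k D g.
Proof.
elim: k f g => [|k IH] f g fg [cf hf].
  split=> //; apply: (subspace_eq_continuous _ cf) => y; rewrite inE; exact: fg.
split.
  by apply: (subspace_eq_continuous _ cf) => y; rewrite inE; exact: fg.
move=> i; have [f' [h1 h2]] := hf i; exists f'; split => // y Dy.
exact: hp_eq (h1 y Dy).
Qed.

Lemma Ck_lower k D f : Ck_on k.+1 D f -> Ck_on k D f.
Proof.
elim: k f => [|k IH] f [cf hf]; first by [].
split=> // i; have [f' [h1 h2]] := hf i; exists f'; split => //; exact: IH.
Qed.

Lemma hp_sub D V f i y l : V `<=` D ->
  has_partial_within D f i y l -> has_partial_within V f i y l.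
Proof. by move=> VD; apply: hd_sub => s /VD. Qed.

Lemma Ck_sub k D V f : V `<=` D -> Ck_on k D f -> Ck_on k V f.
Proof.
move=> VD; elim: k f => [|k IH] f [cf hf].
  by split=> //; exact: continuous_subspaceW cf.
split; first exact: continuous_subspaceW cf.
move=> i; have [f' [h1 h2]] := hf i; exists f'; split; last exact: IH.
by move=> y Vy; apply: (hp_sub VD); exact: h1 (VD _ Vy).
Qed.

Lemma Ck_cst k D (c : R) : Ck_on k D (fun=> c).
Proof.
elim: k c => [|k IH] c; split=> //; try by apply/subspace_continuousP => y Dy; exact: cvg_cst.
by move=> i; exists (fun=> 0); split=> // y Dy; exact: hd_cst.
Qed.

Lemma CkD k D f g : Ck_on k D f -> Ck_on k D g -> Ck_on k D (fun y => f y + g y).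
Proof.
elim: k f g => [|k IH] f g [cf hf] [cg hg].
  split=> //; apply/subspace_continuousP => y Dy; apply: cvgD.
    by move/subspace_continuousP : cf; exact.
  by move/subspace_continuousP : cg; exact.
split.
  apply/subspace_continuousP => y Dy; apply: cvgD.
    by move/subspace_continuousP : cf; exact.
  by move/subspace_continuousP : cg; exact.
move=> i; have [f' [h1 h2]] := hf i; have [g' [h3 h4]] := hg i.
exists (fun y => f' y + g' y); split; last exact: IH.
by move=> y Dy; apply: hdD; [exact: h1|exact: h3].
Qed.

Lemma CkM k D f g : Ck_on k D f -> Ck_on k D g -> Ck_on k D (fun y => f y * g y).
Proof.
elim: k f g => [|k IH] f g hf hg.
  split=> //; apply/subspace_continuousP => y Dy; apply: cvgM.
    by move/subspace_continuousP : (Ck_cont hf); exact.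
  by move/subspace_continuousP : (Ck_cont hg); exact.
split.
  apply/subspace_continuousP => y Dy; apply: cvgM.
    by move/subspace_continuousP : (Ck_cont hf); exact.
  by move/subspace_continuousP : (Ck_cont hg); exact.
move=> i; have [f' [h1 h2]] := hf.2 i; have [g' [h3 h4]] := hg.2 i.
exists (fun y => f' y * g y + f y * g' y); split; last first.
  by apply: CkD; apply: IH => //; exact: Ck_lower.
move=> y Dy; have := hdM (h1 y Dy) (h3 y Dy).
by rewrite /= scale0r addr0.
Qed.

Lemma CkN k D f : Ck_on k D f -> Ck_on k D (fun y => - f y).
Proof.
move=> hf; apply: (Ck_eq _ (CkM (Ck_cst k D (-1)) hf)) => y _.
by rewrite mulN1r.
Qed.

Lemma Ck_sum k D (I : Type) (r : seq I) (F : I -> 'rV[R]_n -> R) :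
  (forall i, Ck_on k D (F i)) -> Ck_on k D (fun y => \sum_(i <- r) F i y).
Proof.
move=> hF; elim: r => [|i r IH].
  by apply: (Ck_eq _ (Ck_cst k D 0)) => y _; rewrite big_nil.
by apply: (Ck_eq _ (CkD (hF i) IH)) => y _; rewrite big_cons.
Qed.

Lemma Ck_prod k D (I : Type) (r : seq I) (F : I -> 'rV[R]_n -> R) :
  (forall i, Ck_on k D (F i)) -> Ck_on k D (fun y => \prod_(i <- r) F i y).
Proof.
move=> hF; elim: r => [|i r IH].
  by apply: (Ck_eq _ (Ck_cst k D 1)) => y _; rewrite big_nil.
by apply: (Ck_eq _ (CkM (hF i) IH)) => y _; rewrite big_cons.
Qed.

Lemma Ck_det k D m (F : 'rV[R]_n -> 'M[R]_m) :
  (forall i j, Ck_on k D (fun y => F y i j)) -> Ck_on k D (fun y => \det (F y)).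
Proof.
move=> hF; apply: Ck_sum => s; apply: CkM; first exact: Ck_cst.
by apply: Ck_prod => i.
Qed.

Lemma hdV (A : set R) (f : R -> R) (t l : R) : f t != 0 ->
  has_deriv_within A f t l -> has_deriv_within A (fun s => (f s)^-1) t (- (l / f t ^+ 2)).
Proof.
move=> ft0 hf; have hc := hd_cvg hf.
have hc' : f @ within A t^' --> f t.
  apply: cvg_trans hc; apply: cvg_app => U [e e0 eU].
  by exists e => // s se /eqP st; apply: eU.
have : (fun s => - ((f s - f t) / (s - t) * ((f s)^-1 / f t))) @ within A t^' -->
    - (l * ((f t)^-1 / f t)).
  by apply: cvgN; apply: cvgM => //; apply: cvgM; [exact: cvgV|exact: cvg_cst].
rewrite (_ : l * _ = l / f t ^+ 2); last by field.
apply: cvg_trans; apply: near_eq_cvg.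
have : \forall s \near within A t^', f s != 0.
  have /cvgrPdist_lt /(_ `|f t|) := hc'; rewrite normr_gt0 => /(_ ft0).
  apply: filterS => s h; apply/negP => /eqP fs0; move: h.
  by rewrite fs0 subr0 ltxx.
by apply: filterS => s fs0; set x := (s - t)^-1; field; rewrite ?ft0 ?fs0.
Qed.

Lemma CkV k D f : (forall y, D y -> f y != 0) -> Ck_on k D f -> Ck_on k D (fun y => (f y)^-1).
Proof.
move=> f0; elim: k f f0 => [|k IH] f f0 hf.
  split=> //; apply/subspace_continuousP => y Dy; apply: cvgV; first exact: f0.
  by move/subspace_continuousP : (Ck_cont hf); exact.
split.
  apply/subspace_continuousP => y Dy; apply: cvgV; first exact: f0.
  by move/subspace_continuousP : (Ck_cont hf); exact.
move=> i; have [f' [h1 h2]] := hf.2 i.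
have hV := IH f f0 (Ck_lower hf).
exists (fun y => - (f' y * ((f y)^-1 * (f y)^-1))); split; last first.
  by apply: CkN; apply: CkM => //; exact: CkM.
move=> y Dy; have := @hdV _ _ _ _ _ (h1 y Dy).
rewrite /= scale0r addr0 => /(_ (f0 y Dy)).
by rewrite expr2 invfM.
Qed.

(** Cramer's rule: a cofactor divided by a nonvanishing determinant. *)
Lemma Ck_invmx k D m (F : 'rV[R]_n -> 'M[R]_m) :
  (forall y, D y -> F y \in unitmx) ->
  (forall i j, Ck_on k D (fun y => F y i j)) ->
  forall i j, Ck_on k D (fun y => invmx (F y) i j).
Proof.
move=> uF hF i j.
have h : Ck_on k D (fun y => (\det (F y))^-1 * cofactor (F y) j i).
  apply: CkM.
    by apply: CkV (Ck_det hF) => y /uF; rewrite unitmxE unitfE.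
  apply: CkM; first exact: Ck_cst.
  apply: Ck_det => a b; apply: (Ck_eq _ (hF (lift j a) (lift i b))) => y _.
  by rewrite !mxE.
apply: Ck_eq h => y Dy.
by rewrite /invmx uF// !mxE.
Qed.

Lemma Ck_mulmx k D p q r (F : 'rV[R]_n -> 'M[R]_(p, q)) (G : 'rV[R]_n -> 'M[R]_(q, r)) :
  (forall i j, Ck_on k D (fun y => F y i j)) ->
  (forall i j, Ck_on k D (fun y => G y i j)) ->
  forall i j, Ck_on k D (fun y => (F y *m G y) i j).
Proof.
move=> hF hG i j.
have h : Ck_on k D (fun y => \sum_l F y i l * G y l j).
  by apply: Ck_sum => l; exact: CkM.
by apply: Ck_eq h => y _; rewrite mxE.
Qed.

Lemma line_cvg (y v : 'rV[R]_n) : (fun s : R => y + s *: v) @ (0 : R) --> y.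
Proof.
move=> A /nbhs_mx[e e0 h]; pose c := 1 + \sum_j `|v 0 j|.
have c0 : 0 < c by rewrite ltr_wpDr// sumr_ge0.
exists (e / c); first by rewrite /= divr_gt0.
move=> s; rewrite /= sub0r normrN => hs; apply: h => i j.
rewrite !mxE opprD addrA subrr add0r normrN normrM ord1.
have vc : `|v 0 j| <= c.
  rewrite /c (bigD1 j)//= addrA -[leLHS]addr0 lerD ?sumr_ge0//.
  by rewrite lerDr.
apply: (@le_lt_trans _ _ (`|s| * c)); first by rewrite ler_wpM2l.
by rewrite -ltr_pdivlMr.
Qed.

Lemma open_line_near D (y v : 'rV[R]_n) : open D -> D y ->
  \forall s \near (0 : R), D (y + s *: v).
Proof. by move=> oD Dy; apply: (line_cvg v); exact: open_nbhs_nbhs. Qed.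

Lemma open_line_proper D (y : 'rV[R]_n) i : open D -> D y ->
  ProperFilter (within [set s : R | D (y + s *: delta_mx 0 i)] (0 : R)^').
Proof.
move=> oD Dy; apply: limit_point_within => e e0.
have [d /= d0 h] := open_line_near (delta_mx 0 i) oD Dy.
have m0 : 0 < Num.min d e by rewrite lt_min d0.
exists (Num.min d e / 2); split.
- apply: h; rewrite /= sub0r normrN gtr0_norm ?divr_gt0//.
  apply: (@lt_le_trans _ _ (Num.min d e)); last by rewrite ge_min lexx.
  by rewrite ltr_pdivrMr// ltr_pMr// ltr1n.
- by rewrite gt_eqF// divr_gt0.
- rewrite sub0r normrN gtr0_norm ?divr_gt0//.
  apply: (@lt_le_trans _ _ (Num.min d e)); last by rewrite ge_min lexx orbT.
  by rewrite ltr_pdivrMr// ltr_pMr// ltr1n.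
Qed.

(** On an open set partial derivatives are unique, so those found on the neighbourhoods [V] agree
    with one function chosen on all of [D], to which the induction applies. *)
Lemma Ck_glue k D f : open D ->
  (forall y, D y -> exists V, [/\ open V, V y, V `<=` D & Ck_on k V f]) -> Ck_on k D f.
Proof.
move=> oD; elim: k f => [|k IH] f H.
  split=> //; apply/subspace_continuousP => y Dy.
  have [V [oV Vy VD hV]] := H y Dy.
  move/subspace_continuousP : (Ck_cont hV) => /(_ y Vy).
  rewrite !cvgrPdist_le => hc e e0; have := hc e e0.
  rewrite !near_withinE => h.
  have nV : \forall z \near y, V z by exact: open_nbhs_nbhs.
  by apply: filterS2 nV h => z Vz + _; exact.
split.
  apply/subspace_continuousP => y Dy.
  have [V [oV Vy VD hV]] := H y Dy.
  move/subspace_continuousP : (Ck_cont hV) => /(_ y Vy).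
  rewrite !cvgrPdist_le => hc e e0; have := hc e e0.
  rewrite !near_withinE => h.
  have nV : \forall z \near y, V z by exact: open_nbhs_nbhs.
  by apply: filterS2 nV h => z Vz + _; exact.
have up V y i l : open V -> V y -> has_partial_within V f i y l -> has_partial_within D f i y l.
  move=> oV Vy; apply: hd_near.
  have := open_line_near (delta_mx 0 i) oV Vy; apply: filterS => s + _; exact.
move=> i; have /choice[f' hf'] y : exists l, D y -> has_partial_within D f i y l.
  have [Dy|] := pselect (D y); last by exists 0.
  have [V [oV Vy VD [cV hV]]] := H y Dy; have [f' [h1 _]] := hV i.
  by exists (f' y) => _; exact: up (h1 y Vy).
exists f'; split=> //; apply: IH => y Dy.
have [V [oV Vy VD [cV hV]]] := H y Dy; have [g' [h1 h2]] := hV i.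
exists V; split=> //; apply: Ck_eq h2 => z Vz.
apply: (@hd_unique _ _ _ _ _ _ (open_line_proper i oD (VD z Vz))); last exact: hf' (VD _ Vz).
by apply: up (h1 z Vz).
Qed.

End Algebra.

(** * Functions of time and position *)

Section TimeDependent.
Variables (m : nat) (J : set R) (U : set 'rV[R]_m).
Implicit Types (f : R -> 'rV[R]_m -> R) (k : nat).

(** For [U] the image of a chart this is the domain used in [chart_smooth_family]; [tfun] and
    [tpair] pass between a pair [(t, y)] and the concatenated row. *)
Definition cyl : set 'rV[R]_(1 + m) := [set z | J (lsubmx z 0 0) /\ U (rsubmx z)].
Definition tfun (T : Type) (f : R -> 'rV[R]_m -> T) (z : 'rV[R]_(1 + m)) : T :=
  f (lsubmx z 0 0) (rsubmx z).
Definition tpair (t : R) (y : 'rV[R]_m) : 'rV[R]_(1 + m) := row_mx t%:M y.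

Lemma tfunE (T : Type) (f : R -> 'rV[R]_m -> T) t y : tfun f (tpair t y) = f t y.
Proof. by rewrite /tfun /tpair row_mxKl row_mxKr mxE eqxx. Qed.

Lemma tpairK (z : 'rV[R]_(1 + m)) : tpair (lsubmx z 0 0) (rsubmx z) = z.
Proof.
rewrite /tpair -[RHS]hsubmxK; congr row_mx.
by apply/matrixP => i j; rewrite !ord1 !mxE eqxx.
Qed.

Lemma cylE t y : cyl (tpair t y) <-> J t /\ U y.
Proof. by rewrite /cyl /tpair /= row_mxKl row_mxKr mxE eqxx. Qed.

Lemma tpair_l t y (s : R) i : tpair t y + s *: delta_mx 0 (lshift m i) = tpair (t + s) y.
Proof.
rewrite /tpair; apply/rowP => j; rewrite !ord1 !mxE !eqxx /=.
case: (split_ordP j) => j' ->; rewrite ?mxE.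
  by rewrite !ord1 !eqxx mulr1.
by rewrite eq_rlshift mulr0 addr0.
Qed.

Lemma tpair_r t y (s : R) i :
  tpair t y + s *: delta_mx 0 (rshift 1 i) = tpair t (y + s *: delta_mx 0 i).
Proof.
rewrite /tpair; apply/rowP => j; rewrite !mxE !eqxx /=.
case: (split_ordP j) => j' ->; rewrite ?mxE ?eqxx /=.
  by rewrite eq_lrshift mulr0 addr0.
by rewrite (inj_eq (@rshift_inj _ _)).
Qed.

Lemma hp_time f i t y l : U y ->
  has_partial_within cyl (tfun f) (lshift m i) (tpair t y) l <->
  has_deriv_within J (f^~ y) t l.
Proof.
move=> Uy; rewrite /has_partial_within.
rewrite (_ : [set s | _] = [set s | J (s + t)]); last first.
  apply/funext => s; rewrite /= tpair_l addrC; apply/propext.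
  by rewrite cylE; split=> [[]|].
rewrite (_ : (fun s => _) = (fun s => f (s + t) y)); last first.
  by apply/funext => s; rewrite tpair_l tfunE addrC.
by rewrite (hd_shift J (f^~ y)) add0r.
Qed.

Lemma hp_space f i t y l : J t ->
  has_partial_within cyl (tfun f) (rshift 1 i) (tpair t y) l <->
  has_partial_within U (f t) i y l.
Proof.
move=> Jt; rewrite /has_partial_within.
rewrite (_ : [set s | cyl _] = [set s | U (y + s *: delta_mx 0 i)]); last first.
  apply/funext => s; rewrite /= tpair_r; apply/propext.
  by rewrite cylE; split=> [[]|].
by rewrite (_ : (fun s => tfun _ _) = (fun s => f t (y + s *: delta_mx 0 i)))//;
  apply/funext => s; rewrite tpair_r tfunE.
Qed.

Lemma tpair_dist (t t' : R) (y y' : 'rV[R]_m) (e : R) :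
  (forall i j, `|tpair t y i j - tpair t' y' i j| < e) <->
  (`|t - t'| < e /\ forall i j, `|y i j - y' i j| < e).
Proof.
split=> [h|[h1 h2] i j].
  split; first by have := h 0 (lshift m 0); rewrite !row_mxEl !mxE eqxx.
  by move=> i j; have := h i (rshift 1 j); rewrite !row_mxEr.
case: (split_ordP j) => j' ->; first by rewrite !row_mxEl !mxE !ord1 eqxx.
by rewrite !row_mxEr.
Qed.

Lemma cyl_contP f : {within cyl, continuous (tfun f)} <->
  forall t y e, J t -> U y -> 0 < e -> exists2 d : R, 0 < d &
    forall t' y', J t' -> U y' -> `|t - t'| < d -> (forall i j, `|y i j - y' i j| < d) ->
      `|f t y - f t' y'| <= e.
Proof.
split=> [/subspace_continuousP H t y e Jt Uy e0|H].
  have /cvgrPdist_le /(_ e e0) := H (tpair t y) ((cylE _ _).2 (conj Jt Uy)).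
  rewrite near_withinE => /nbhs_mx[d d0 h]; exists d => // t' y' Jt' Uy' tt' yy'.
  have := h (tpair t' y'); rewrite /from_subspace !tfunE; apply; last exact/cylE.
  exact/tpair_dist.
apply/subspace_continuousP => z; rewrite -(tpairK z); set t := lsubmx z 0 0; set y := rsubmx z.
move=> /cylE[Jt Uy]; apply/cvgrPdist_le => e e0.
have [d d0 h] := H t y e Jt Uy e0; rewrite near_withinE; apply/nbhs_mx; exists d => // z'.
rewrite -(tpairK z') => /tpair_dist[h1 h2] /cylE[Jt' Uy'].
by rewrite /from_subspace !tfunE; exact: h.
Qed.

Lemma Ck_space k (f : 'rV[R]_m -> R) : Ck_on k U f -> Ck_on k cyl (tfun (fun _ y => f y)).
Proof.
have cont (g : 'rV[R]_m -> R) : {within U, continuous g} ->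
    {within cyl, continuous (tfun (fun _ y => g y))}.
  move=> /subspace_continuousP cg; apply/cyl_contP => t y e _ Uy e0.
  have /cvgrPdist_le /(_ e e0) := cg y Uy; rewrite near_withinE => /nbhs_mx[d d0 h].
  by exists d => // t' y' _ Uy' _ yy'; exact: h.
elim: k f => [|k IH] f [cf hf]; first by split=> //; exact: cont.
split; first exact: cont.
move=> i; case: (split_ordP i) => j ->.
  exists (fun=> 0); split; last exact: Ck_cst.
  move=> z; rewrite -(tpairK z) => /cylE[Jt Uy]; apply/hp_time => //; exact: hd_cst.
have [f' [h1 h2]] := hf j; exists (tfun (fun _ y => f' y)); split; last exact: IH.
move=> z; rewrite -(tpairK z) => /cylE[Jt Uy]; rewrite tfunE; apply/hp_space => //.
exact: h1.
Qed.

Lemma Ck_slice k t f : J t -> Ck_on k cyl (tfun f) -> Ck_on k U (f t).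
Proof.
move=> Jt.
have cont (g : R -> 'rV[R]_m -> R) : {within cyl, continuous (tfun g)} -> {within U, continuous (g t)}.
  move=> /cyl_contP cg; apply/subspace_continuousP => y Uy.
  apply/cvgrPdist_le => e e0; rewrite near_withinE; apply/nbhs_mx.
  have [d d0 h] := cg t y e Jt Uy e0; exists d => // y' yy' Uy'.
  by apply: h => //; rewrite subrr normr0.
elim: k f => [|k IH] f [cf hf]; first by split=> //; exact: cont.
split; first exact: cont.
move=> i; have [f' [h1 h2]] := hf (rshift 1 i).
have f'E : f' = tfun (fun t y => f' (tpair t y)).
  by apply/funext => z; rewrite /tfun tpairK.
exists (fun y => f' (tpair t y)); split; last first.
  by apply: (IH (fun t y => f' (tpair t y))); rewrite -f'E.
move=> y Uy; apply/(hp_space f i y _ Jt); apply: h1; exact/cylE.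
Qed.

(** Meant for [metric_dot], which is defined as a pointwise limit: uniqueness of derivatives
    identifies it with the partial derivative that [Ck_on] supplies. *)
Lemma Ck_time_deriv k f f' : (forall t, J t -> ProperFilter (within J t^')) ->
  (forall t y, J t -> U y -> has_deriv_within J (f^~ y) t (f' t y)) ->
  Ck_on k.+1 cyl (tfun f) -> Ck_on k cyl (tfun f').
Proof.
move=> PJ hf' [_ /(_ (lshift m 0))[g [h1 h2]]].
apply: Ck_eq h2 => z; rewrite -(tpairK z) => /cylE[Jt Uy].
rewrite tfunE; apply: (hd_unique (PJ _ Jt)) (hf' _ _ Jt Uy).
by apply/(hp_time f 0 _ _ Uy); apply: h1; exact/cylE.
Qed.

End TimeDependent.
End SmoothCalculus.

(** * Smoothness of linear flows *)

Section FlowRegularity.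
Context {R : realType}.

(** Tube lemma: closeness near each point of the compact segment, jointly in time and parameter, is
    uniform in time. *)
Lemma muconv_tube (Y : Type) (G : set_system Y) {FG : Filter G} (a b : R) m n
    (F : Y -> R -> 'M[R]_(m, n)) (L : R -> 'M[R]_(m, n)) :
  (forall t (e : R) i j, a <= t <= b -> 0 < e ->
     \forall s \near t & v \near G, a <= s <= b -> `|F v s i j - L s i j| <= e) ->
  muconv G a b F L.
Proof.
move=> H e e0.
have key ij : \forall v \near G, forall t, a <= t <= b -> `|F v t ij.1 ij.2 - L t ij.1 ij.2| <= e.
  have := (compact_near_coveringP _).1 (@segment_compact R a b).
  move=> /near_covering_withinP /(_ Y G
    (fun v t => `|F v t ij.1 ij.2 - L t ij.1 ij.2| <= e) FG) h.
  have : \forall v \near G, `[a, b]%classic `<=` (fun t => `|F v t ij.1 ij.2 - L t ij.1 ij.2| <= e).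
    apply: h => t; rewrite /= in_itv /= => tab.
    have [[A B] [/= hA hB] hAB] := H t e ij.1 ij.2 tab e0.
    exists (A, B); first by [].
    by move=> [s v] [/= As Bv]; rewrite in_itv /=; exact: (hAB (s, v)).
  by apply: filterS => v hv t tab; apply: hv; rewrite /= in_itv.
have := @filter_forall _ _ _ G FG key.
by apply: filterS => v hv t tab i j; exact: (hv (i, j)).
Qed.

Section Cylinder.
Variables (J : set R) (m : nat) (U : set 'rV[R]_m).
Hypotheses (iJ : is_interval J) (J0 : J 0) (nJ : exists2 u, J u & u != 0) (oU : open U).

Let Kcont n (K : R -> 'rV[R]_m -> 'M[R]_n) :=
  forall i j, {within cyl J U, continuous (tfun (fun t y => K t y i j))}.
Let isflow n (K F : R -> 'rV[R]_m -> 'M[R]_n) := forall y, U y ->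
  F 0 y = 1%:M /\ forall t, J t -> mderiv J (F^~ y) t (K t y *m F t y).

Let Kcont_time n (K : R -> 'rV[R]_m -> 'M[R]_n) y : Kcont K -> U y -> mcont J (K^~ y).
Proof.
move=> cK Uy i j; apply/subspace_continuousP => t Jt; apply/cvgrPdist_le => e e0.
have [d d0 h] := (cyl_contP _ _ _).1 (cK i j) t y e Jt Uy e0.
rewrite near_withinE; exists d => // s /= sd Js; apply: h => // k l.
by rewrite subrr normr0.
Qed.

Let Kmuconv n (K : R -> 'rV[R]_m -> 'M[R]_n) y a b : Kcont K -> U y -> `[a, b] `<=` J ->
  muconv (within U (nbhs y)) a b (fun v t => K t v) (K^~ y).
Proof.
move=> cK Uy abJ; apply: muconv_tube => t e i j tab e0.
have Jab s : a <= s <= b -> J s by move=> sab; apply: abJ; rewrite /= in_itv.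
have [|d d0 h] := (cyl_contP _ _ _).1 (cK i j) t y (e / 2) (Jab t tab) Uy.
  by rewrite divr_gt0.
exists ([set s | `|t - s| < d], [set v | U v /\ forall k l, `|y k l - v k l| < d]).
  split; first by exists d.
  have : \forall v \near within U (nbhs y), U v /\ forall k l, `|y k l - v k l| < d.
    by rewrite near_withinE; apply/nbhs_mx; exists d.
  by [].
move=> [s v] [/= sd [Uv vd]] sab.
have h1 := h s v (Jab s sab) Uv sd vd.
have h2 : `|K t y i j - K s y i j| <= e / 2.
  by apply: h => //; [exact: Jab|move=> k l; rewrite subrr normr0].
rewrite (_ : K s v i j - K s y i j = (K t y i j - K s y i j) - (K t y i j - K s v i j)); last by ring.
by rewrite (le_trans (ler_normB _ _))// [leRHS]splitr lerD.
Qed.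

Let flow_at n (K F : R -> 'rV[R]_m -> 'M[R]_n) y : Kcont K -> isflow K F -> U y ->
  exists G, is_flow J (K^~ y) (F^~ y) G.
Proof.
move=> cK hF Uy; have [F1 [G1 FG]] := flow_exists iJ J0 nJ (Kcont_time cK Uy).
by have [F0 F'] := hF y Uy; exists G1; case: FG => _ ? _ ?; split.
Qed.

(** Convergence uniform in time as the parameter tends to [y], combined with continuity in time at
    the fixed parameter [y]. *)
Lemma flow_continuous n (K F : R -> 'rV[R]_m -> 'M[R]_n) :
  Kcont K -> isflow K F -> Kcont F.
Proof.
move=> cK hF i j; apply/cyl_contP => t y e Jt Uy e0.
have [a [b [ab tab abJ Nt]]] := segment_nbhs iJ J0 Jt.
have Jab s : a <= s <= b -> J s by move=> sab; apply: abJ; rewrite /= in_itv.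
have [G0 fl] := flow_at cK hF Uy.
have fl' := is_flow_sub abJ fl.
have e2 : 0 < e / 2 by rewrite divr_gt0.
have := @flow_uconv R _ (within U (nbhs y)) _ a b n (fun v t => K t v) (fun v t => F t v)
  (K^~ y) (F^~ y) G0 ab fl' _ (Kmuconv cK Uy abJ) (e / 2) e2.
rewrite !near_withinE => H.
have H1 : \forall v \near y, U v -> F 0 v = 1%:M /\
    forall s, a <= s <= b -> mderiv `[a, b] (F^~ v) s (K s v *m F s v).
  near=> v => Uv; have [v0 v'] := hF v Uv; split=> // s sab.
  by apply: (mderiv_sub abJ); exact: v' (Jab s sab).
have /nbhs_mx[d1 d10 h1] : nbhs y [set v | U v -> forall s, a <= s <= b ->
    forall k l, `|F s v k l - F s y k l| <= e / 2] by exact: H H1.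
have h0 : {within J, continuous (fun s => F s y i j)}.
  by apply: mderiv_mcont => s Js; exact: (hF y Uy).2.
move/subspace_continuousP : h0 => /(_ t Jt) /cvgrPdist_le /(_ _ e2).
rewrite near_withinE => -[d2 /= d20 h2].
have [d3 /= d30 h3] := Nt.
exists (Num.min d1 (Num.min d2 d3)); first by rewrite !lt_min d10 d20.
move=> s v Js Uv; rewrite !lt_min => /and3P[_ sd2 sd3] vd.
have sab : a <= s <= b by have := h3 s sd3 Js; rewrite in_itv.
have k1 : `|F s v i j - F s y i j| <= e / 2.
  apply: h1 => // k l; apply: lt_le_trans (vd k l) _.
  by rewrite ge_min lexx.
have k2 := h2 s sd2 Js; rewrite /from_subspace in k2.
rewrite (_ : F t y i j - F s v i j = (F t y i j - F s y i j) - (F s v i j - F s y i j)); last by ring.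
by rewrite (le_trans (ler_normB _ _))// [leRHS]splitr lerD.
Unshelve. all: by end_near. Qed.

(** [Z] solves the linearised equation. What has to be shown is that the difference quotients of [K]
    in direction [l] converge to [DK] uniformly on a segment of times; [flow_diff] then applies with
    the step size as parameter. *)
Lemma flow_space_deriv n (K F DK Z : R -> 'rV[R]_m -> 'M[R]_n) (l : 'I_m) :
  Kcont K -> isflow K F -> Kcont DK ->
  (forall t y i j, J t -> U y -> has_partial_within U (fun y => K t y i j) l y (DK t y i j)) ->
  (forall y, U y -> Z 0 y = 0 /\
     forall t, J t -> mderiv J (Z^~ y) t (K t y *m Z t y + DK t y *m F t y)) ->
  forall t y i j, J t -> U y -> has_partial_within U (fun y => F t y i j) l y (Z t y i j).
Proof.
move=> cK hF cDK hDK hZ t y i j Jt Uy.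
have [a [b [ab tab abJ Nt]]] := segment_nbhs iJ J0 Jt.
have Jab s : a <= s <= b -> J s by move=> sab; apply: abJ; rewrite /= in_itv.
have [G0 fl] := flow_at cK hF Uy.
pose v := delta_mx 0 l : 'rV[R]_m.
have Nv : \forall s \near (0 : R)^', U (y + s *: v).
  by apply: nbhs_dnbhs; exact: open_line_near.
have H : muconv (0 : R)^' a b (fun s t => s^-1 *: (F t (y + s *: v) - F t y)) (Z^~ y).
  apply: (@flow_diff R R (0 : R)^' _ a b n (fun s t => K t (y + s *: v))
    (fun s t => F t (y + s *: v)) (K^~ y) (F^~ y) G0 ab (is_flow_sub abJ fl) _ _ id (DK^~ y)).
  - apply: filterS Nv => s Us; have [v0 v'] := hF _ Us; split=> // r rab.
    by apply: (mderiv_sub abJ); exact: v' (Jab r rab).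
  - move=> e e0; have := Kmuconv cK Uy abJ e0; rewrite near_withinE => h.
    by apply: filterS2 Nv (nbhs_dnbhs (line_cvg v h)) => s Us; apply.
  - apply: muconv_tube => r e p q rab e0.
    have [|d d0 h] := (cyl_contP _ _ _).1 (cDK p q) r y (e / 2) (Jab r rab) Uy.
      by rewrite divr_gt0.
    have [d1 /= d10 h1] := open_line_near v oU Uy.
    have [d2 /= d20 h2] : \forall s \near (0 : R), forall k l, `|y k l - (y + s *: v) k l| < d.
      have nb : nbhs y [set z | forall k l, `|y k l - z k l| < d] by apply/nbhs_mx; exists d.
      exact: (line_cvg v nb).
    pose d3 := Num.min d1 d2.
    have d30 : 0 < d3 by rewrite lt_min d10.
    exists ([set s | `|r - s| < d], [set s | `|s| < d3 /\ s != 0]).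
      split; first by exists d.
      by exists d3 => // s /= sd s0; split=> //; rewrite sub0r normrN in sd.
    move=> [s h'] [/= sd [hd h'0]] sab.
    have small x : `|x| <= `|h'| -> U (y + x *: v) /\ forall k l, `|y k l - (y + x *: v) k l| < d.
      move=> xh; have : `|x| < d3 by exact: le_lt_trans hd.
      rewrite lt_min => /andP[x1 x2]; split.
        by apply: h1; rewrite /= sub0r normrN.
      by apply: h2; rewrite /= sub0r normrN.
    have dk x : `|x| <= `|h'| -> `|DK r y p q - DK s (y + x *: v) p q| <= e / 2.
      by move=> /small[Ux xd]; apply: h => //; exact: Jab.
    (* Mean value inequality along the coordinate line, after subtraction of the linear term: the
       remainder has derivative at most [e / 2]. *)
    have := @hd_lip R [set x : R | `|x| <= `|h'|] (fun x => K s (y + x *: v) p q - DK r y p q * x)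
      (fun x => DK s (y + x *: v) p q - DK r y p q) (e / 2) 0 h'.
    rewrite !subr0 mulr0 subr0 scale0r addr0 /= => hl.
    have {hl} k1 : `|K s (y + h' *: v) p q - DK r y p q * h' - K s y p q| <= e / 2 * `|h'|.
      apply: hl.
      - move=> x1 x2 /= hx1 hx2 x /andP[x1x xx2]; move: hx1 hx2.
        by rewrite !ler_norml => /andP[? ?] /andP[? ?]; apply/andP; split; lra.
      - by rewrite /= normr0.
      - by rewrite /=.
      - move=> x /= xh _; have [Ux _] := small x xh; split; last by rewrite distrC; exact: dk.
        apply: hdB; last by have := @hdZ _ _ _ _ _ (DK r y p q) (@hd_id R [set x : R | `|x| <= `|h'|] x); rewrite mulr1.
        have := hDK s _ p q (Jab s sab) Ux; rewrite /has_partial_within => hp.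
        have := (@hd_shift R [set x : R | U (y + x *: v)] (fun x => K s (y + x *: v) p q) 0 x (DK s (y + x *: v) p q)).1.
        rewrite add0r => hs; apply: (hd_sub _ (hs _)); first by move=> z /small[].
        move: hp; congr has_deriv_within.
          by apply/funext => z; rewrite /= scalerDl addrA addrAC.
        by apply/funext => z; rewrite /= scalerDl addrA addrAC.
    have k2 : `|DK r y p q - DK s y p q| <= e / 2.
      by have := dk 0; rewrite normr0 scale0r addr0; exact.
    rewrite !mxE.
    rewrite (_ : h'^-1 * _ - _ = h'^-1 * (K s (y + h' *: v) p q - DK r y p q * h' - K s y p q)
        + (DK r y p q - DK s y p q)); last by field.
    apply: (le_trans (ler_normD _ _)); rewrite [leRHS]splitr; apply: lerD => //.
    rewrite normrM normfV mulrC ler_pdivrMr ?normr_gt0//.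
  - by apply: (mcont_sub abJ); exact: Kcont_time.
  - by have [] := hZ y Uy.
  - move=> s sab; apply: (mderiv_sub abJ); exact: (hZ y Uy).2 (Jab s sab).
rewrite /has_partial_within /has_deriv_within; apply/cvgrPdist_le => e e0.
have := H e e0; rewrite near_withinE; apply: filterS => s hs _.
have := hs t tab i j; rewrite distrC !mxE !subr0 scale0r addr0 mulrC.
by rewrite -[delta_mx 0 l]/v.
Qed.

(** The first block column of the flow of the block matrix with rows [(K, 0)] and [(DK, K)] consists
    of [F] and its derivative in direction [l]. If [K] is C^(k+1) this matrix is C^k, so the
    induction hypothesis in size [n + n] makes the derivative C^k. *)
Lemma flow_Ck k n (K F : R -> 'rV[R]_m -> 'M[R]_n) :
  (forall i j, Ck_on k (cyl J U) (tfun (fun t y => K t y i j))) -> isflow K F ->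
  forall i j, Ck_on k (cyl J U) (tfun (fun t y => F t y i j)).
Proof.
elim: k n K F => [|k IH] n K F hK hF i j.
  by split=> //; apply: (@flow_continuous n K F) => // p q; exact: Ck_cont (hK p q).
have cK : Kcont K by move=> p q; exact: Ck_cont (hK p q).
have hK' p q : Ck_on k (cyl J U) (tfun (fun t y => K t y p q)) by exact: Ck_lower.
have hFk p q := IH n K F hK' hF p q.
split; first exact: flow_continuous.
move=> l; case: (split_ordP l) => {}l ->.
  exists (tfun (fun t y => (K t y *m F t y) i j)); split.
    move=> z; rewrite -(tpairK z) => /cylE[Jt Uy]; rewrite tfunE; apply/hp_time => //.
    exact: (hF _ Uy).2.
  exact: (@Ck_mulmx R (1 + m) k (cyl J U) n n n (tfun K) (tfun F)).
have /choice[D hD] (pq : 'I_n * 'I_n) := (hK pq.1 pq.2).2 (rshift 1 l).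
pose DK t y : 'M[R]_n := \matrix_(p, q) D (p, q) (tpair t y).
have DKk p q : Ck_on k (cyl J U) (tfun (fun t y => DK t y p q)).
  apply: Ck_eq (hD (p, q)).2 => z _; by rewrite /tfun mxE tpairK.
pose K2 t y := block_mx (K t y) 0 (DK t y) (K t y).
have K2k p q : Ck_on k (cyl J U) (tfun (fun t y => K2 t y p q)).
  case: (split_ordP p) => p' ->; case: (split_ordP q) => q' ->.
  - by apply: Ck_eq (hK' p' q') => z _; rewrite /tfun block_mxEul.
  - by apply: Ck_eq (Ck_cst k _ 0) => z _; rewrite /tfun block_mxEur mxE.
  - by apply: Ck_eq (DKk p' q') => z _; rewrite /tfun block_mxEdl.
  - by apply: Ck_eq (hK' p' q') => z _; rewrite /tfun block_mxEdr.
have cK2 : Kcont K2 by move=> p q; exact: Ck_cont (K2k p q).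
have /choice[F2 hF2] y : exists F2 : R -> 'M[R]_(n + n), U y ->
    F2 0 = 1%:M /\ forall t, J t -> mderiv J F2 t (K2 t y *m F2 t).
  have [Uy|] := pselect (U y); last by exists (fun=> 0).
  by have [F2 ? ?] := linear_flow iJ J0 nJ (Kcont_time cK2 Uy); exists F2.
have F2k p q := IH (n + n)%N K2 (fun t y => F2 y t) K2k hF2 p q.
have blk y t : U y -> J t ->
    mderiv J (fun s => ulsubmx (F2 y s)) t (K t y *m ulsubmx (F2 y t)) /\
    mderiv J (fun s => dlsubmx (F2 y s)) t
      (DK t y *m ulsubmx (F2 y t) + K t y *m dlsubmx (F2 y t)).
  move=> Uy Jt; have := (hF2 y Uy).2 t Jt.
  have -> : K2 t y *m F2 y t = block_mx (K t y *m ulsubmx (F2 y t)) (K t y *m ursubmx (F2 y t))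
      (DK t y *m ulsubmx (F2 y t) + K t y *m dlsubmx (F2 y t))
      (DK t y *m ursubmx (F2 y t) + K t y *m drsubmx (F2 y t)).
    by rewrite -[F2 y t in LHS]submxK /K2 mulmx_block !mul0mx !addr0.
  move=> h; split => p q.
    have := h (lshift n p) (lshift n q); rewrite block_mxEul.
    by congr has_deriv_within; apply/funext => s; rewrite !mxE.
  have := h (rshift n p) (lshift n q); rewrite block_mxEdl.
  by congr has_deriv_within; apply/funext => s; rewrite !mxE.
have ulF y t : U y -> J t -> ulsubmx (F2 y t) = F t y.
  move=> Uy Jt; have [G0 fl] := flow_at cK hF Uy.
  have := @flow_unique R J n n _ _ _ (fun s => ulsubmx (F2 y s)) iJ J0 fl.
  have -> : ulsubmx (F2 y 0) = 1%:M by rewrite (hF2 y Uy).1 scalar_mx_block block_mxKul.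
  rewrite -[RHS]mulmx1; apply => //.
  by move=> s Js; have [] := blk y s Uy Js.
exists (tfun (fun t y => dlsubmx (F2 y t) i j)); split; last first.
  by apply: Ck_eq (F2k (rshift n i) (lshift n j)) => z _; rewrite /tfun !mxE.
move=> z; rewrite -(tpairK z) => /cylE[Jt Uy]; rewrite tfunE; apply/hp_space => //.
apply: (@flow_space_deriv n K F DK (fun t y => dlsubmx (F2 y t))) => //.
- by move=> p q; exact: Ck_cont (DKk p q).
- move=> t y p q Jt' Uy'; rewrite mxE; apply: (iffLR (hp_space U (fun t y => K t y p q) l y _ Jt')).
  apply: (hD (p, q)).1; exact/cylE.
- move=> y Uy'; split.
    by rewrite (hF2 y Uy').1 scalar_mx_block block_mxKdl.
  move=> t Jt'; rewrite -(ulF y t Uy' Jt') addrC; by have [] := blk y t Uy' Jt'.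
Qed.

End Cylinder.
End FlowRegularity.

(** * The cubic form of a three-form *)

Section PermutationSymbol.
Context {R : realType}.

(* The permutation symbol, as a function of arbitrary index maps. *)
Definition eps n (h : 'I_n -> 'I_n) : R := \det (\matrix_(k, j) (h k == j)%:R).

Lemma eps_noninj n (h : 'I_n -> 'I_n) i j : i != j -> h i = h j -> eps h = 0.
Proof.
by move=> ij hij; apply: (determinant_alternate ij) => k; rewrite !mxE hij.
Qed.

(** Multiplying a Vandermonde matrix at the nodes 0, ..., n-1 by the 0-1 matrix of [h] gives the one
    at the nodes [h j]. The first determinant is positive and [eps h] is 0, 1 or -1, so [eps h] is
    the sign of the second. This replaces a sum over permutations by a product of signs. *)
Lemma eps_sg n (h : 'I_n -> 'I_n) :
  eps h = \prod_(i < n) \prod_(j < n | (i < j)%N) Num.sg ((h j)%:R - (h i)%:R).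
Proof.
pose x : 'rV[R]_n := \row_j (j : nat)%:R.
have V0 : 0 < \det (Vandermonde n x).
  rewrite det_Vandermonde; apply: prodr_gt0 => i _; apply: prodr_gt0 => j ij.
  by rewrite !mxE subr_gt0 ltr_nat.
have E : eps h * \det (Vandermonde n x) = \det (Vandermonde n (\row_j (h j : nat)%:R : 'rV[R]_n)).
  rewrite -[X in _ * X]det_tr -[RHS]det_tr -det_mulmx; congr (\det _).
  apply/matrixP => k l; rewrite !mxE (bigD1 (h k))//= !mxE eqxx mul1r big1 ?addr0// => j jh.
  by rewrite !mxE eq_sym (negbTE jh) mul0r.
have := congr1 Num.sg E; rewrite sgrM (gtr0_sg V0) mulr1 det_Vandermonde => H.
have -> : eps h = Num.sg (eps h).
  have [/injectiveP hi|] := boolP (injectiveb h).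
    have -> : eps h = (-1) ^+ (perm hi).
      rewrite -det_perm; congr (\det _); apply/matrixP => k l.
      by rewrite !mxE permE.
    by case: (odd_perm _); rewrite ?expr1 ?expr0 ?sgrN1 ?sgr1.
  by move=> /injectivePn[i [j ij hij]]; rewrite (eps_noninj ij hij) sgr0.
rewrite H; elim/big_rec2: _ => [|i y1 y2 _ <-]; first by rewrite sgr1.
rewrite sgrM; congr (_ * _); elim/big_rec2: _ => [|j z1 z2 _ <-]; first by rewrite sgr1.
by rewrite sgrM !mxE.
Qed.

Definition sgz2 (a b : nat) : int := if (a < b)%N then 1 else if (b < a)%N then -1 else 0.

Lemma sgz2E (a b : nat) : (sgz2 a b)%:~R = Num.sg (b%:R - a%:R) :> R.
Proof.
rewrite /sgz2; case: ltngtP => [ab|ba|->].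
- by rewrite gtr0_sg// subr_gt0 ltr_nat.
- by rewrite ltr0_sg ?rmorphN1// subr_lt0 ltr_nat.
- by rewrite subrr sgr0.
Qed.

(** Integer version of the product of signs, recursive on the list of values so that it can be
    evaluated. *)
Fixpoint epsz (l : seq nat) : int :=
  if l is a :: l' then foldr (fun b acc => sgz2 a b * acc) 1 l' * epsz l' else 1.

Lemma epszE (l : seq nat) : (epsz l)%:~R =
  \prod_(i < size l) \prod_(j < size l | (i < j)%N)
     Num.sg ((nth 0%N l j)%:R - (nth 0%N l i)%:R) :> R.
Proof.
elim: l => [|a l IH]; first by rewrite big_ord0.
rewrite /= big_ord_recl intrM IH; congr (_ * _).
  rewrite big_mkcond big_ord_recl /= mul1r.
  elim: l {IH} => [|b l IH]; first by rewrite big_ord0.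
  by rewrite /= big_ord_recl intrM IH sgz2E.
apply: eq_bigr => i _; rewrite [RHS]big_mkcond big_ord_recl /= mul1r big_mkcond.
by apply: eq_bigr => j _.
Qed.

Lemma eps_tuple n (t : n.-tuple 'I_n) :
  eps (tnth t) = (epsz [seq val i | i <- t])%:~R.
Proof.
rewrite epszE eps_sg size_map size_tuple; apply: eq_bigr => i _; apply: eq_bigr => j _.
by rewrite !(nth_map i) ?size_tuple// -!tnth_nth.
Qed.

(** Selecting columns of [A] by [h] amounts to multiplication by the 0-1 matrix whose determinant is
    [eps h]; repeated columns make both sides zero. *)
Lemma eps_expand n (h : 'I_n -> 'I_n) (A : 'M[R]_n) :
  \sum_(s : 'S_n) (-1) ^+ s * \prod_k A (s k) (h k) = \det A * eps h.
Proof.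
rewrite -(det_tr A) mulrC /eps -det_mulmx; apply: eq_bigr => s _; congr (_ * _).
apply: eq_bigr => k _; rewrite !mxE (bigD1 (h k))//= !mxE eqxx mul1r big1 ?addr0// => j jh.
by rewrite !mxE eq_sym (negbTE jh) mul0r.
Qed.

(* [T] encodes the index maps. *)
Lemma sum_perm_eps n (T : finType) (code : T -> 'I_n -> 'I_n) (of_perm : 'S_n -> T) (G : T -> R) :
  (forall s k, code (of_perm s) k = s k) -> (forall t (s : 'S_n), code t =1 s -> t = of_perm s) ->
  \sum_(s : 'S_n) (-1) ^+ s * G (of_perm s) = \sum_t eps (code t) * G t.
Proof.
move=> h1 h2.
under [RHS]eq_bigr => t _ do rewrite big_distrl /=.
rewrite exchange_big /=; apply: eq_bigr => s _.
rewrite (bigD1 (of_perm s))//= [X in _ + X]big1 ?addr0.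
  by congr (_ * _); rewrite big1 ?mulr1// => k _; rewrite mxE h1 eqxx.
move=> t ts; have [k hk] : exists k, code t k != s k.
  apply/existsP; rewrite -[X in is_true X]negbK negb_exists; apply/negP => /forallP H.
  by move: ts; rewrite (h2 t s) ?eqxx// => k; have := H k; rewrite negbK => /eqP.
by rewrite (bigD1 k)//= mxE (negbTE hk) mul0r mulr0 mul0r.
Qed.

End PermutationSymbol.

(** * The wedge product of two two-forms and a three-form *)

Section CubicForm.
Context {R : realType}.
Notation I := 'I_7.
Notation form3 := (@form3 R).

(** Seven indices grouped as the arguments of two two-forms and a three-form, so that products of
    iterated sums become one sum over [H7]. *)
Definition H7 : finType := ((I * I) * (I * I) * (I * I * I))%type.
Definition tup7 (h : H7) : 7.-tuple I :=
  [tuple h.1.1.1; h.1.1.2; h.1.2.1; h.1.2.2; h.2.1.1; h.2.1.2; h.2.2].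
Definition o7 k (hk : (k < 7)%N) : I := Ordinal hk.
Definition of7 (s : 'S_7) : H7 :=
  ((s (o7 (isT : 0 < 7)%N), s (o7 (isT : 1 < 7)%N)), (s (o7 (isT : 2 < 7)%N), s (o7 (isT : 3 < 7)%N)),
   (s (o7 (isT : 4 < 7)%N), s (o7 (isT : 5 < 7)%N), s (o7 (isT : 6 < 7)%N))).

Lemma forall_I7 (P : I -> Prop) : P (o7 (isT : 0 < 7)%N) -> P (o7 (isT : 1 < 7)%N) ->
  P (o7 (isT : 2 < 7)%N) -> P (o7 (isT : 3 < 7)%N) -> P (o7 (isT : 4 < 7)%N) ->
  P (o7 (isT : 5 < 7)%N) -> P (o7 (isT : 6 < 7)%N) -> forall k, P k.
Proof.
by move=> P0 P1 P2 P3 P4 P5 P6 [[|[|[|[|[|[|[|//]]]]]]] hk];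
  rewrite (bool_irrelevance hk isT).
Qed.

Lemma tup7_of7 s k : tnth (tup7 (of7 s)) k = s k.
Proof. by move: k; apply: forall_I7. Qed.

Lemma tup7_inj t (s : 'S_7) : tnth (tup7 t) =1 s -> t = of7 s.
Proof.
case: t => [[[a b] [c d]] [[e f] g]] H.
by rewrite /of7 -!H.
Qed.

Definition pull2 (A : 'M[R]_7) (w : I -> I -> R) : I -> I -> R := fun b c =>
  \sum_p \sum_q A b p * A c q * w p q.

(** Not normalised: on alternating arguments it is 2! 2! 3! times the component of the wedge product
    on the standard basis. *)
Definition wedge7 (u v : I -> I -> R) (w : form3) : R := \sum_(s : 'S_7)
  (-1) ^+ s * (u (of7 s).1.1.1 (of7 s).1.1.2 * v (of7 s).1.2.1 (of7 s).1.2.2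
     * w (of7 s).2.1.1 (of7 s).2.1.2 (of7 s).2.2).

Lemma wedge7_eps u v w : wedge7 u v w = \sum_(h : H7) eps (tnth (tup7 h)) *
  (u h.1.1.1 h.1.1.2 * v h.1.2.1 h.1.2.2 * w h.2.1.1 h.2.1.2 h.2.2).
Proof.
rewrite -(@sum_perm_eps R 7 H7 (fun h => tnth (tup7 h)) of7
  (fun h => u h.1.1.1 h.1.1.2 * v h.1.2.1 h.1.2.2 * w h.2.1.1 h.2.1.2 h.2.2))//.
  exact: tup7_of7.
exact: tup7_inj.
Qed.

(** By multilinearity both sides are sums over [h : H7]; for fixed [h] the sum over permutations is
    the determinant of the columns of [A] selected by [h]. *)
Lemma wedge7_pull A u v w :
  wedge7 (pull2 A u) (pull2 A v) (pull3 A w) = \det A * wedge7 u v w.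
Proof.
rewrite [in RHS]wedge7_eps big_distrr /=.
have reorder (x1 x2 x3 y1 y2 y3 z1 z2 z3 z4 : R) :
    x1 * x2 * x3 * (y1 * y2 * y3) * (z1 * z2 * z3 * z4) =
    x1 * (x2 * (y1 * (y2 * (z1 * (z2 * z3))))) * (x3 * y3 * z4) by ring.
have E s : pull2 A u (of7 s).1.1.1 (of7 s).1.1.2 * pull2 A v (of7 s).1.2.1 (of7 s).1.2.2
     * pull3 A w (of7 s).2.1.1 (of7 s).2.1.2 (of7 s).2.2 =
  \sum_(h : H7) (\prod_k A (s k) (tnth (tup7 h) k)) *
   (u h.1.1.1 h.1.1.2 * v h.1.2.1 h.1.2.2 * w h.2.1.1 h.2.1.2 h.2.2).
  rewrite /pull2 /pull3 !pair_bigA /= big_distrlr /= pair_bigA /=.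
  rewrite big_distrlr /= pair_bigA /=.
  apply: eq_bigr => -[[[a b] [c d]] [[e f] g]] _ /=.
  rewrite !big_ord_recl big_ord0 /= mulr1.
  rewrite !(tnth_nth a) /=; rewrite /of7 /=.
  have e0 : ord0 = o7 (isT : 0 < 7)%N by exact: val_inj.
  have e1 : lift ord0 ord0 = o7 (isT : 1 < 7)%N by exact: val_inj.
  have e2 : lift ord0 (lift ord0 ord0) = o7 (isT : 2 < 7)%N by exact: val_inj.
  have e3 : lift ord0 (lift ord0 (lift ord0 ord0)) = o7 (isT : 3 < 7)%N by exact: val_inj.
  have e4 : lift ord0 (lift ord0 (lift ord0 (lift ord0 ord0))) = o7 (isT : 4 < 7)%N by exact: val_inj.
  have e5 : lift ord0 (lift ord0 (lift ord0 (lift ord0 (lift ord0 ord0)))) = o7 (isT : 5 < 7)%N by exact: val_inj.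
  have e6 : lift ord0 (lift ord0 (lift ord0 (lift ord0 (lift ord0 (lift ord0 ord0))))) = o7 (isT : 6 < 7)%N by exact: val_inj.
  by rewrite e6 e5 e4 e3 e2 e1 e0 reorder.
transitivity (\sum_(s : 'S_7) \sum_(h : H7) ((-1) ^+ s * \prod_k A (s k) (tnth (tup7 h) k)) *
   (u h.1.1.1 h.1.1.2 * v h.1.2.1 h.1.2.2 * w h.2.1.1 h.2.1.2 h.2.2)).
  rewrite /wedge7; apply: eq_bigr => s _; rewrite E big_distrr /=.
  by apply: eq_bigr => h _; exact: mulrA.
rewrite exchange_big /=; apply: eq_bigr => h _.
by rewrite -big_distrl /= eps_expand; symmetry; exact: mulrA.
Qed.

(* [cubic w] is the symmetric bilinear form (u, v) |-> i_u w /\ i_v w /\ w with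
   values in the top forms; it recovers the metric of a positive form up to scale. *)
Definition cubic (w : form3) : 'M[R]_7 := \matrix_(u, v) wedge7 (w u) (w v) w.

Lemma wedge7_suml (c : I -> R) (a : I -> I -> I -> R) v w :
  wedge7 (fun b d => \sum_p c p * a p b d) v w = \sum_p c p * wedge7 (a p) v w.
Proof.
rewrite /wedge7; under [RHS]eq_bigr => p _ do rewrite big_distrr /=.
rewrite exchange_big /=; apply: eq_bigr => s _.
rewrite !big_distrl /= big_distrr /=; apply: eq_bigr => p _.
by rewrite -!mulrA mulrCA.
Qed.

Lemma wedge7_sumr (c : I -> R) (a : I -> I -> I -> R) u w :
  wedge7 u (fun b d => \sum_p c p * a p b d) w = \sum_p c p * wedge7 u (a p) w.
Proof.
rewrite /wedge7; under [RHS]eq_bigr => p _ do rewrite big_distrr /=.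
rewrite exchange_big /=; apply: eq_bigr => s _.
rewrite big_distrr big_distrl /= big_distrr /=; apply: eq_bigr => p _.
by rewrite -!mulrA (mulrCA _ (c p)) (mulrCA _ (c p)).
Qed.

Lemma pull3_pull2 A (w : form3) u :
  pull3 A w u = fun b d => \sum_p A u p * pull2 A (w p) b d.
Proof.
apply/funext => b; apply/funext => d; rewrite /pull3; apply: eq_bigr => p _.
rewrite /pull2 big_distrr /=; apply: eq_bigr => q _; rewrite big_distrr /=.
by apply: eq_bigr => r _; rewrite !mulrA.
Qed.

Lemma congr_mxE (A C : 'M[R]_7) u v :
  (A *m C *m A^T) u v = \sum_p \sum_q A u p * A v q * C p q.
Proof.
rewrite mxE exchange_big /=; apply: eq_bigr => q _.
rewrite [in LHS]mxE big_distrl /=; apply: eq_bigr => p _; rewrite [A^T _ _]mxE; ring.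
Qed.

Lemma cubic_pull A w : cubic (pull3 A w) = \det A *: (A *m cubic w *m A^T).
Proof.
apply/matrixP => u v; rewrite mxE (pull3_pull2 A w u) wedge7_suml.
under eq_bigr => p _ do rewrite (pull3_pull2 A w v) wedge7_sumr.
rewrite mxE congr_mxE big_distrr /=; apply: eq_bigr => p _; rewrite !big_distrr /=.
apply: eq_bigr => q _; rewrite wedge7_pull [cubic _ _ _]mxE.
set x := wedge7 _ _ _; ring.
Qed.

End CubicForm.

(** * The metric of a positive three-form *)

Section Phi0.
Context {R : realType}.
Notation I := 'I_7.
Notation form3 := (@form3 R).

(** The real part of [e_a] times an octonion is minus its coefficient at [e_a], and the coefficient
    of the product of [e_b] and [e_c] at [e_a] is [fano b c a]. *)
Lemma phi0E a b c : phi0 a b c = - fano b c a :> R.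
Proof.
have h1 : gamma c *m psi0 = col_mx 0 (delta_mx c 0) :> 'cV[R]_(1 + 7).
  by rewrite /gamma /psi0 mul_block_col !mul0mx !mulmx0 mulmx1 !addr0.
have h2 : gamma b *m (gamma c *m psi0) = col_mx (- (delta_mx 0 b *m delta_mx c 0))
    ((\matrix_(d, e) fano b e d) *m delta_mx c 0) :> 'cV[R]_(1 + 7).
  by rewrite h1 /gamma mul_block_col !mulmx0 !add0r mulNmx.
rewrite /phi0 -!mulmxA h2 /gamma mul_block_col !mul0mx add0r /psi0 tr_col_mx.
rewrite mul_row_col trmx1 mul1mx trmx0 mul0mx addr0 mulNmx mxE; congr (- _).
rewrite mxE (bigD1 a)//= [delta_mx 0 a 0 a]mxE !eqxx mul1r big1 ?addr0.
  rewrite mxE (bigD1 c)//= [delta_mx c 0 c 0]mxE !eqxx mulr1 big1 ?addr0 ?mxE//.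
  by move=> e ec; rewrite [delta_mx c 0 e 0]mxE (negbTE ec) mulr0.
by move=> e ea; rewrite [delta_mx 0 a 0 e]mxE (negbTE ea) andbF mul0r.
Qed.

(** From here to [cubicz], integer-valued copies on natural numbers: unlike expressions over an
    abstract [R], they can be evaluated by [vm_compute]. *)
Definition line7 (a b c : nat) : bool := (b == (a + 1) %% 7)%N && (c == (a + 3) %% 7)%N.
Definition fanoz (a b c : nat) : int :=
  if [|| line7 a b c, line7 b c a | line7 c a b] then 1
  else if [|| line7 b a c, line7 a c b | line7 c b a] then -1 else 0.

Lemma line7E (a b c : I) : fano_line a b c = line7 a b c.
Proof. by []. Qed.

Lemma fanozE (a b c : I) : fano a b c = (fanoz a b c)%:~R :> R.
Proof.
rewrite /fano /fanoz !line7E; by case: ifP => _ //; case: ifP => _ //; rewrite rmorphN1.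
Qed.

Definition phiz (z : nat * nat * nat) : int := - fanoz z.1.2 z.2 z.1.1.

Lemma phizE (a b c : I) : phi0 a b c = (phiz (val a, val b, val c))%:~R :> R.
Proof. by rewrite phi0E fanozE /phiz rmorphN. Qed.

Definition L1 : seq nat := iota 0 7.
Definition L2 : seq (nat * nat) := [seq (a, b) | a <- L1, b <- L1].
Definition L3 : seq (nat * nat * nat) := [seq (x, c) | x <- L2, c <- L1].

Lemma sumL1 (F : nat -> int) : \sum_(a : I) F a = \sum_(a <- L1) F a.
Proof. by rewrite -(big_mkord xpredT F). Qed.

Lemma sumL2 (F : nat * nat -> int) :
  \sum_(x : I * I) F (val x.1, val x.2) = \sum_(x <- L2) F x.
Proof.
rewrite /L2 big_allpairs -(sumL1 (fun a => \sum_(b <- L1) F (a, b))).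
rewrite -(pair_bigA _ (fun a b : I => F (val a, val b))) /=; apply: eq_bigr => a _.
exact: (sumL1 (fun b => F (val a, b))).
Qed.

Lemma sumL3 (F : nat * nat * nat -> int) :
  \sum_(z : I * I * I) F (val z.1.1, val z.1.2, val z.2) = \sum_(z <- L3) F z.
Proof.
rewrite /L3 big_allpairs -(sumL2 (fun x => \sum_(c <- L1) F (x, c))).
rewrite -(pair_bigA _ (fun (x : I * I) (c : I) => F (val x.1, val x.2, val c))) /=.
by apply: eq_bigr => x _; exact: (sumL1 (fun c => F (val x.1, val x.2, c))).
Qed.

Lemma sum_support (T : eqType) (L : seq T) (f G : T -> int) :
  \sum_(x <- L) f x * G x = \sum_(x <- [seq x <- L | f x != 0]) f x * G x.
Proof.
rewrite big_filter [RHS]big_mkcond /=; apply: eq_bigr => x _.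
by case: eqP => // ->; rewrite mul0r.
Qed.

Definition supp2 (u : nat) := [seq x <- L2 | phiz (u, x.1, x.2) != 0].
Definition supp3 := [seq z <- L3 | phiz z != 0].

Definition sumz (T : Type) (L : seq T) (f : T -> int) : int :=
  foldr (fun x acc => f x + acc) 0 L.

Lemma sumzE (T : Type) (L : seq T) (f : T -> int) : sumz L f = \sum_(x <- L) f x.
Proof. by elim: L => [|x L IH]; rewrite ?big_nil ?big_cons//= IH. Qed.

(** The sums run over supports only. Each [supp2] has 6 elements and [supp3] has 42, which leaves
    1512 terms per entry instead of 7^7. *)
Definition cubicz (u v : nat) : int :=
  let L := supp3 in let M := supp2 v in
  sumz (supp2 u) (fun x => phiz (u, x.1, x.2) * sumz M (fun y => phiz (v, y.1, y.2) *
   sumz L (fun z => phiz z * epsz [:: x.1; x.2; y.1; y.2; z.1.1; z.1.2; z.2]))).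

Lemma cubic_phi0z (u v : I) : cubic phi0 u v = (cubicz u v)%:~R :> R.
Proof.
have -> : cubicz u v = \sum_(x <- supp2 u) phiz (val u, x.1, x.2) *
    \sum_(y <- supp2 v) phiz (val v, y.1, y.2) *
   \sum_(z <- supp3) phiz z * epsz [:: x.1; x.2; y.1; y.2; z.1.1; z.1.2; z.2].
  rewrite /cubicz sumzE; apply: eq_bigr => x _; congr (_ * _); rewrite sumzE.
  by apply: eq_bigr => y _; congr (_ * _); rewrite sumzE.
rewrite /supp2 /supp3 -(sum_support _ (fun x => phiz (val u, x.1, x.2))
  (fun x => \sum_(y <- [seq y <- L2 | phiz (val v, y.1, y.2) != 0]) phiz (val v, y.1, y.2) *
   \sum_(z <- [seq z <- L3 | phiz z != 0])
     phiz z * epsz [:: x.1; x.2; y.1; y.2; z.1.1; z.1.2; z.2])).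
under eq_bigr => x _ do rewrite -(sum_support _ (fun y => phiz (val v, y.1, y.2))
  (fun y => \sum_(z <- [seq z <- L3 | phiz z != 0])
     phiz z * epsz [:: x.1; x.2; y.1; y.2; z.1.1; z.1.2; z.2])).
under eq_bigr => x _ do under eq_bigr => y _ do rewrite -(sum_support _ phiz
  (fun z => epsz [:: x.1; x.2; y.1; y.2; z.1.1; z.1.2; z.2])).
rewrite -sumL2.
under eq_bigr => x _ do rewrite -sumL2.
under eq_bigr => x _ do under eq_bigr => y _ do rewrite -sumL3.
rewrite mxE wedge7_eps rmorph_sum /=.
transitivity (\sum_(x : I * I) \sum_(y : I * I) \sum_(z : I * I * I)
  (phi0 u x.1 x.2 * phi0 v y.1 y.2 * phi0 z.1.1 z.1.2 z.2 * eps (tnth (tup7 ((x, y), z))) : R)).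
  rewrite pair_bigA pair_bigA /=; apply: eq_bigr => -[[x y] z] _ /=.
  by rewrite mulrC.
apply: eq_bigr => x _; rewrite rmorphM /= -phizE rmorph_sum big_distrr /=.
apply: eq_bigr => y _; rewrite rmorphM /= -phizE rmorph_sum mulrA big_distrr /=.
apply: eq_bigr => z _; rewrite rmorphM /= -phizE mulrA; congr (_ * _).
by rewrite eps_tuple.
Qed.

(** This is the identity i_u phi /\ i_v phi /\ phi = 6 <u, v> vol; the unnormalised wedge product
    multiplies 6 by 2! 2! 3! = 24. *)
Lemma cubicz_table :
  all (fun u => all (fun v => cubicz u v == if u == v then Posz 144 else Posz 0) L1) L1.
Proof. by vm_compute. Qed.

Lemma cubic_phi0 : cubic phi0 = 144%:M :> 'M[R]_7.
Proof.
apply/matrixP => u v; rewrite cubic_phi0z !mxE.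
have mem (k : I) : (k : nat) \in L1 by rewrite mem_iota ltn_ord.
move/allP : cubicz_table => /(_ u (mem u)) /allP /(_ v (mem v)) /eqP ->.
case: (eqVneq u v) => [->|/negbTE uv]; first by rewrite eqxx -pmulrn mulr1n.
by rewrite [u == v :> nat]uv -pmulrn !mulr0n.
Qed.

Lemma phi0_alternating : alternating3 (phi0 : form3).
Proof.
have H : all (fun a => all (fun b => all (fun c => (phiz (b, a, c) == - phiz (a, b, c)) &&
    (phiz (a, c, b) == - phiz (a, b, c))) L1) L1) L1 by vm_compute.
have mem (k : I) : (k : nat) \in L1 by rewrite mem_iota ltn_ord.
split=> a b c; move/allP : H => /(_ a (mem a)) /allP /(_ b (mem b)) /allP /(_ c (mem c))
  /andP[/eqP h1 /eqP h2].
- by rewrite (phizE b a c) h1 rmorphN /= -phizE.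
- by rewrite (phizE a c b) h2 rmorphN /= -phizE.
Qed.

Lemma pull3_alternating A (w : form3) : alternating3 w -> alternating3 (pull3 A w).
Proof.
move=> [h1 h2]; split=> a b c; rewrite /pull3.
  rewrite exchange_big /= -sumrN; apply: eq_bigr => p _; rewrite -sumrN.
  apply: eq_bigr => q _; rewrite -sumrN; apply: eq_bigr => r _; rewrite h1; ring.
rewrite -sumrN; apply: eq_bigr => p _.
rewrite exchange_big /= -sumrN; apply: eq_bigr => q _; rewrite -sumrN.
by apply: eq_bigr => r _; rewrite h2; ring.
Qed.

Lemma positive3_alternating (w : form3) : positive3 w -> alternating3 w.
Proof. by move=> [A _ ->]; apply: pull3_alternating; exact: phi0_alternating. Qed.

Lemma cubic_metric (A : 'M[R]_7) :
  cubic (pull3 A phi0) = (144 * \det A) *: (A *m A^T).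
Proof.
rewrite cubic_pull cubic_phi0 mul_mx_scalar -scalemxAl scalerA.
by rewrite mulrC.
Qed.

(* If [w = pull3 A phi0] then [\det (cubic w) / 144 ^+ 7 = \det A ^+ 9], and the
   exponential is [\det A ^+ 2]; this form is valid for both signs of [\det A]. *)
Definition metric_formula (w : form3) : 'M[R]_7 :=
  let D := \det (cubic w) / 144 ^+ 7 in
  ((144 * D)^-1 * expR (ln (D ^+ 2) / 9) ^+ 4) *: cubic w.

Lemma det_cubic (A : 'M[R]_7) :
  \det (cubic (pull3 A phi0)) / 144 ^+ 7 = \det A ^+ 9.
Proof.
rewrite cubic_metric detZ det_mulmx det_tr exprMn mulrAC (mulrAC (144 ^+ 7)).
rewrite divff ?mul1r; last by rewrite expf_neq0.
by rewrite -expr2 -exprD.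
Qed.

Lemma is_metric_ofE (w : form3) G : is_metric_of w G -> G = metric_formula w.
Proof.
move=> [A [uA -> ->]]; rewrite /metric_formula det_cubic cubic_metric.
have d0 : \det A != 0 by rewrite -unitfE -unitmxE.
have d2 : 0 < \det A ^+ 2 by rewrite exprn_even_gt0.
have -> : expR (ln ((\det A ^+ 9) ^+ 2) / 9) = \det A ^+ 2.
  by rewrite exprAC (lnXn 9 d2) -[_ *+ 9]mulr_natr mulfK ?lnK// pnatr_eq0.
(* With [d = \det A] the scalar is [(144 * d ^+ 9)^-1 * d ^+ 8 * (144 * d)], which explains the
   fourth power in the formula. *)
rewrite scalerA -[LHS]scale1r; congr (_ *: _).
by field.
Qed.

(** [metric_formula] depends on the form alone, so the choice made by [xget] is forced. *)
Lemma metric_ofE (w : form3) G : is_metric_of w G -> metric_of w = G.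
Proof.
move=> h; apply: xget_unique => // G' /is_metric_ofE ->.
by rewrite (is_metric_ofE h).
Qed.

Lemma positive3_metric (w : form3) : positive3 w -> is_metric_of w (metric_of w).
Proof.
move=> [A uA wA]; have h : is_metric_of w (A *m A^T) by exists A.
by rewrite (metric_ofE h).
Qed.

End Phi0.

(** * The action of endomorphisms on three-forms *)

Section FormAction.
Context {R : realType}.
Notation I := 'I_7.
Notation form3 := (@form3 R).
Implicit Types (A B K : 'M[R]_7) (w : form3) (J : set R) (t : R).

(** An endomorphism acting on one argument. [pull3] is the composite of the three slots, and slots
    at different positions commute, so products and derivatives of pullbacks are handled without
    expanding triple sums. *)
Definition slot1 A w : form3 := fun a b c => \sum_p A a p * w p b c.
Definition slot2 A w : form3 := fun a b c => \sum_p A b p * w a p c.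
Definition slot3 A w : form3 := fun a b c => \sum_p A c p * w a b p.

Lemma form3P w w' : (forall a b c, w a b c = w' a b c) -> w = w'.
Proof. by move=> h; do 3 apply/funext => ?. Qed.

Lemma pull3E A w : pull3 A w = slot1 A (slot2 A (slot3 A w)).
Proof.
apply: form3P => a b c; rewrite /pull3 /slot1 /slot2 /slot3.
apply: eq_bigr => p _; rewrite big_distrr /=; apply: eq_bigr => q _.
by rewrite !big_distrr /=; apply: eq_bigr => r _; rewrite !mulrA.
Qed.

Lemma slot1M A B w : slot1 (A *m B) w = slot1 A (slot1 B w).
Proof.
apply: form3P => a b c; rewrite /slot1.
under eq_bigr => p _ do rewrite mxE big_distrl /=.
rewrite exchange_big /=; apply: eq_bigr => q _; rewrite big_distrr /=.
by apply: eq_bigr => p _; rewrite mulrA.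
Qed.

Lemma slot2M A B w : slot2 (A *m B) w = slot2 A (slot2 B w).
Proof.
apply: form3P => a b c; rewrite /slot2.
under eq_bigr => p _ do rewrite mxE big_distrl /=.
rewrite exchange_big /=; apply: eq_bigr => q _; rewrite big_distrr /=.
by apply: eq_bigr => p _; rewrite mulrA.
Qed.

Lemma slot3M A B w : slot3 (A *m B) w = slot3 A (slot3 B w).
Proof.
apply: form3P => a b c; rewrite /slot3.
under eq_bigr => p _ do rewrite mxE big_distrl /=.
rewrite exchange_big /=; apply: eq_bigr => q _; rewrite big_distrr /=.
by apply: eq_bigr => p _; rewrite mulrA.
Qed.

Lemma slot12C A B w : slot1 A (slot2 B w) = slot2 B (slot1 A w).
Proof.
apply: form3P => a b c; rewrite /slot1 /slot2.
under eq_bigr => p _ do rewrite big_distrr /=.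
under [RHS]eq_bigr => p _ do rewrite big_distrr /=.
by rewrite exchange_big /=; apply: eq_bigr => q _; apply: eq_bigr => p _; rewrite mulrCA.
Qed.

Lemma slot13C A B w : slot1 A (slot3 B w) = slot3 B (slot1 A w).
Proof.
apply: form3P => a b c; rewrite /slot1 /slot3.
under eq_bigr => p _ do rewrite big_distrr /=.
under [RHS]eq_bigr => p _ do rewrite big_distrr /=.
by rewrite exchange_big /=; apply: eq_bigr => q _; apply: eq_bigr => p _; rewrite mulrCA.
Qed.

Lemma slot23C A B w : slot2 A (slot3 B w) = slot3 B (slot2 A w).
Proof.
apply: form3P => a b c; rewrite /slot2 /slot3.
under eq_bigr => p _ do rewrite big_distrr /=.
under [RHS]eq_bigr => p _ do rewrite big_distrr /=.
by rewrite exchange_big /=; apply: eq_bigr => q _; apply: eq_bigr => p _; rewrite mulrCA.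
Qed.

Lemma pull3M A B w : pull3 (A *m B) w = pull3 A (pull3 B w).
Proof.
by rewrite !pull3E slot1M slot2M slot3M -(slot13C B A) -(slot12C B A) -(slot23C B A).
Qed.

Lemma pull3_1 w : pull3 1%:M w = w.
Proof.
apply: form3P => a b c; rewrite pull3E /slot1 /slot2 /slot3.
rewrite (bigD1 a)//= mxE eqxx mul1r [X in _ + X]big1 ?addr0; last first.
  by move=> p pa; rewrite mxE eq_sym (negbTE pa) mul0r.
rewrite (bigD1 b)//= mxE eqxx mul1r [X in _ + X]big1 ?addr0; last first.
  by move=> p pa; rewrite mxE eq_sym (negbTE pa) mul0r.
rewrite (bigD1 c)//= mxE eqxx mul1r [X in _ + X]big1 ?addr0// => p pa.
by rewrite mxE eq_sym (negbTE pa) mul0r.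
Qed.

Lemma pull3K A w : A \in unitmx -> pull3 (invmx A) (pull3 A w) = w.
Proof. by move=> uA; rewrite -pull3M mulVmx// pull3_1. Qed.

Lemma is_metric_of_pull w G F : F \in unitmx ->
  is_metric_of w G -> is_metric_of (pull3 F w) (F *m G *m F^T).
Proof.
move=> uF [A [uA -> ->]]; exists (F *m A); split.
- by rewrite unitmx_mul uF.
- by rewrite pull3M.
- by rewrite trmx_mul !mulmxA.
Qed.

Lemma positive3_pull w F : F \in unitmx -> positive3 w -> positive3 (pull3 F w).
Proof.
by move=> uF [A uA ->]; exists (F *m A); [rewrite unitmx_mul uF|rewrite pull3M].
Qed.

Definition tderiv J (w : R -> form3) t (w' : form3) : Prop :=
  forall a b c, has_deriv_within J (fun s => w s a b c) t (w' a b c).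

Definition fadd (w w' : form3) : form3 := fun a b c => w a b c + w' a b c.

(* The derivation action of gl(7) on three-forms. *)
Definition lie3 K w : form3 := fun a b c =>
  slot1 K w a b c + slot2 K w a b c + slot3 K w a b c.

Lemma tderiv_slot1 J (A : R -> 'M[R]_7) (w : R -> form3) t A' w' :
  mderiv J A t A' -> tderiv J w t w' ->
  tderiv J (fun s => slot1 (A s) (w s)) t (fadd (slot1 A' (w t)) (slot1 (A t) w')).
Proof.
move=> hA hw a b c; rewrite /fadd -big_split /=.
by apply: hd_sum => p; apply: hdM; [exact: hA|exact: hw].
Qed.

Lemma tderiv_slot2 J (A : R -> 'M[R]_7) (w : R -> form3) t A' w' :
  mderiv J A t A' -> tderiv J w t w' ->
  tderiv J (fun s => slot2 (A s) (w s)) t (fadd (slot2 A' (w t)) (slot2 (A t) w')).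
Proof.
move=> hA hw a b c; rewrite /fadd -big_split /=.
by apply: hd_sum => p; apply: hdM; [exact: hA|exact: hw].
Qed.

Lemma tderiv_slot3 J (A : R -> 'M[R]_7) (w : R -> form3) t A' w' :
  mderiv J A t A' -> tderiv J w t w' ->
  tderiv J (fun s => slot3 (A s) (w s)) t (fadd (slot3 A' (w t)) (slot3 (A t) w')).
Proof.
move=> hA hw a b c; rewrite /fadd -big_split /=.
by apply: hd_sum => p; apply: hdM; [exact: hA|exact: hw].
Qed.

Lemma slot1D A w w' : slot1 A (fadd w w') = fadd (slot1 A w) (slot1 A w').
Proof.
by apply: form3P => a b c; rewrite /slot1 /fadd -big_split; apply: eq_bigr => p _; rewrite mulrDr.
Qed.

Lemma slot2D A w w' : slot2 A (fadd w w') = fadd (slot2 A w) (slot2 A w').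
Proof.
by apply: form3P => a b c; rewrite /slot2 /fadd -big_split; apply: eq_bigr => p _; rewrite mulrDr.
Qed.

Lemma slot3D A w w' : slot3 A (fadd w w') = fadd (slot3 A w) (slot3 A w').
Proof.
by apply: form3P => a b c; rewrite /slot3 /fadd -big_split; apply: eq_bigr => p _; rewrite mulrDr.
Qed.

Lemma lie3E K w : lie3 K w = fadd (fadd (slot1 K w) (slot2 K w)) (slot3 K w).
Proof. by []. Qed.

Lemma pull3D A w w' : pull3 A (fadd w w') = fadd (pull3 A w) (pull3 A w').
Proof. by rewrite !pull3E slot3D slot2D slot1D. Qed.

Lemma slot1N A w a b c : slot1 (- A) w a b c = - slot1 A w a b c.
Proof. by rewrite /slot1 -sumrN; apply: eq_bigr => p _; rewrite mxE mulNr. Qed.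
Lemma slot2N A w a b c : slot2 (- A) w a b c = - slot2 A w a b c.
Proof. by rewrite /slot2 -sumrN; apply: eq_bigr => p _; rewrite mxE mulNr. Qed.
Lemma slot3N A w a b c : slot3 (- A) w a b c = - slot3 A w a b c.
Proof. by rewrite /slot3 -sumrN; apply: eq_bigr => p _; rewrite mxE mulNr. Qed.

Lemma slot1_opp A w a b c : slot1 A (fun a b c => - w a b c) a b c = - slot1 A w a b c.
Proof. by rewrite /slot1 -sumrN; apply: eq_bigr => p _; rewrite mulrN. Qed.
Lemma slot2_opp A w a b c : slot2 A (fun a b c => - w a b c) a b c = - slot2 A w a b c.
Proof. by rewrite /slot2 -sumrN; apply: eq_bigr => p _; rewrite mulrN. Qed.

Lemma pull3_0 A : pull3 A (fun _ _ _ => 0) = fun _ _ _ => 0.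
Proof.
by apply: form3P => a b c; rewrite /pull3; do 3 (apply: big1 => ? _); rewrite mulr0.
Qed.

Lemma pull3_deriv J (A : R -> 'M[R]_7) (w : R -> form3) t A' w' :
  mderiv J A t A' -> tderiv J w t w' ->
  tderiv J (fun s => pull3 (A s) (w s)) t
    (fadd (slot1 A' (slot2 (A t) (slot3 (A t) (w t))))
      (fadd (slot1 (A t) (slot2 A' (slot3 (A t) (w t))))
        (fadd (slot1 (A t) (slot2 (A t) (slot3 A' (w t)))) (pull3 (A t) w')))).
Proof.
move=> hA hw.
have := tderiv_slot1 hA (tderiv_slot2 hA (tderiv_slot3 hA hw)).
rewrite slot2D !slot1D -pull3E => h a b c.
have := h a b c; congr has_deriv_within.
by apply/funext => s; rewrite pull3E.
Qed.

(** In the product rule one slot carries [K *m F t]; its factor [K] commutes past the other slots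
    and acts on the pullback. *)
Lemma pull3_flow_deriv J (F : R -> 'M[R]_7) K w t :
  mderiv J F t (K *m F t) -> tderiv J (fun s => pull3 (F s) w) t (lie3 K (pull3 (F t) w)).
Proof.
move=> hF.
have hw : tderiv J (fun=> w) t (fun _ _ _ => 0) by move=> a b c; exact: hd_cst.
have h := pull3_deriv hF hw.
move=> a b c; have := h a b c.
congr (has_deriv_within _ _ _ _).
rewrite slot1M slot2M slot3M (slot23C _ K) (slot13C _ K) (slot12C _ K) -!pull3E.
by rewrite pull3_0 /fadd /lie3 addr0 addrA.
Qed.

(** Each slot contributes [F *m K] once with a minus sign, from the derivative of [F], and once with
    a plus sign, from that of the form. *)
Lemma pull3_coflow_deriv J (F : R -> 'M[R]_7) (w : R -> form3) K t :
  mderiv J F t (- (F t *m K)) -> tderiv J w t (lie3 K (w t)) ->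
  tderiv J (fun s => pull3 (F s) (w s)) t (fun _ _ _ => 0).
Proof.
move=> hF hw; have h := pull3_deriv hF hw.
move=> a b c; have := h a b c.
congr (has_deriv_within _ _ _ _).
rewrite lie3E !pull3D.
have e1 : slot1 (F t) (slot2 (F t) (slot3 (F t) (slot1 K (w t)))) =
   slot1 (F t) (slot1 K (slot2 (F t) (slot3 (F t) (w t)))).
  by rewrite -slot13C -slot12C.
have e2 : slot2 (F t) (slot3 (F t) (slot2 K (w t))) =
   slot2 (F t) (slot2 K (slot3 (F t) (w t))).
  by rewrite -slot23C.
rewrite !pull3E e1 e2 -slot1M -slot2M -slot3M /fadd.
rewrite slot1N.
have -> : slot1 (F t) (slot2 (- (F t *m K)) (slot3 (F t) (w t))) a b c =
  - slot1 (F t) (slot2 (F t *m K) (slot3 (F t) (w t))) a b c.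
  have -> : slot2 (- (F t *m K)) (slot3 (F t) (w t)) =
      fun a b c => - slot2 (F t *m K) (slot3 (F t) (w t)) a b c.
    by apply: form3P => ? ? ?; exact: slot2N.
  exact: slot1_opp.
have -> : slot1 (F t) (slot2 (F t) (slot3 (- (F t *m K)) (w t))) a b c =
  - slot1 (F t) (slot2 (F t) (slot3 (F t *m K) (w t))) a b c.
  have -> : slot3 (- (F t *m K)) (w t) = fun a b c => - slot3 (F t *m K) (w t) a b c.
    by apply: form3P => ? ? ?; exact: slot3N.
  have -> : slot2 (F t) (fun a b c => - slot3 (F t *m K) (w t) a b c) =
      fun a b c => - slot2 (F t) (slot3 (F t *m K) (w t)) a b c.
    by apply: form3P => ? ? ?; exact: slot2_opp.
  exact: slot1_opp.
ring.
Qed.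

(** Pulling back by the inverse flow makes the form constant. [K] may depend on [w]: only the linear
    flow of the resulting path of endomorphisms is used. *)
Lemma lie3_flow J (K F G : R -> 'M[R]_7) (w : R -> form3) :
  is_interval J -> J 0 -> is_flow J K F G ->
  (forall t, J t -> tderiv J w t (lie3 (K t) (w t))) ->
  forall t, J t -> w t = pull3 (F t) (w 0).
Proof.
move=> iJ J0 fl hw t Jt; have [_ G0 _ hG] := fl.
have [_ FG] := flow_inv iJ J0 fl Jt.
have H : pull3 (G t) (w t) = w 0.
  rewrite -[RHS]pull3_1 -G0; apply: form3P => a b c.
  apply: (@hd0_cst R J (fun s => pull3 (G s) (w s) a b c) 0 t iJ J0 Jt) => s Js.
  by have h := pull3_coflow_deriv (hG s Js) (hw s Js); have := h a b c.
by rewrite -H -pull3M FG pull3_1.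
Qed.

(** The three indices are variables with prescribed values, so that the formula applies to whatever
    terms denote 0, 1 and 2 in ['I_3]. *)
Lemma sum_S3 (T : 'I_3 -> 'I_3 -> 'I_3 -> R) (i0 i1 i2 : 'I_3) :
  i0 = 0 :> nat -> i1 = 1%N :> nat -> i2 = 2%N :> nat ->
  \sum_(s : 'S_3) (-1) ^+ s * T (s i0) (s i1) (s i2) =
  T i0 i1 i2 - T i0 i2 i1 - T i1 i0 i2 + T i1 i2 i0 + T i2 i0 i1 - T i2 i1 i0.
Proof.
move=> h0 h1 h2.
pose code (z : 'I_3 * 'I_3 * 'I_3) : 'I_3 -> 'I_3 := tnth [tuple z.1.1; z.1.2; z.2].
pose ofp (s : 'S_3) := (s i0, s i1, s i2).
have e0 : i0 = ord0 by exact: val_inj.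
have e1 : i1 = lift ord0 ord0 by exact: val_inj.
have e2 : i2 = lift ord0 (lift ord0 ord0) by exact: val_inj.
rewrite (@sum_perm_eps R 3 _ code ofp (fun z => T z.1.1 z.1.2 z.2)).
- under eq_bigr => z _ do rewrite eps_tuple.
  rewrite -(pair_bigA _ (fun (x : 'I_3 * 'I_3) c => (epsz [seq val i | i <- [tuple x.1; x.2; c]])%:~R * T x.1 x.2 c)) /=.
  rewrite -(pair_bigA _ (fun (a b : 'I_3) => \sum_c ((epsz [:: val a; val b; val c])%:~R * T a b c))) /=.
  rewrite !big_ord_recl !big_ord0 -e2 -e1 -e0.
  rewrite h0 h1 h2 /sgz2 !ltnn /=.
  rewrite !(mulr1, mul1r, mulr0, mul0r, mulN1r, opprK, rmorphN, rmorph0, rmorph1) /=.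
  ring.
- move=> s k; rewrite /code /ofp (tnth_nth i0) /=.
  by case: k => [[|[|[|//]]] hk] /=; congr (s _); apply: val_inj.
- move=> [[a b] c] s H; rewrite /ofp -!H /code !(tnth_nth i0) /= h0 h1 h2.
  by [].
Qed.

(** By skew-symmetry of [w] the six permutations contribute equally in pairs, and the three cyclic
    ones are the three slots. Hence [i_form] is 2/3! = 1/3 of the derivation action, and the factor
    3/2 leaves 1/2. *)
Lemma i_formE w h a b c : alternating3 w ->
  3 / 2 * i_form w h a b c = lie3 (2^-1 *: (h *m invmx (metric_of w))) w a b c.
Proof.
move=> [w12 w23]; set K := h *m _.
have TE x y z : \sum_i \sum_j h x i * (invmx (metric_of w)) i j * w j y z = slot1 K w x y z.
  rewrite exchange_big /=; apply: eq_bigr => j _.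
  by rewrite mxE big_distrl.
have T23 x y z : slot1 K w x z y = - slot1 K w x y z.
  by rewrite /slot1 -sumrN; apply: eq_bigr => p _; rewrite w23 mulrN.
have T2 : slot1 K w b c a = slot2 K w a b c.
  by apply: eq_bigr => p _; rewrite w23 w12 opprK.
have T3 : slot1 K w c a b = slot3 K w a b c.
  by apply: eq_bigr => p _; rewrite w12 w23 opprK.
rewrite /i_form /skew3 /=.
under eq_bigr => s _ do rewrite TE.
rewrite (@sum_S3 (fun i j k => slot1 K w (tnth [tuple a; b; c] i) (tnth [tuple a; b; c] j)
  (tnth [tuple a; b; c] k)))// !(tnth_nth a) /=.
rewrite (T23 a b c) (T23 b c a) (T23 c a b) T2 T3.
have Z1 : slot1 (2^-1 *: K) w a b c = 2^-1 * slot1 K w a b c.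
  by rewrite /slot1 [RHS]mulr_sumr; apply: eq_bigr => p _; rewrite [(_ *: K) _ _]mxE mulrA.
have Z2 : slot2 (2^-1 *: K) w a b c = 2^-1 * slot2 K w a b c.
  by rewrite /slot2 [RHS]mulr_sumr; apply: eq_bigr => p _; rewrite [(_ *: K) _ _]mxE mulrA.
have Z3 : slot3 (2^-1 *: K) w a b c = 2^-1 * slot3 K w a b c.
  by rewrite /slot3 [RHS]mulr_sumr; apply: eq_bigr => p _; rewrite [(_ *: K) _ _]mxE mulrA.
rewrite /lie3 Z1 Z2 Z3 (_ : (3`!)%:R = 6 :> R)//.
by set x := slot1 _ _ _ _ _; set y := slot2 _ _ _ _ _; set z := slot3 _ _ _ _ _; field.
Qed.

Lemma cvg_prodr (T I : Type) (F : set_system T) {FF : Filter F} (r : seq I)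
    (f : I -> T -> R) (l : I -> R) : (forall i, f i @ F --> l i) ->
  (fun x => \prod_(i <- r) f i x) @ F --> \prod_(i <- r) l i.
Proof.
move=> hf; elim: r => [|i r IH].
  rewrite big_nil (_ : (fun _ => _) = fun=> 1); first exact: cvg_cst.
  by apply/funext => s; rewrite big_nil.
rewrite big_cons (_ : (fun _ => _) = fun s => f i s * \prod_(j <- r) f j s).
  exact: cvgM.
by apply/funext => s; rewrite big_cons.
Qed.

Lemma cvg_det (T : Type) (F : set_system T) {FF : Filter F} n
    (A : T -> 'M[R]_n) (L : 'M[R]_n) : (forall i j, (fun x => A x i j) @ F --> L i j) ->
  (fun x => \det (A x)) @ F --> \det L.
Proof.
move=> hA; apply: cvg_sumr => s; apply: cvgM; first exact: cvg_cst.
by apply: cvg_prodr => i.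
Qed.

Lemma cvg_cubic (T : Type) (F : set_system T) {FF : Filter F} (w : T -> form3) (l : form3) :
  (forall a b c, (fun x => w x a b c) @ F --> l a b c) ->
  forall u v, (fun x => cubic (w x) u v) @ F --> cubic l u v.
Proof.
move=> hw u v; rewrite (_ : (fun x => _) = fun x => wedge7 (w x u) (w x v) (w x)); last first.
  by apply/funext => x; rewrite mxE.
rewrite mxE; apply: cvg_sumr => s; apply: cvgM; first exact: cvg_cst.
by apply: cvgM => //; exact: cvgM.
Qed.

(** On positive forms [metric_of] is [metric_formula], in which the inverse is taken of a nonzero
    number and the logarithm of its positive square. *)
Lemma metric_of_cont J (w : R -> form3) : (forall t, J t -> positive3 (w t)) ->
  (forall a b c, {within J, continuous (fun t => w t a b c)}) ->
  mcont J (fun t => metric_of (w t)).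
Proof.
move=> pw cw i j.
have E t : J t -> metric_of (w t) = metric_formula (w t).
  by move=> /pw /positive3_metric /is_metric_ofE.
apply: (@subspace_eq_continuous _ _ _ (fun t => metric_formula (w t) i j)).
  by move=> t; rewrite inE => Jt; rewrite /from_subspace E.
apply/subspace_continuousP => t Jt; rewrite /from_subspace.
have cD : (fun s => \det (cubic (w s)) / 144 ^+ 7) @ within J (nbhs t) -->
    \det (cubic (w t)) / 144 ^+ 7.
  apply: cvgM; last exact: cvg_cst.
  apply: cvg_det => k l; apply: cvg_cubic => a b c.
  by have /subspace_continuousP := cw a b c; exact.
have cB : (fun s => cubic (w s) i j) @ within J (nbhs t) --> cubic (w t) i j.
  apply: cvg_cubic => a b c.
  by have /subspace_continuousP := cw a b c; exact.
have D0 : \det (cubic (w t)) / 144 ^+ 7 != 0.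
  have [A uA ->] := pw t Jt; rewrite det_cubic expf_neq0// -unitfE -unitmxE//.
rewrite (_ : (fun s => metric_formula (w s) i j) = fun s =>
  (144 * (\det (cubic (w s)) / 144 ^+ 7))^-1 *
     expR (ln ((\det (cubic (w s)) / 144 ^+ 7) ^+ 2) / 9) ^+ 4 * cubic (w s) i j); last first.
  by apply/funext => s; rewrite /metric_formula mxE.
rewrite /metric_formula mxE; apply: cvgM => //; apply: cvgM.
  apply: cvgV; first by rewrite mulf_neq0// pnatr_eq0.
  by apply: cvgM => //; exact: cvg_cst.
set D := (fun s => \det (cubic (w s)) / 144 ^+ 7) in cD *.
have cE : (fun s => expR (ln (D s ^+ 2) / 9)) @ within J (nbhs t) --> expR (ln (D t ^+ 2) / 9).
  apply: (@cvg_comp _ _ _ (fun s => ln (D s ^+ 2) / 9) expR); last exact: continuous_expR.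
  apply: cvgM; last exact: cvg_cst.
  apply: (@cvg_comp _ _ _ (fun s => D s ^+ 2) (@ln R)); last first.
    by apply: continuous_ln; rewrite exprn_even_gt0.
  rewrite expr2 (_ : (fun s => D s ^+ 2) = fun s => D s * D s); first exact: cvgM.
  by apply/funext => s; rewrite expr2.
rewrite !exprS expr0 !mulr1 (_ : (fun s => _) = fun s => expR (ln (D s ^+ 2) / 9) *
  (expR (ln (D s ^+ 2) / 9) * (expR (ln (D s ^+ 2) / 9) * expR (ln (D s ^+ 2) / 9)))).
  by apply: cvgM => //; apply: cvgM => //; exact: cvgM.
by apply/funext => s; rewrite !exprS expr0 !mulr1.
Qed.

End FormAction.

(** * Flats *)

Section MatrixExponential.
Context {R : realType}.
Implicit Types (A B E : 'M[R]_7).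

Lemma cvg_mx m n (u : nat -> 'M[R]_(m, n)) (L : 'M[R]_(m, n)) :
  u @ \oo --> L <-> forall i j, (fun k => u k i j) @ \oo --> L i j.
Proof.
split=> [h i j|h].
  apply/cvgrPdist_lt => e e0; apply: (h [set M | `|L i j - M i j| < e]).
  by apply/nbhs_mx; exists e => // M hM; exact: hM.
move=> U /nbhs_mx[e e0 hU].
have key ij : \forall k \near \oo, `|L ij.1 ij.2 - u k ij.1 ij.2| < e.
  by have /cvgrPdist_lt /(_ e e0) := h ij.1 ij.2.
have H : \forall k \near \oo, forall ij : 'I_m * 'I_n, `|L ij.1 ij.2 - u k ij.1 ij.2| < e.
  exact: (filter_forall _ key).
suff : \forall k \near \oo, U (u k) by [].
by near=> k; apply: hU => i j; have /(_ (i, j)) // : forall ij : 'I_m * 'I_n,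
  `|L ij.1 ij.2 - u k ij.1 ij.2| < e by near: k.
Unshelve. all: by end_near. Qed.

(** [expmx] is a [lim], so convergence has to be known before it means anything. The entries of
    [A ^+ k] are at most [(7 * c) ^+ k], and the scalar exponential series dominates. *)
Lemma expmx_cvg A : series (fun k => (k`!)%:R^-1 *: A ^+ k) @ \oo --> expmx A.
Proof.
pose c := \sum_i \sum_j `|A i j|.
have hc i j : `|A i j| <= c.
  rewrite /c (bigD1 i)//= (bigD1 j)//= -addrA -[leLHS]addr0 lerD//.
  by rewrite addr_ge0 ?sumr_ge0// => k _; rewrite sumr_ge0.
have c0 : 0 <= c by apply: le_trans (hc 0 0).
have hk k : forall i j, `|(A ^+ k) i j| <= (7 * c) ^+ k.
  elim: k => [|k IH] i j.
    by rewrite !expr0 mxE; case: (i == j); rewrite ?normr1 ?normr0.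
  by rewrite !exprS -mulrA; exact: mulmx_entry_le.
have hij i j : cvgn (series (fun k => (k`!)%:R^-1 * (A ^+ k) i j)).
  apply: normed_cvg; apply: (series_le_cvg _ _ _ (is_cvg_series_exp_coeff (7 * c))).
  - by move=> k /=.
  - by move=> k; rewrite /exp_coeff /= divr_ge0// exprn_ge0// mulr_ge0.
  - move=> k; rewrite /exp_coeff /= normrM ger0_norm ?invr_ge0// mulrC.
    by rewrite ler_wpM2r ?invr_ge0.
suff h : cvgn (series (fun k => (k`!)%:R^-1 *: A ^+ k)) by exact: h.
apply: (cvgP (\matrix_(i, j) limn (series (fun k => (k`!)%:R^-1 * (A ^+ k) i j)))).
apply/cvg_mx => i j; rewrite mxE.
rewrite (_ : (fun k => _) = series (fun k => (k`!)%:R^-1 * (A ^+ k) i j)); first exact: hij.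
by apply/funext => k; rewrite /series /= summxE; apply: eq_bigr => l _; rewrite mxE.
Qed.

Lemma cvg_mulmx m n p (u : nat -> 'M[R]_(m, n)) (L : 'M[R]_(m, n)) (B : 'M[R]_(n, p)) :
  u @ \oo --> L -> (fun k => u k *m B) @ \oo --> L *m B.
Proof.
move=> /cvg_mx h; apply/cvg_mx => i j; rewrite mxE.
rewrite (_ : (fun k => _) = fun k => \sum_l u k i l * B l j); last first.
  by apply/funext => k; rewrite mxE.
by apply: cvg_sumr => l; apply: cvgM => //; exact: cvg_cst.
Qed.

Lemma cvg_trmx m n (u : nat -> 'M[R]_(m, n)) (L : 'M[R]_(m, n)) :
  u @ \oo --> L -> (fun k => (u k)^T) @ \oo --> L^T.
Proof.
move=> /cvg_mx h; apply/cvg_mx => i j; rewrite mxE.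
by rewrite (_ : (fun k => _) = fun k => u k j i)//; apply/funext => k; rewrite mxE.
Qed.

Lemma cvg_mulmxl m n p (u : nat -> 'M[R]_(n, p)) (L : 'M[R]_(n, p)) (B : 'M[R]_(m, n)) :
  u @ \oo --> L -> (fun k => B *m u k) @ \oo --> B *m L.
Proof.
move=> /cvg_trmx /(cvg_mulmx (B := B^T)) /cvg_trmx; rewrite trmx_mul !trmxK.
by rewrite (_ : (fun k => _) = fun k => B *m u k)//; apply/funext => k; rewrite trmx_mul !trmxK.
Qed.

Lemma mx_cvg_unique m n (u : nat -> 'M[R]_(m, n)) (L L' : 'M[R]_(m, n)) :
  u @ \oo --> L -> u @ \oo --> L' -> L = L'.
Proof.
move=> /cvg_mx h /cvg_mx h'; apply/matrixP => i j.
exact: (cvg_unique (@Rhausdorff R) (h i j) (h' i j)).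
Qed.

Lemma expmx_comm A B : A *m B = B *m A -> expmx A *m B = B *m expmx A.
Proof.
move=> AB; have h := cvg_mulmx (B := B) (@expmx_cvg A).
apply: (mx_cvg_unique h).
have := cvg_mulmxl (B := B) (@expmx_cvg A).
rewrite (_ : (fun k => B *m _) = fun k => series (fun k => (k`!)%:R^-1 *: A ^+ k) k *m B)//.
apply/funext => k; rewrite /series /= mulmx_sumr mulmx_suml; apply: eq_bigr => l _.
rewrite -scalemxAl -scalemxAr; congr (_ *: _).
elim: l => [|l IH]; first by rewrite expr0 mulmx1 mul1mx.
by rewrite exprS -mulmxE mulmxA -AB -!mulmxA IH.
Qed.

Lemma expmx_self_adjoint G A : self_adjoint G A -> self_adjoint G (expmx A).
Proof.
move=> AG; rewrite /self_adjoint.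
have h := cvg_mulmx (B := G) (@expmx_cvg A).
apply: (mx_cvg_unique h).
have := cvg_mulmxl (B := G) (cvg_trmx (@expmx_cvg A)).
rewrite (_ : (fun k => G *m _) = fun k => series (fun k => (k`!)%:R^-1 *: A ^+ k) k *m G)//.
apply/funext => k; rewrite /series /= linear_sum /= mulmx_sumr mulmx_suml.
apply: eq_bigr => l _; rewrite linearZ /= -scalemxAl -scalemxAr; congr (_ *: _).
elim: l => [|l IH]; first by rewrite expr0 trmx1 mulmx1 mul1mx.
by rewrite [in LHS]exprSr [in RHS]exprS -!mulmxE trmx_mul mulmxA -AG -mulmxA IH mulmxA.
Qed.

Lemma posdef_unit (G : 'M[R]_7) : posdef G -> G \in unitmx.
Proof.
move=> [_ pG]; rewrite unitmxE unitfE; apply/negP => /det0P[v v0 vG].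
by have := pG v v0; rewrite vG mul0mx mxE ltxx.
Qed.

(** [G] cancels: [q E] is [E *m E] times the inverse of [E0 *m E0]. *)
Lemma square_ratio_commute n (G E0 E1 E2 : 'M[R]_n) : E0 *m E0 *m G \in unitmx ->
  E0 *m E1 = E1 *m E0 -> E0 *m E2 = E2 *m E0 -> E1 *m E2 = E2 *m E1 ->
  let q (E : 'M[R]_n) := (E *m E *m G) *m invmx (E0 *m E0 *m G) in q E1 *m q E2 = q E2 *m q E1.
Proof.
move=> u0 h1 h2 c12 q.
have uE0 : E0 \in unitmx by move: u0; rewrite !unitmx_mul => /andP[/andP[]].
have qE (E : 'M[R]_n) : q E = E *m E *m (invmx E0 *m invmx E0).
  rewrite /q; apply: (can_inj (mulmxK u0)); rewrite mulmxKV// !mulmxA mulmxKV//.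
  by rewrite -[E *m E *m invmx E0 *m E0]mulmxA mulVmx// mulmx1.
rewrite !qE.
have cV (E : 'M[R]_n) : E0 *m E = E *m E0 -> invmx E0 *m E = E *m invmx E0.
  move=> h; apply: (can_inj (mulmxK uE0)); rewrite mulmxKV// -mulmxA -h mulmxA.
  by rewrite mulVmx// mul1mx.
have c1' (X : 'M[R]_n) : invmx E0 *m (E1 *m X) = E1 *m (invmx E0 *m X) by rewrite mulmxA cV// mulmxA.
have c2' (X : 'M[R]_n) : invmx E0 *m (E2 *m X) = E2 *m (invmx E0 *m X) by rewrite mulmxA cV// mulmxA.
have c12' (X : 'M[R]_n) : E1 *m (E2 *m X) = E2 *m (E1 *m X) by rewrite mulmxA c12 mulmxA.
by rewrite -!mulmxA !c1' !c2' !c12'.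
Qed.

(** Since [expmx A] is self-adjoint with respect to the base point [G], the points of the flat are
    [expmx A *m expmx A *m G], with commuting exponentials. Therefore any point [g0] of the flat can
    serve as the new base point. *)
Lemma flat_commute (F : set 'M[R]_7) (g0 g1 g2 : 'M[R]_7) : flat_subspace F ->
  F g0 -> F g1 -> F g2 -> g0 \in unitmx ->
  (g1 *m invmx g0) *m (g2 *m invmx g0) = (g2 *m invmx g0) *m (g1 *m invmx g0).
Proof.
move=> [G [a [_ sa ca FE]]].
have sE g : F g -> exists E, g = E *m E *m G /\ exists2 A, A \in a & E = expmx A.
  rewrite FE => -[A hA <-]; exists (expmx A); split; last by exists A.
  by have := expmx_self_adjoint (sa A hA); rewrite /self_adjoint -mulmxA => <-; rewrite mulmxA.
have cE A B : A \in a -> B \in a -> expmx A *m expmx B = expmx B *m expmx A.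
  by move=> hA hB; apply: expmx_comm; apply/esym/expmx_comm; exact: ca.
move=> /sE[E0 [-> [A0 h0 e0]]] /sE[E1 [-> [A1 h1 e1]]] /sE[E2 [-> [A2 h2 e2]]] u0.
by apply: square_ratio_commute => //; rewrite ?e0 ?e1 ?e2; exact: cE.
Qed.

End MatrixExponential.

(** * Uniqueness of positive square roots *)

Section PositiveRoot.
Context {R : realType}.

Lemma mxtrace_sqr n (M : 'M[R]_n) : \tr (M *m M^T) = \sum_i \sum_j M i j ^+ 2.
Proof. by apply: eq_bigr => i _; rewrite mxE; apply: eq_bigr => j _; rewrite mxE expr2. Qed.

Lemma mxtrace_sqr_ge0 n (M : 'M[R]_n) : 0 <= \tr (M *m M^T).
Proof. by rewrite mxtrace_sqr !sumr_ge0// => i _; rewrite sumr_ge0// => j _; rewrite sqr_ge0. Qed.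

Lemma mxtrace_sqr_eq0 n (M : 'M[R]_n) : \tr (M *m M^T) = 0 -> M = 0.
Proof.
rewrite mxtrace_sqr => /eqP; rewrite psumr_eq0; last first.
  by move=> i _; rewrite sumr_ge0// => j _; rewrite sqr_ge0.
move=> /allP H; apply/matrixP => i j; rewrite mxE.
have := H i (mem_index_enum i); rewrite psumr_eq0; last by move=> k _; rewrite sqr_ge0.
by move=> /allP /(_ j (mem_index_enum j)); rewrite /= sqrf_eq0 => /eqP.
Qed.

(* With [D = p - q] and [N = p + q], [p ^+ 2 = q ^+ 2] says that [D] and [N]
   anticommute, so that [\tr (D N D) = 0], while [N] is positive definite. *)
Lemma positive_root_unique n (s x : 'M[R]_n) : s^T = s -> x^T = x ->
  s \in unitmx -> (s *m s) *m (s *m s) = (x *m x) *m (x *m x) -> s *m s = x *m x.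
Proof.
move=> ss xx us H; set p := s *m s in H *; set q := x *m x in H *.
have pT : p^T = p by rewrite /p trmx_mul ss.
have qT : q^T = q by rewrite /q trmx_mul xx.
set D := p - q; have DT : D^T = D by rewrite /D linearB /= pT qT.
have anti : D *m (p + q) = - ((p + q) *m D).
  rewrite /D mulmxBl !mulmxDr !mulmxDl !mulmxN -H; set u := p *m p; set v := p *m q; set w := q *m p.
  by apply/matrixP => i j; rewrite !mxE; ring.
have tr0 : \tr (D *m (p + q) *m D) = 0.
  have : \tr (D *m (p + q) *m D) = - \tr (D *m (p + q) *m D).
    by rewrite {1}anti mulNmx linearN /= -mulmxA mxtrace_mulC mulmxA mxtrace_mulC mulmxA.
  by move=> /eqP; rewrite -addr_eq0 -mulr2n mulrn_eq0 => /eqP.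
(* [p] and [q] are squares of symmetric matrices, so this is a sum of two Gram matrices. Their
   traces are nonnegative, both vanish, and [D *m s = 0] with [s] invertible. *)
have e : D *m (p + q) *m D = (D *m s) *m (D *m s)^T + (D *m x) *m (D *m x)^T.
  by rewrite !trmx_mul ss xx DT mulmxDr mulmxDl /p /q !mulmxA.
move: tr0; rewrite e linearD /= => /eqP; rewrite paddr_eq0 ?mxtrace_sqr_ge0// => /andP[/eqP h _].
have Ds := mxtrace_sqr_eq0 h.
have : D = 0 by rewrite -(mulmxK us D) Ds mul0mx.
by move=> /eqP; rewrite subr_eq0 => /eqP.
Qed.

(** With [G = B *m B^T], conjugation by [B] turns self-adjointness for [G] into symmetry. Positivity
    of the roots is encoded by their being squares of self-adjoint endomorphisms. *)
Lemma self_adjoint_root_unique (G B T X : 'M[R]_7) : G = B *m B^T -> B \in unitmx ->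
  self_adjoint G T -> self_adjoint G X -> T \in unitmx ->
  (T *m T) *m (T *m T) = (X *m X) *m (X *m X) -> T *m T = X *m X.
Proof.
move=> -> uB hT hX uT H.
have conj Y : self_adjoint (B *m B^T) Y -> (invmx B *m Y *m B)^T = invmx B *m Y *m B.
  move=> h; have uBT : B^T \in unitmx by rewrite unitmx_tr.
  apply: (can_inj (mulKmx uB)); apply: (can_inj (mulmxK uBT)).
  rewrite !trmx_mul trmx_inv -!mulmxA mulVmx// mulmx1 mulKVmx//.
  by rewrite [Y *m _]h !mulmxA.
have P Y Z : (invmx B *m Y *m B) *m (invmx B *m Z *m B) = invmx B *m (Y *m Z) *m B.
  by rewrite !mulmxA mulmxK.
have uT' : invmx B *m T *m B \in unitmx by rewrite !unitmx_mul unitmx_inv uB uT.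
have := positive_root_unique (conj _ hT) (conj _ hX) uT'.
rewrite !P H => /(_ erefl) /(congr1 (fun M => B *m M *m invmx B)).
by rewrite !mulmxA mulmxV// !mul1mx !mulmxK.
Qed.

End PositiveRoot.

(** * Flows generated by commuting endomorphisms *)

Lemma scaled_square_deriv (R : comPzRingType) n (c : R) (L T : 'M[R]_n) : T *m L = L *m T ->
  (c *: L *m T) *m T + T *m (c *: L *m T) = (c + c) *: L *m (T *m T).
Proof.
move=> TL.
have -> : c *: L *m T *m T = c *: (L *m (T *m T)) by rewrite -!scalemxAl mulmxA.
have -> : T *m (c *: L *m T) = c *: (L *m (T *m T)) by rewrite -scalemxAl -scalemxAr !mulmxA TL.
by rewrite -scalerDl scalemxAl.
Qed.

Lemma inverse_commute (R : pzRingType) n (U T L : 'M[R]_n) :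
  U *m T = 1%:M -> T *m U = 1%:M -> T *m L = L *m T -> U *m L = L *m U.
Proof.
by move=> UT TU TL; rewrite -[U *m L]mulmx1 -TU mulmxA -(mulmxA U) -TL mulmxA UT mul1mx.
Qed.

Section CommutingFlow.
Context {R : realType}.
Variables (t1 : R) (g gd : R -> 'M[R]_7).
Hypothesis t10 : 0 < t1.
Let I : set R := `[0, t1]%classic.
Let L t := gd t *m invmx (g t).
Let S t := g t *m invmx (g 0).
Hypothesis g_deriv : forall t, I t -> mderiv I g t (gd t).
Hypothesis g_unit : forall t, I t -> g t \in unitmx.
Hypothesis g_sym : forall t, I t -> (g t)^T = g t.
Hypothesis contL : mcont I L.
Hypothesis S_comm : forall s t, I s -> I t -> S s *m S t = S t *m S s.

Let iI : is_interval I. Proof. exact: is_interval_segment. Qed.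
Let I0 : I 0. Proof. by rewrite /I /= in_itv /= lexx ltW. Qed.
Let nI : exists2 u, I u & u != 0.
Proof. by exists t1; rewrite ?gt_eqF// /I /= in_itv /= lexx ltW. Qed.
Let PI t : I t -> ProperFilter (within I t^').
Proof. exact: itv_within_proper0. Qed.

Let S_deriv t : I t -> mderiv I S t (L t *m S t).
Proof.
move=> It; have := mderivM (g_deriv It) (@mderiv_cst R I 7 7 (invmx (g 0)) t).
by rewrite mulmx0 addr0 /L /S !mulmxA mulmxKV ?g_unit.
Qed.

(** Differentiate the commutation of [M] with [S], use [S' = L *m S], commute [M] past [S t] and
    cancel [S t]. *)
Let comm_deriv (M : 'M[R]_7) : (forall s, I s -> M *m S s = S s *m M) ->
  forall t, I t -> M *m L t = L t *m M.
Proof.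
move=> H t It.
have uS : S t \in unitmx by rewrite unitmx_mul g_unit//= unitmx_inv g_unit.
have h1 := mderivM (@mderiv_cst R I 7 7 M t) (S_deriv It).
have h2 := mderivM (S_deriv It) (@mderiv_cst R I 7 7 M t).
rewrite mul0mx add0r in h1; rewrite mulmx0 addr0 in h2.
have h1' : mderiv I (fun s => S s *m M) t (M *m (L t *m S t)).
  by apply: (mderiv_eq It _ h1) => s Is; exact: H.
have E := mderiv_unique (PI It) h1' h2.
apply: (can_inj (mulmxK uS)).
by rewrite -mulmxA E -[LHS]mulmxA -[RHS]mulmxA (H t It).
Qed.

(** [S s *m F] solves the same linear equation as [F], because [L] commutes with [S s]; so
    [S s *m F t = F t *m S s], and [comm_deriv] passes from [S] to [L]. *)
Lemma commuting_flow (c : R) (F G : R -> 'M[R]_7) : is_flow I (fun t => c *: L t) F G ->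
  forall t s, I t -> I s -> F t *m L s = L s *m F t.
Proof.
move=> fl t s It Is; apply: comm_deriv => // {s Is} s Is.
have [F0 _ _ _] := fl.
have := @flow_unique R I 7 7 _ _ _ (fun u => S s *m F u) iI I0 fl _ t It.
rewrite F0 mulmx1 => -> // u Iu; have [_ _ hF _] := fl.
have := mderivM (@mderiv_cst R I 7 7 (S s) u) (hF u Iu).
rewrite mul0mx add0r mulmxA -scalemxAr (comm_deriv _ Iu) ?scalemxAl ?mulmxA//.
by move=> v Iv; exact: S_comm.
Qed.

(** [F], [T] and [E] are the flows of 1/2, 1/4 and 1 times [L]. Everything commutes, so [T *m T],
    [F *m F] and [S] satisfy the equations of [F], [E] and [E]. The quarter flow is introduced to
    show that [F] is a positive root. *)
Lemma commuting_flow_root : exists F G T,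
  [/\ is_flow I (fun t => 2^-1 *: L t) F G,
    forall t, I t -> F t = T t *m T t /\ T t \in unitmx,
    forall t, I t -> self_adjoint (g 0) (T t)
  & forall t, I t -> F t *m F t = S t].
Proof.
have [F [G fl]] := flow_exists iI I0 nI (@mcontZ R I 7 7 2^-1 L contL).
have [T [U flT]] := flow_exists iI I0 nI (@mcontZ R I 7 7 4^-1 L contL).
have [E [E' flE]] := flow_exists iI I0 nI contL.
have [F0 _ hF _] := fl; have [T0 U0 hT hU] := flT.
have cF := commuting_flow fl; have cT := commuting_flow flT.
have TU t : I t -> U t *m T t = 1%:M /\ T t *m U t = 1%:M by move=> It; exact: (flow_inv iI I0 flT It).
have uT t : I t -> T t \in unitmx by move=> /TU[_ /mulmx1_unit[]].
exists F, G, T; split=> //.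
- move=> t It; split; last exact: uT.
  have := @flow_unique R I 7 7 _ _ _ (fun u => T u *m T u) iI I0 fl _ t It.
  rewrite T0 mulmx1 mulmx1 => -> // s Is.
  have := mderivM (hT s Is) (hT s Is); congr mderiv.
  rewrite (scaled_square_deriv _ (cT s s Is Is)); congr (_ *: _ *m _); by field.
- move=> t It; have u0 := g_unit I0.
  have gd_sym s : I s -> (gd s)^T = gd s.
    move=> Is; apply: (mderiv_unique (PI Is)); last exact: g_deriv.
    by apply: (mderiv_eq Is _ (mderivT (g_deriv Is))) => u Iu; exact: g_sym.
  (* [L s] is self-adjoint for [g 0], not only for [g s]: this uses that it commutes with [S s]. *)
  have LT s : I s -> g 0 *m (L s)^T *m invmx (g 0) = L s.
    move=> Is; rewrite /L trmx_mul trmx_inv g_sym// gd_sym//.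
    have uS : S s \in unitmx by rewrite unitmx_mul g_unit//= unitmx_inv.
    have e : L s *m S s = S s *m L s.
      by rewrite (comm_deriv _ Is)// => v Iv; exact: S_comm.
    apply: (can_inj (mulKmx uS)); rewrite -e /S /L !mulmxA mulmxKV// mulmxKV ?g_unit//.
    by rewrite mulmxV ?g_unit// mul1mx.
  (* The [g 0]-adjoint of [T]. It satisfies the transposed equation, with [L] on the right, so
     [X *m U] is constant and [X = T]. *)
  pose X s := g 0 *m (T s)^T *m invmx (g 0).
  have hX s : I s -> mderiv I X s (X s *m (4^-1 *: L s)).
    move=> Is; have := mderivM (mderivM (@mderiv_cst R I 7 7 (g 0) s) (mderivT (hT s Is)))
      (@mderiv_cst R I 7 7 (invmx (g 0)) s).
    congr mderiv; rewrite mul0mx add0r mulmx0 addr0 /X -{2}(LT s Is).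
    rewrite trmx_mul linearZ /= -!scalemxAr -!scalemxAl; congr (_ *: _).
    by rewrite !mulmxA mulmxKV.
  have hXU s : I s -> X s *m U s = X 0 *m U 0.
    move=> Is; apply: (@mderiv0_cst R I 7 7 (fun s => X s *m U s) 0 s) => // r Ir.
    have := mderivM (hX r Ir) (hU r Ir).
    have -> : U r *m (4^-1 *: L r) = (4^-1 *: L r) *m U r.
      rewrite -scalemxAl -scalemxAr; congr (_ *: _).
      exact: (inverse_commute (TU r Ir).1 (TU r Ir).2 (cT r r Ir Ir)).
    by rewrite mulmxN mulmxA addrN.
  have X0 : X 0 = 1%:M by rewrite /X T0 trmx1 mulmx1 mulmxV.
  have XT : X t = T t.
    have := hXU t It; rewrite X0 U0 mulmx1 => h.
    by rewrite -[LHS]mulmx1 -(TU t It).1 mulmxA h mul1mx.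
  by rewrite /self_adjoint -[in LHS]XT /X mulmxKV.
- move=> t It.
  have := @flow_unique R I 7 7 _ _ _ (fun u => F u *m F u) iI I0 flE _ t It.
  rewrite F0 mulmx1 mulmx1 => -> //; last first.
    move=> s Is; have := mderivM (hF s Is) (hF s Is); congr mderiv.
    rewrite (scaled_square_deriv _ (cF s s Is Is)) (_ : 2^-1 + 2^-1 = 1) ?scale1r//; by field.
  have := @flow_unique R I 7 7 _ _ _ S iI I0 flE _ t It.
  have -> : S 0 = 1%:M by rewrite /S mulmxV ?g_unit.
  by rewrite mulmx1 => -> //; exact: S_deriv.
Qed.

End CommutingFlow.

(** * The evolution equation along a path of metrics *)

Section MetricPaths.
Context {R : realType}.
Implicit Types (J : set R) (g gd : R -> 'M[R]_7).

Lemma mcont_invmx J n (F : R -> 'M[R]_n) : (forall t, J t -> F t \in unitmx) ->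
  mcont J F -> mcont J (fun t => invmx (F t)).
Proof.
move=> uF cF i j.
pose f t := (\det (F t))^-1 * cofactor (F t) j i.
apply: (@subspace_eq_continuous _ _ _ f).
  by move=> t; rewrite inE /f /from_subspace => Jt; rewrite /invmx uF// !mxE.
apply/subspace_continuousP => t Jt.
have c k l : (fun s => F s k l) @ within J (nbhs t) --> F t k l.
  by have /subspace_continuousP := cF k l; exact.
rewrite /from_subspace /f; apply: cvgM.
  apply: cvgV; first by have := uF t Jt; rewrite unitmxE unitfE.
  exact: cvg_det.
apply: cvgM; first exact: cvg_cst.
apply: cvg_det => k l; rewrite (_ : (fun x => _) = fun s => F s (lift j k) (lift i l)).
  by rewrite !mxE.
by apply/funext => s; rewrite !mxE.
Qed.

(** [G *m H *m G^T] has zero derivative. *)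
Lemma flow_congr J (K F G H : R -> 'M[R]_7) : is_interval J -> J 0 -> is_flow J K F G ->
  (forall t, J t -> mderiv J H t (K t *m H t + H t *m (K t)^T)) ->
  forall t, J t -> H t = F t *m H 0 *m (F t)^T.
Proof.
move=> iJ J0 fl hH t Jt; have [F0 G0 hF hG] := fl.
have [_ FG] := flow_inv iJ J0 fl Jt.
have E : G t *m H t *m (G t)^T = H 0.
  have := @mderiv0_cst R J 7 7 (fun t => G t *m H t *m (G t)^T) 0 t iJ J0 Jt.
  rewrite G0 mul1mx trmx1 mulmx1; apply=> s Js.
  have := mderivM (mderivM (hG s Js) (hH s Js)) (mderivT (hG s Js)).
  congr mderiv; rewrite mulNmx mulmxDr !mulmxA addKr.
  by rewrite linearN /= trmx_mul mulmxN !mulmxA addrN.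
have GF : (G t)^T *m (F t)^T = 1%:M by rewrite -trmx_mul FG trmx1.
by rewrite -E -!mulmxA GF mulmx1 !mulmxA FG mul1mx.
Qed.

Definition metric_path J g gd : Prop := [/\ forall t, J t -> posdef (g t),
  forall t, J t -> mderiv J g t (gd t) & mcont J gd].

Definition frame_gen g gd (t : R) : 'M[R]_7 := 2^-1 *: (gd t *m invmx (g t)).

Section Path.
Variables (J : set R) (g gd : R -> 'M[R]_7).
Hypothesis J_itv : is_interval J.
Hypothesis J0 : J 0.
Hypothesis nJ : exists2 t, J t & t != 0.
Hypothesis path : metric_path J g gd.

Let PJ t : J t -> ProperFilter (within J t^').
Proof. exact: itv_within_proper0. Qed.

Lemma metric_path_dot_sym t : J t -> (gd t)^T = gd t.
Proof.
move=> Jt; have [pg hg _] := path; apply: (mderiv_unique (PJ Jt)); last exact: hg.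
by apply: (mderiv_eq Jt _ (mderivT (hg t Jt))) => s Js; have [] := pg s Js.
Qed.

Lemma metric_path_unit t : J t -> g t \in unitmx.
Proof. by move=> Jt; have [pg _ _] := path; exact/posdef_unit/pg. Qed.

Lemma frame_gen_cont : mcont J (frame_gen g gd).
Proof.
have [pg hg cg] := path; apply: mcontZ; apply: mcontM => //.
by apply: mcont_invmx; [exact: metric_path_unit|exact: mderiv_mcont hg].
Qed.

(** Symmetry of [m] and [h] makes each of the two terms one half of [h]. *)
Lemma half_gen_congr (m h : 'M[R]_7) : m^T = m -> h^T = h -> m \in unitmx ->
  let k := 2^-1 *: (h *m invmx m) in k *m m + m *m k^T = h.
Proof.
move=> mT hT um /=; rewrite linearZ /= trmx_mul trmx_inv mT hT -scalemxAl -scalemxAr mulmxKV//.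
by rewrite mulKVmx// -scalerDl (_ : 2^-1 + 2^-1 = 1) ?scale1r//; field.
Qed.

Lemma metric_path_flow F G : is_flow J (frame_gen g gd) F G ->
  forall t, J t -> g t = F t *m g 0 *m (F t)^T.
Proof.
move=> fl; apply: (flow_congr J_itv J0 fl) => t Jt; have [pg hg cg] := path.
have [gT _] := pg t Jt.
by rewrite half_gen_congr//; [exact: hg|exact: metric_path_dot_sym|exact: metric_path_unit].
Qed.

Lemma flow_unit (K F G : R -> 'M[R]_7) : is_flow J K F G -> forall t, J t -> F t \in unitmx.
Proof. by move=> fl t Jt; have [/mulmx1_unit[]] := flow_inv J_itv J0 fl Jt. Qed.

Lemma is_metric_of_flow F G w : is_flow J (frame_gen g gd) F G -> is_metric_of w (g 0) ->
  forall t, J t -> is_metric_of (pull3 (F t) w) (g t).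
Proof.
move=> fl hw t Jt; rewrite (metric_path_flow fl Jt).
by apply: is_metric_of_pull => //; exact: flow_unit fl _ Jt.
Qed.

Lemma flow_solves F G w : is_flow J (frame_gen g gd) F G -> is_metric_of w (g 0) ->
  forall t, J t -> forall a b c, has_deriv_within J (fun s => pull3 (F s) w a b c) t
    (3 / 2 * i_form (pull3 (F t) w) (gd t) a b c).
Proof.
move=> fl hw t Jt a b c; have hm := is_metric_of_flow fl hw Jt.
have alt : alternating3 (pull3 (F t) w).
  by apply: positive3_alternating; have [A [uA -> _]] := hm; exists A.
rewrite i_formE// (metric_ofE hm); have [_ _ hF _] := fl.
exact: pull3_flow_deriv (hF t Jt) a b c.
Qed.

(* The flow of [2^-1 *: (gd t *m invmx (metric_of (w t)))] moves [w 0] to [w t], hence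
   [metric_of (w 0)] to [metric_of (w t)], whose derivative is therefore [gd t]. *)
Lemma solution_metric (w : R -> form3) : (forall t, J t -> positive3 (w t)) ->
  (forall t, J t -> forall a b c, has_deriv_within J (fun s => w s a b c) t
    (3 / 2 * i_form (w t) (gd t) a b c)) ->
  metric_of (w 0) = g 0 -> forall t, J t -> metric_of (w t) = g t.
Proof.
move=> pw hw m0 t Jt; have [pg hg cg] := path.
have hm s : J s -> is_metric_of (w s) (metric_of (w s)) by move=> Js; exact/positive3_metric/pw.
have um s : J s -> metric_of (w s) \in unitmx.
  by move=> /hm[A [uA _ ->]]; rewrite unitmx_mul unitmx_tr uA.
have mT s : J s -> (metric_of (w s))^T = metric_of (w s).
  by move=> /hm[A [_ _ ->]]; rewrite trmx_mul trmxK.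
pose H s := 2^-1 *: (gd s *m invmx (metric_of (w s))).
have cH : mcont J H.
  apply: mcontZ; apply: mcontM => //; apply: mcont_invmx => //.
  apply: metric_of_cont => // a b c.
  by apply: (hd_within_cont (f' := fun s => 3 / 2 * i_form (w s) (gd s) a b c)) => s Js; exact: hw.
have [F [G fl]] := flow_exists J_itv J0 nJ cH.
have wE s : J s -> w s = pull3 (F s) (w 0).
  apply: (lie3_flow J_itv J0 fl) => r Jr a b c.
  by rewrite -i_formE; [exact: hw|exact/positive3_alternating/pw].
have mE s : J s -> F s *m metric_of (w 0) *m (F s)^T = metric_of (w s).
  move=> Js; rewrite (wE s Js); apply/esym/metric_ofE; apply: is_metric_of_pull.
    exact: flow_unit fl _ Js.
  exact: hm.
have hmd s : J s -> mderiv J (fun s => metric_of (w s)) s (gd s).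
  move=> Js; apply: (mderiv_eq Js mE); have [_ _ hF _] := fl.
  have := mderivM (mderivM (hF s Js) (@mderiv_cst R J 7 7 (metric_of (w 0)) s)) (mderivT (hF s Js)).
  congr mderiv; rewrite mulmx0 addr0 trmx_mul.
  rewrite -(half_gen_congr (mT s Js) (metric_path_dot_sym Js) (um s Js)) -/(H s) -(mE s Js).
  by rewrite !mulmxA.
apply/eqP; rewrite -subr_eq0; apply/eqP.
rewrite -(subrr (g 0)) -{1}m0.
apply: (@mderiv0_cst R J 7 7 (fun s => metric_of (w s) - g s) 0 t) => // s Js.
by rewrite -(subrr (gd s)); apply: mderivB; [exact: hmd|exact: hg].
Qed.

Lemma solution_flow F G (w : R -> form3) : is_flow J (frame_gen g gd) F G ->
  (forall t, J t -> positive3 (w t)) ->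
  (forall t, J t -> forall a b c, has_deriv_within J (fun s => w s a b c) t
    (3 / 2 * i_form (w t) (gd t) a b c)) ->
  metric_of (w 0) = g 0 -> forall t, J t -> w t = pull3 (F t) (w 0).
Proof.
move=> fl pw hw m0; apply: (lie3_flow J_itv J0 fl) => t Jt a b c.
rewrite /frame_gen -(solution_metric pw hw m0 Jt) -i_formE; first exact: hw.
exact/positive3_alternating/pw.
Qed.

(** Exhibits [F t1] as a positive square root of [g t1 *m invmx (g 0)], in the form that
    [self_adjoint_root_unique] requires. *)
Lemma flat_flow_root (t1 : R) F G (A : set 'M[R]_7) : flat_subspace A -> 0 <= t1 -> J t1 ->
  (forall t, 0 <= t <= t1 -> A (g t)) -> is_flow J (frame_gen g gd) F G ->
  exists T, [/\ F t1 = T *m T, T \in unitmx, self_adjoint (g 0) T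
    & F t1 *m F t1 = g t1 *m invmx (g 0)].
Proof.
move=> flatA t10 Jt1 Ag fl; have [pg hg cg] := path; have [F0 _ _ _] := fl.
(* At [t1 = 0] the segment is degenerate and derivatives on it are not unique; there the flow is the
   identity. *)
have [->|t1n] := eqVneq t1 0.
  by exists 1%:M; rewrite F0 !mulmx1 unitmx1 mulmxV ?metric_path_unit// /self_adjoint trmx1 mul1mx mulmx1.
have t1p : 0 < t1 by rewrite lt_def t1n.
have sub : `[0, t1] `<=` J by exact: segment_sub.
have segE t : `[0, t1]%classic t -> 0 <= t <= t1 by rewrite /= in_itv.
have cL : mcont `[0, t1] (fun t => gd t *m invmx (g t)).
  apply: (mcont_sub sub); apply: mcontM => //.
  by apply: mcont_invmx; [exact: metric_path_unit|exact: mderiv_mcont hg].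
have fl1 := is_flow_sub sub fl.
have sc s t : `[0, t1]%classic s -> `[0, t1]%classic t ->
    g s *m invmx (g 0) *m (g t *m invmx (g 0)) = g t *m invmx (g 0) *m (g s *m invmx (g 0)).
  move=> /segE hs /segE ht; apply: flat_commute (Ag _ hs) (Ag _ ht) _ => //.
    by apply: Ag; rewrite lexx.
  exact: metric_path_unit.
have [F' [G' [T [fl' FT sT FS]]]] := commuting_flow_root t1p
  (fun t h => mderiv_sub sub (hg t (sub t h))) (fun t h => metric_path_unit (sub t h))
  (fun t h => (pg t (sub t h)).1) cL sc.
have I1 : `[0, t1]%classic t1 by rewrite /= in_itv /= lexx t10.
have I0 : `[0, t1]%classic (0 : R) by rewrite /= in_itv /= lexx t10.
have FE : F t1 = F' t1.
  have [_ _ hF _] := fl1.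
  by rewrite (@flow_unique R _ 7 7 _ _ _ F (@is_interval_segment R 0 t1) I0 fl' hF t1 I1) F0 mulmx1.
exists (T t1); rewrite FE; have [e1 e2] := FT t1 I1; split=> //; [exact: sT|exact: FS].
Qed.

End Path.

(** The two paths may have different time intervals and end times; what is compared is two positive
    roots of the same endomorphism [g t1 *m invmx (g 0)]. *)
Lemma flat_flow_unique J J' g g' gd gd' F F' G G' (t1 t1' : R) (A : set 'M[R]_7) (w : form3) :
  is_interval J -> J 0 -> metric_path J g gd ->
  is_interval J' -> J' 0 -> metric_path J' g' gd' ->
  is_flow J (frame_gen g gd) F G -> is_flow J' (frame_gen g' gd') F' G' ->
  is_metric_of w (g 0) -> flat_subspace A ->
  0 <= t1 -> J t1 -> (forall t, 0 <= t <= t1 -> A (g t)) ->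
  0 <= t1' -> J' t1' -> (forall t, 0 <= t <= t1' -> A (g' t)) ->
  g' 0 = g 0 -> g' t1' = g t1 -> F' t1' = F t1.
Proof.
move=> iJ J0 pJ iJ' J0' pJ' fl fl' [B [uB _ gB]] fA t0 Jt At t0' Jt' At' e0 e1.
have [T [TE uT sT TS]] := flat_flow_root iJ J0 pJ fA t0 Jt At fl.
have [X [XE uX sX XS]] := flat_flow_root iJ' J0' pJ' fA t0' Jt' At' fl'.
rewrite TE XE; rewrite e0 e1 in sX XS.
by apply: (self_adjoint_root_unique gB uB sX sT uX); rewrite -TE -XE TS XS.
Qed.

End MetricPaths.

(** Congruent metrics have conjugate generators, so [P *m F'] solves the equation of [F]. With [P] a
    Jacobian this is the change of chart. *)
Lemma flow_conj (R : realType) (J : set R) (g gd g' gd' F G F' G' : R -> 'M[R]_7) (P : 'M[R]_7) :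
  is_interval J -> J 0 -> (exists2 t, J t & t != 0) ->
  metric_path J g gd -> metric_path J g' gd' -> P \in unitmx ->
  (forall t, J t -> g t = P *m g' t *m P^T) ->
  is_flow J (frame_gen g gd) F G -> is_flow J (frame_gen g' gd') F' G' ->
  forall t, J t -> F t *m P = P *m F' t.
Proof.
move=> iJ J0 nJ pg pg' uP gE fl fl' t Jt.
have uPT : P^T \in unitmx by rewrite unitmx_tr.
have dE s : J s -> gd s = P *m gd' s *m P^T.
  move=> Js; have [_ hg _] := pg; have [_ hg' _] := pg'.
  have PJ : ProperFilter (within J s^') by exact: itv_within_proper0.
  apply: (mderiv_unique PJ (hg s Js)).
  apply: (mderiv_eq Js (F := fun s => P *m g' s *m P^T)) => [r Jr|]; first by rewrite gE.
  have := mderivM (mderivM (@mderiv_cst R J 7 7 P s) (hg' s Js)) (@mderiv_cst R J 7 7 P^T s).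
  by rewrite mul0mx add0r mulmx0 addr0.
have KE s : J s -> frame_gen g gd s *m P = P *m frame_gen g' gd' s.
  move=> Js; rewrite /frame_gen -scalemxAl -scalemxAr; congr (_ *: _).
  have ug := metric_path_unit pg Js; have ug' := metric_path_unit pg' Js.
  have e : P *m (gd' s *m invmx (g' s)) *m invmx P = gd s *m invmx (g s).
    apply: (can_inj (mulmxK ug)); rewrite mulmxKV// gE// dE//.
    by rewrite -!mulmxA (mulmxA (invmx P)) mulVmx// mul1mx (mulmxA (invmx _)) mulVmx// mul1mx.
  by rewrite -e mulmxKV.
have [F0' _ hF' _] := fl'.
have := @flow_unique R J 7 7 _ _ _ (fun s => P *m F' s) iJ J0 fl _ t Jt.
rewrite F0' mulmx1 => -> // s Js.
have := mderivM (@mderiv_cst R J 7 7 P s) (hF' s Js).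
by rewrite mul0mx add0r mulmxA -KE// mulmxA.
Qed.

(** * Auxiliary facts on smooth families *)

Section SmoothFamilies.
Context {R : realType}.

Lemma Ck_pull3 n k (D : set 'rV[R]_n) (A : 'rV[R]_n -> 'M[R]_7) (w : 'rV[R]_n -> form3) :
  (forall p q, Ck_on k D (fun y => A y p q)) ->
  (forall a b c, Ck_on k D (fun y => w y a b c)) ->
  forall a b c, Ck_on k D (fun y => pull3 (A y) (w y) a b c).
Proof.
by move=> hA hw a b c; do 3 (apply: Ck_sum => ?); do !apply: CkM.
Qed.

Lemma Ck_time_hd n (J : set R) (U : set 'rV[R]_n) (f : R -> 'rV[R]_n -> R) y :
  Ck_on 1 (cyl J U) (tfun f) -> U y ->
  exists f', forall t, J t -> has_deriv_within J (f^~ y) t (f' t).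
Proof.
move=> [_ /(_ (lshift n 0))[f' [hf' _]]] Uy.
exists (fun t => f' (tpair t y)) => t Jt.
by apply/(hp_time _ _ _ _ _ Uy); apply: hf'; apply/cylE.
Qed.

Lemma open_within_preimage (S T : topologicalType) (A : set S) (B : set T) (f : S -> T) :
  open A -> open B -> {within A, continuous f} -> open (A `&` f @^-1` B).
Proof.
move=> oA oB /subspace_continuousP cf; rewrite openE => y [Ay By].
have h : \forall z \near y, A z -> B (f z).
  exact: (cf y Ay) (open_nbhs_nbhs (conj oB By)).
have h' : \forall z \near y, A z by exact: open_nbhs_nbhs (conj oA Ay).
rewrite /interior; near=> z; have Az : A z by near: z.
by split=> //; apply: (near h z).
Unshelve. all: by end_near. Qed.

End SmoothFamilies.

(** * Tensor fields on the manifold *)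

Section OnManifold.
Context {R : realType} {M : topologicalType} {X : oriented_atlas R M}.

Notation dom := Defs.dom.
Notation coord := Defs.coord.

Lemma image_par (i : chart X) y : (coord i @` dom i) y -> dom i (par i y) /\ coord i (par i y) = y.
Proof. by move=> [x dx <-]; rewrite coordK. Qed.

Lemma jac_unit (i j : chart X) x : dom i x -> dom j x -> jac i j x \in unitmx.
Proof. by move=> hi hj; rewrite unitmxE unitfE gt_eqF// /jac transition_oriented. Qed.

Section MetricFamily.
Variables (J : set R) (g : R -> tensor2 X).
Hypothesis J_itv : is_interval J.
Hypothesis J0 : J 0.
Hypothesis nJ : exists2 t, J t & t != 0.
Hypothesis g_smooth : smooth_metric_family J g.

Let PJ t : J t -> ProperFilter (within J t^').
Proof. exact: itv_within_proper0. Qed.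

Let Ck_metric k (i : chart X) a b :
  Ck_on k (cyl J (coord i @` dom i)) (tfun (fun t y => g t i (par i y) a b)).
Proof. by have [_ /(_ i a b k)] := g_smooth. Qed.

Let metric_hd (i : chart X) x t : dom i x -> J t ->
  mderiv J (fun s => g s i x) t (metric_dot J g t i x).
Proof.
move=> dx Jt a b; rewrite mxE.
have Ux : (coord i @` dom i) (coord i x) by exists x.
have [f' hf'] := Ck_time_hd (Ck_metric 1 i a b) Ux; rewrite coordK// in hf'.
(* The limit exists by smoothness, so [deriv_within] is the derivative and not a default value of
   [lim]. *)
by rewrite (deriv_withinE (PJ Jt) (hf' t Jt)); exact: hf'.
Qed.

Let Ck_metric_dot k (i : chart X) a b :
  Ck_on k (cyl J (coord i @` dom i)) (tfun (fun t y => metric_dot J g t i (par i y) a b)).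
Proof.
apply: (Ck_time_deriv PJ _ (Ck_metric k.+1 i a b)) => t y Jt /image_par[dy _].
exact: metric_hd.
Qed.

Lemma metric_family_path (i : chart X) x : dom i x ->
  metric_path J (fun t => g t i x) (fun t => metric_dot J g t i x).
Proof.
move=> dx; split=> [t Jt|t Jt|a b].
- by have [/(_ t Jt)[_ _ h] _] := g_smooth; exact: h.
- exact: metric_hd.
have Ux : (coord i @` dom i) (coord i x) by exists x.
have [f' hf'] := Ck_time_hd (Ck_metric_dot 1 i a b) Ux; rewrite coordK// in hf'.
exact: hd_within_cont hf'.
Qed.

Definition metric_gen (i : chart X) (x : M) : R -> 'M[R]_7 :=
  frame_gen (fun t => g t i x) (fun t => metric_dot J g t i x).

Lemma metric_flow_exists (i : chart X) x : dom i x -> exists F G, is_flow J (metric_gen i x) F G.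
Proof.
move=> dx; apply: flow_exists => //.
exact: frame_gen_cont (metric_family_path dx).
Qed.

Lemma Ck_metric_gen k (i : chart X) a b :
  Ck_on k (cyl J (coord i @` dom i)) (tfun (fun t y => metric_gen i (par i y) t a b)).
Proof.
have h := @Ck_mulmx R _ k (cyl J (coord i @` dom i)) 7 7 7
  (tfun (fun t y => metric_dot J g t i (par i y)))
  (tfun (fun t y => invmx (g t i (par i y)))) (Ck_metric_dot k i)
  (@Ck_invmx R _ k (cyl J (coord i @` dom i)) 7 (tfun (fun t y => g t i (par i y))) _ (Ck_metric k i)) a b.
apply: (Ck_eq _ (CkM (Ck_cst k _ 2^-1) (h _))) => [z _|z [Jz /image_par[dz _]]].
  by rewrite /tfun /metric_gen /frame_gen [in RHS]mxE.
exact: (metric_path_unit (metric_family_path dz) Jz).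
Qed.

Lemma Ck_metric_flow k (i : chart X) (F G : M -> R -> 'M[R]_7) :
  (forall x, dom i x -> is_flow J (metric_gen i x) (F x) (G x)) -> forall a b,
  Ck_on k (cyl J (coord i @` dom i)) (tfun (fun t y => F (par i y) t a b)).
Proof.
move=> fl a b; apply: (@flow_Ck R J 7 _ J_itv J0 nJ (@coord_open _ _ X i) k 7
  (fun t y => metric_gen i (par i y) t) (fun t y => F (par i y) t)).
  exact: Ck_metric_gen.
by move=> y /image_par[dy _]; have [F0 _ hF _] := fl _ dy.
Qed.

(** Gives the transported forms their transformation law between charts. *)
Lemma metric_flow_jac (i j : chart X) x F G F' G' : dom i x -> dom j x ->
  is_flow J (metric_gen i x) F G -> is_flow J (metric_gen j x) F' G' ->
  forall t, J t -> F t *m jac i j x = jac i j x *m F' t.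
Proof.
move=> di dj fl fl'; apply: (flow_conj J_itv J0 nJ (metric_family_path di)
  (metric_family_path dj) (jac_unit di dj) _ fl fl') => t Jt.
by have [/(_ t Jt)[/(_ i j x di dj)]] := g_smooth.
Qed.

(** A formula for every solution at a single point of a chart; uniqueness and the statement on flats
    both follow from it. *)
Lemma solution_flowE (w : tensor3 X) (W : R -> tensor3 X) (i : chart X) x F G :
  solution J g w W -> dom i x -> is_metric_of (w i x) (g 0 i x) ->
  is_flow J (metric_gen i x) F G -> forall t, J t -> W t i x = pull3 (F t) (w i x).
Proof.
move=> [pW hW W0] dx hw fl t Jt; rewrite -(W0 i x dx).
apply: (solution_flow J_itv J0 nJ (metric_family_path dx) fl _ _ _ Jt (w := fun t => W t i x)).
- by move=> s Js; have [_] := pW s Js; exact.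
- by move=> s Js a b c; exact: hW.
- by rewrite (W0 i x dx); exact: metric_ofE.
Qed.

End MetricFamily.

(** * The fundamental form of a G_2-structure *)

Section FundamentalForm.
Variables (P : chart X -> M -> set 'M[R]_7) (g : tensor2 X) (w : tensor3 X).
Hypothesis P_G2 : G2_structure P.
Hypothesis P_metric : underlying_metric P g.
Hypothesis P_form : fundamental_form P w.

Lemma G2_1 : G2 (1%:M : 'M[R]_7).
Proof. by split; [exact: unitmx1|exact: pull3_1]. Qed.

Lemma G2_frame_exists (i : chart X) x : dom i x -> exists E, P i x E.
Proof.
move=> dx; have [_ _ /(_ x)[U [e [_ Ux _ /(_ i x Ux dx) ->]]]] := P_G2.
by exists (1%:M *m e i x), 1%:M => //; exact: G2_1.
Qed.

Lemma G2_frame_unit (i : chart X) x E : dom i x -> P i x E -> E \in unitmx.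
Proof.
by move=> dx PE; have [_ /(_ i x dx E PE) h _] := P_G2; rewrite unitmxE unitfE gt_eqF.
Qed.

Lemma fundamental_formE (i : chart X) x E : dom i x -> P i x E -> w i x = pull3 (invmx E) phi0.
Proof.
by move=> dx PE; rewrite -(P_form dx PE) pull3K//; exact: G2_frame_unit PE.
Qed.

(** For an adapted frame [E], the same matrix [invmx E] expresses the form through [phi0] and, by
    orthonormality, the metric through the identity. *)
Lemma fundamental_form_metric (i : chart X) x : dom i x -> is_metric_of (w i x) (g i x).
Proof.
move=> dx; have [E PE] := G2_frame_exists dx; have uE := G2_frame_unit dx PE.
exists (invmx E); split; [by rewrite unitmx_inv|exact: fundamental_formE|].
have := P_metric dx PE; rewrite /orthonormal_frame => h.
have uET : E^T \in unitmx by rewrite unitmx_tr.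
apply: (can_inj (mulKmx uE)); apply: (can_inj (mulmxK uET)).
by rewrite h mulKVmx// trmx_inv mulVmx.
Qed.

Lemma fundamental_form_positive (i : chart X) x : dom i x -> positive3 (w i x).
Proof. by move=> /fundamental_form_metric[A [uA -> _]]; exists A. Qed.

(** The form is specified only through its values on adapted frames. The transformation law comes
    from that of the frames; smoothness comes from local smooth frames [e], where the form is the
    pullback of the constant [phi0] by [invmx e], and is then glued. *)
Lemma fundamental_form_three_form : three_form w.
Proof.
split.
- move=> i j x di dj; have [E PE] := G2_frame_exists di.
  have uE := G2_frame_unit di PE.
  have PE' : P j x (E *m jac i j x).
    by have [/(_ i j x di dj) -> _ _] := P_G2; exists E.
  by rewrite -[LHS](pull3K _ uE) (P_form di PE) -(P_form dj PE') pull3M pull3K.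
- move=> i a b c k; rewrite setIT.
  apply: Ck_glue; first exact: coord_open.
  move=> y /image_par[dy cy]; have [_ _ /(_ (par i y))[U [e [oU Uy [_ se _] PE]]]] := P_G2.
  exists (coord i @` dom i `&` par i @^-1` U); split.
  + by apply: open_within_preimage => //; [exact: coord_open|exact: par_continuous].
  + by split=> //; exists (par i y).
  + by move=> z [].
  have VE : coord i @` dom i `&` par i @^-1` U `<=` coord i @` (dom i `&` U).
    by move=> z [[x dx <-]]; rewrite /= coordK// => Ux; exists x.
  have dU z : (coord i @` dom i `&` par i @^-1` U) z -> dom i (par i z) /\ P i (par i z) (e i (par i z)).
    move=> [/image_par[dz _] Uz]; split=> //; rewrite PE//.
    by exists 1%:M; [exact: G2_1|rewrite mul1mx].
  have ce p q : Ck_on k (coord i @` dom i `&` par i @^-1` U) (fun z => e i (par i z) p q).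
    exact: Ck_sub VE (se i p q k).
  have ci := Ck_invmx (fun z h => G2_frame_unit (dU z h).1 (dU z h).2) ce.
  have := @Ck_pull3 R _ k _ (fun z => invmx (e i (par i z))) (fun=> phi0) ci
    (fun a b c => Ck_cst k _ (phi0 a b c)) a b c.
  by apply: Ck_eq => z /dU[dz Pz]; rewrite /= (fundamental_formE dz Pz).
- by move=> i x dx; exact/positive3_alternating/fundamental_form_positive.
Qed.

End FundamentalForm.

(** * Existence and uniqueness of solutions *)

Section Existence.
Variables (J : set R) (g : R -> tensor2 X) (w : tensor3 X).
Hypothesis J_itv : is_interval J.
Hypothesis J0 : J 0.
Hypothesis nJ : exists2 t, J t & t != 0.
Hypothesis g_smooth : smooth_metric_family J g.
Hypothesis w_form : three_form w.
Hypothesis w_metric : forall i x, dom i x -> is_metric_of (w i x) (g 0 i x).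

Lemma flow_form_family (F G : chart X -> M -> R -> 'M[R]_7) :
  (forall i x, dom i x -> is_flow J (metric_gen J g i x) (F i x) (G i x)) ->
  smooth_form_family J (fun t i x => pull3 (F i x t) (w i x)).
Proof.
move=> fl; have [w_jac w_smooth w_alt] := w_form.
have sm k i a b c : Ck_on k (cyl J (coord i @` dom i))
    (tfun (fun t y => pull3 (F i (par i y) t) (w i (par i y)) a b c)).
  apply: (@Ck_pull3 R _ k _ (tfun (fun t y => F i (par i y) t)) (tfun (fun _ y => w i (par i y)))).
    exact: Ck_metric_flow (fl i).
  move=> p q r; apply: (@Ck_space R 7 J (coord i @` dom i) k (fun y => w i (par i y) p q r)).
  by have := w_smooth i p q r k; rewrite setIT.
split=> [t Jt|i a b c k]; last exact: sm.
split.
- move=> i j x di dj; rewrite (w_jac i j x di dj) -!pull3M.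
  by rewrite (metric_flow_jac J_itv J0 nJ g_smooth di dj (fl i x di) (fl j x dj) Jt).
- by move=> i a b c k; rewrite setIT; exact: Ck_slice Jt (sm k i a b c).
- by move=> i x dx; exact/pull3_alternating/w_alt.
Qed.

Lemma solution_exists : exists W : R -> tensor3 X, [/\ solution J g w W, smooth_form_family J W
  & forall W', solution J g w W' -> forall t, J t -> same3 (W' t) (W t)].
Proof.
(* Flows are chosen independently for each chart and point. Uniqueness of flows makes the choices
   compatible, and their regularity in parameters makes them smooth in the point. *)
have /choice[FG fl] : forall ix : chart X * M, exists FG : (R -> 'M[R]_7) * (R -> 'M[R]_7),
    dom ix.1 ix.2 -> is_flow J (metric_gen J g ix.1 ix.2) FG.1 FG.2.
  move=> [i x]; have [dx|ndx] := pselect (dom i x); last by exists (fun=> 0, fun=> 0).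
  by have [F [G h]] := metric_flow_exists J_itv J0 nJ g_smooth dx; exists (F, G).
pose F i x := (FG (i, x)).1.
have flF i x : dom i x -> is_flow J (metric_gen J g i x) (F i x) (FG (i, x)).2 by exact: (fl (i, x)).
have smF := flow_form_family flF.
exists (fun t i x => pull3 (F i x t) (w i x)); split=> //.
- split.
  + move=> t Jt; split; first exact: smF.1.
    move=> i x dx; apply: positive3_pull.
      exact: (flow_unit J_itv J0 (flF i x dx) Jt).
    by have [A [uA -> _]] := w_metric dx; exists A.
  + move=> t Jt i x dx a b c.
    exact: (flow_solves J_itv J0 nJ (metric_family_path J_itv J0 nJ g_smooth dx) (flF i x dx) (w_metric dx) Jt).
  + by move=> i x dx; have [F0 _ _ _] := flF i x dx; rewrite F0 pull3_1.
- move=> W' sW' t Jt i x dx.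
  exact: (solution_flowE J_itv J0 nJ g_smooth sW' dx (w_metric dx) (flF i x dx) Jt).
Qed.

End Existence.

(** At each point both solutions move the same form [w i x] by flows whose end values agree; the
    flats at different points never interact. *)
Lemma flat_solution_unique (A : chart X -> M -> set 'M[R]_7) (w : tensor3 X)
    (J : set R) (g : R -> tensor2 X) (t1 : R) (W : R -> tensor3 X)
    (J' : set R) (g' : R -> tensor2 X) (t1' : R) (W' : R -> tensor3 X) :
  maximal_flats A -> (forall i x, dom i x -> is_metric_of (w i x) (g 0 i x)) ->
  is_interval J -> J 0 -> (exists2 t, J t & t != 0) -> smooth_metric_family J g ->
  0 <= t1 -> J t1 -> (forall t, 0 <= t <= t1 -> in_flats A (g t)) ->
  is_interval J' -> J' 0 -> (exists2 t, J' t & t != 0) -> smooth_metric_family J' g' ->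
  0 <= t1' -> J' t1' -> (forall t, 0 <= t <= t1' -> in_flats A (g' t)) ->
  same2 (g' 0) (g 0) -> same2 (g' t1') (g t1) ->
  solution J g w W -> solution J' g' w W' -> same3 (W' t1') (W t1).
Proof.
move=> [_ flatA] hw iJ J0 nJ sg t0 Jt Ag iJ' J0' nJ' sg' t0' Jt' Ag' e0 e1 sW sW' i x dx.
have [F [G fl]] := metric_flow_exists iJ J0 nJ sg dx.
have [F' [G' fl']] := metric_flow_exists iJ' J0' nJ' sg' dx.
have hw' : is_metric_of (w i x) (g' 0 i x) by rewrite (e0 i x dx); exact: hw.
rewrite (solution_flowE iJ J0 nJ sg sW dx (hw i x dx) fl Jt).
rewrite (solution_flowE iJ' J0' nJ' sg' sW' dx hw' fl' Jt').
have [fA _] := flatA i x dx.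
congr (pull3 _ _).
apply: (flat_flow_unique iJ J0 (metric_family_path iJ J0 nJ sg dx) iJ' J0'
  (metric_family_path iJ' J0' nJ' sg' dx) fl fl' (hw i x dx) fA t0 Jt _ t0' Jt') => //.
- by move=> t ht; exact: Ag.
- by move=> t ht; exact: Ag'.
- exact: e0.
- exact: e1.
Qed.

End OnManifold.

Theorem corollary0p4 (R : realType) (M : topologicalType)
    (X : oriented_atlas R M)
    (M_hausdorff : hausdorff_space M) (M_countable : @second_countable M)
    (M_compact : compact [set: M]) (M_connected : connected [set: M])
    (M_spin : spin_manifold X)
    (J : set R) (J_itv : is_interval J) (J0 : J 0)
    (J_nondegenerate : exists2 t, J t & t != 0)
    (g : R -> tensor2 X) (g_smooth : smooth_metric_family J g)
    (w : tensor3 X)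
    (w_G2 : exists P, [/\ G2_structure P, underlying_metric P (g 0)
                        & fundamental_form P w]) :
  (exists W : R -> tensor3 X,
     [/\ solution J g w W, smooth_form_family J W
       & forall W', solution J g w W' ->
           forall t, J t -> same3 (W' t) (W t)])
  /\
  (forall (F : chart X -> M -> set 'M[R]_7) (t1 : R),
     maximal_flats F -> 0 <= t1 -> J t1 ->
     (forall t, 0 <= t <= t1 -> in_flats F (g t)) ->
     forall (J' : set R) (g' : R -> tensor2 X) (t1' : R),
       is_interval J' -> J' 0 -> (exists2 t, J' t & t != 0) ->
       smooth_metric_family J' g' ->
       0 <= t1' -> J' t1' ->
       (forall t, 0 <= t <= t1' -> in_flats F (g' t)) ->
       same2 (g' 0) (g 0) -> same2 (g' t1') (g t1) ->
       forall W W' : R -> tensor3 X,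
         solution J g w W -> solution J' g' w W' ->
         same3 (W' t1') (W t1)).
Proof.
have [P [P_G2 P_metric P_form]] := w_G2.
have hw i x : Defs.dom i x -> is_metric_of (w i x) (g 0 i x).
  exact: fundamental_form_metric P_G2 P_metric P_form i x.
split.
  apply: solution_exists => //.
  exact: fundamental_form_three_form P_G2 P_metric P_form.
move=> F t1 mF t0 Jt inF J' g' t1' iJ' J0' nJ' sg' t0' Jt' inF' e0 e1 W W' sW sW'.
exact: (flat_solution_unique mF hw J_itv J0 J_nondegenerate g_smooth t0 Jt inF
  iJ' J0' nJ' sg' t0' Jt' inF' e0 e1 sW sW').
Qed.
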